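(* There is an algorithm that, given a connected graph $G$ with $n$ vertices, $m$ edges and maximum degree $\Delta(G)$ such that $G$ does not admit a $1$-join, in $O(nm(\Delta(G)+\alpha(m,\Delta(G))))$ time either finds a generalized $2$-join of $G$ or reports that $G$ has no generalized $2$-join.
   Context: $\alpha(\cdot,\cdot)$ is the inverse Ackermann function. A $1$-join of $G$ is a partition $(V_1,V_2)$ of $V(G)$ with sets $A_1\subseteq V_1$, $A_2\subseteq V_2$ such that $A_1\cup A_2$ is a clique, $V_1\setminus A_1$ has no neighbor in $V_2$, $V_2\setminus A_2$ has no neighbor in $V_1$, and $A_i\neq\emptyset$, $V_i\setminus A_i\neq\emptyset$ for $i=1,2$. A generalized $2$-join of $G$ is a partition $(V_0,V_1,V_2)$ of $V(G)$ together with, for $i=1,2$, disjoint sets $A_i,B_i\subseteq V_i$ such that $V_0\cup A_1\cup A_2$ and $V_0\cup B_1\cup B_2$ are cliques, every edge of $G$ whose endpoints lie in two different sets among $V_0,V_1,V_2$ has both endpoints in $V_0\cup A_1\cup A_2$ or both in $V_0\cup B_1\cup B_2$, and $A_i$, $B_i$, $V_i\setminus(A_i\cup B_i)$ are nonempty for $i=1,2$. *)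

(* Defs.v *)
From mathcomp Require Import all_boot.

Set Implicit Arguments.
Unset Strict Implicit.
Unset Printing Implicit Defensive.

Record sgraph (T : finType) := SGraph {
  adj :> rel T;
  adj_sym : symmetric adj;
  adj_irr : irreflexive adj
}.

Section Graphs.
Variables (T : finType) (G : sgraph T).
Implicit Types A B K V : {set T}.

Definition edges : {set {set T}} := [set [set p.1; p.2] | p : T * T & G p.1 p.2].

Definition num_edges : nat := #|edges|.

Definition max_degree : nat := \max_(x : T) #|[set y | G x y]|.

Definition connected : Prop := forall x y, connect G x y.

Definition clique K : Prop := {in K &, forall x y, x != y -> G x y}.

Definition anticomplete A B : Prop := {in A & B, forall x y, ~~ G x y}.

Record one_join V1 V2 A1 A2 : Prop := OneJoin {
  oj_cover : V1 :|: V2 = setT;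
  oj_disjoint : [disjoint V1 & V2];
  oj_sub : A1 \subset V1 /\ A2 \subset V2;
  oj_clique : clique (A1 :|: A2);
  oj_rest1 : anticomplete (V1 :\: A1) V2;
  oj_rest2 : anticomplete (V2 :\: A2) V1;
  oj_nonempty : [/\ A1 != set0, A2 != set0, V1 :\: A1 != set0
                  & V2 :\: A2 != set0]
}.

Definition admits_one_join : Prop :=
  exists V1 V2 A1 A2, one_join V1 V2 A1 A2.

(* [V0] may be empty. *)
Record generalized_two_join V0 V1 V2 A1 B1 A2 B2 : Prop := GeneralizedTwoJoin {
  gj_cover : V0 :|: V1 :|: V2 = setT;
  gj_disjoint : [/\ [disjoint V0 & V1], [disjoint V0 & V2]
                  & [disjoint V1 & V2]];
  gj_sub1 : [/\ A1 \subset V1, B1 \subset V1 & [disjoint A1 & B1]];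
  gj_sub2 : [/\ A2 \subset V2, B2 \subset V2 & [disjoint A2 & B2]];
  gj_cliqueA : clique (V0 :|: A1 :|: A2);
  gj_cliqueB : clique (V0 :|: B1 :|: B2);
  gj_crossing : forall x y, G x y ->
    ~~ [|| (x \in V0) && (y \in V0), (x \in V1) && (y \in V1)
         | (x \in V2) && (y \in V2)] ->
    [set x; y] \subset V0 :|: A1 :|: A2 \/ [set x; y] \subset V0 :|: B1 :|: B2;
  gj_nonempty1 : [/\ A1 != set0, B1 != set0 & V1 :\: (A1 :|: B1) != set0];
  gj_nonempty2 : [/\ A2 != set0, B2 != set0 & V2 :\: (A2 :|: B2) != set0]
}.

Definition admits_generalized_two_join : Prop :=
  exists V0 V1 V2 A1 B1 A2 B2, generalized_two_join V0 V1 V2 A1 B1 A2 B2.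

End Graphs.

(* With [A i j] = [ackermann i.-1 j] for [1 <= i] and [1 <= j], this is Tarjan's
     A 1 j = 2 ^ j,  A i 1 = A (i - 1) 2,  A i j = A (i - 1) (A i (j - 1)),
   the last two equations being the unfolding of the iteration from 2. *)
Fixpoint ackermann (i j : nat) : nat :=
  if i is i'.+1 then iter j (ackermann i') 2 else 2 ^ j.

Lemma ltn_ackermann i j : j < ackermann i j.
Proof.
elim: i j => [|i IHi] j /=; first exact: ltn_expl.
elim: j => [//|j IHj]; rewrite iterS.
exact: leq_ltn_trans IHj (IHi _).
Qed.

Lemma ackermann_inc i j : ackermann i.+1 j < ackermann i.+1 j.+1.
Proof. by rewrite /= ltn_ackermann. Qed.

Lemma ackermann_unbounded n j : 0 < j -> n < 2 ^ ackermann n.+1 j.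
Proof.
have A2 i : i < ackermann i 2.
  elim: i => [//|i IHi]; apply: leq_ltn_trans IHi _.
  exact: ltn_ackermann.
case: j => // j _; apply: leq_ltn_trans (ltnW (A2 n)) _.
apply: (@leq_ltn_trans (ackermann n.+1 j.+1)); last exact: ltn_expl.
elim: j => [//|j IHj]; exact: leq_trans IHj (ltnW (ackermann_inc _ _)).
Qed.

Lemma inv_ackermann_subproof m n :
  exists i, n < 2 ^ ackermann i (maxn 1 (m %/ n)).
Proof. by exists n.+1; apply: ackermann_unbounded; rewrite leq_max. Qed.

(* Tarjan's min {i >= 1 | A i (floor (m / n)) > log2 n}.  It is usually defined
   only for [1 <= n <= m], where the [maxn 1] is immaterial. *)
Definition inv_ackermann (m n : nat) : nat :=
  (ex_minn (inv_ackermann_subproof m n)).+1.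

(* Structured programs for a random access machine: finitely many registers
   (those named in the program) and a memory with indirect addressing. *)
Inductive binop := Add | Sub | Mul | Ltn | Eqn.

Definition eval_binop (o : binop) (a b : nat) : nat :=
  match o with
  | Add => a + b
  | Sub => a - b
  | Mul => a * b
  | Ltn => a < b
  | Eqn => a == b
  end.

Inductive cmd :=
| Const (r v : nat)                (* r := v *)
| Op (o : binop) (r x y : nat)     (* r := x o y *)
| Fetch (r x : nat)                 (* r := mem[x] *)
| Store (x y : nat)                (* mem[x] := y *)
| Seq (c1 c2 : cmd)
| If (x : nat) (c1 c2 : cmd)       (* tests x <> 0 *)
| While (x : nat) (c : cmd).       (* tests x <> 0 *)

Record state := State { reg : nat -> nat; mem : nat -> nat }.

Definition upd (f : nat -> nat) (a v : nat) : nat -> nat :=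
  fun b => if b == a then v else f b.

Definition set_reg (s : state) (r v : nat) : state :=
  State (upd (reg s) r v) (mem s).

Definition set_mem (s : state) (a v : nat) : state :=
  State (reg s) (upd (mem s) a v).

(* [exec W c s s' t]: started in [s], [c] halts in [s'] after [t] unit-cost
   steps, every computed word being smaller than [W].  There is no rule for an
   overflowing operation, so such a run is stuck. *)
Inductive exec (W : nat) : cmd -> state -> state -> nat -> Prop :=
| exec_const r v s : v < W -> exec W (Const r v) s (set_reg s r v) 1
| exec_op o r x y s : eval_binop o (reg s x) (reg s y) < W ->
    exec W (Op o r x y) s (set_reg s r (eval_binop o (reg s x) (reg s y))) 1
| exec_fetch r x s : exec W (Fetch r x) s (set_reg s r (mem s (reg s x))) 1
| exec_store x y s : exec W (Store x y) s (set_mem s (reg s x) (reg s y)) 1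
| exec_seq c1 c2 s1 s2 s3 t1 t2 :
    exec W c1 s1 s2 t1 -> exec W c2 s2 s3 t2 ->
    exec W (Seq c1 c2) s1 s3 (t1 + t2)
| exec_if_true x c1 c2 s s' t : reg s x != 0 ->
    exec W c1 s s' t -> exec W (If x c1 c2) s s' t.+1
| exec_if_false x c1 c2 s s' t : reg s x = 0 ->
    exec W c2 s s' t -> exec W (If x c1 c2) s s' t.+1
| exec_while_true x c s1 s2 s3 t1 t2 : reg s1 x != 0 ->
    exec W c s1 s2 t1 -> exec W (While x c) s2 s3 t2 ->
    exec W (While x c) s1 s3 (t1 + t2).+1
| exec_while_false x c s : reg s x = 0 -> exec W (While x c) s s 1.

(* [es] lists every edge of [G] exactly once, in one of its two orientations,
   in any order. *)
Definition edge_list (n : nat) (G : sgraph 'I_n) (es : seq ('I_n * 'I_n)) : Prop :=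
  [/\ uniq es,
      forall x y, (x, y) \in es -> G x y
    & forall x y, G x y -> ((x, y) \in es) (+) ((y, x) \in es)].

(* Memory initially holds n, m, u_1, v_1, ..., u_m, v_m, then zeros. *)
Definition input (n : nat) (es : seq ('I_n * 'I_n)) : state :=
  State (fun=> 0)
    (nth 0 [:: n, size es & flatten [seq [:: val p.1; val p.2] | p <- es]]).

(* After a run, cell 0 is the answer and cell [v.+1] the label of vertex [v]. *)
Definition answer (s : state) : nat := mem s 0.

Definition part (n : nat) (s : state) (l : nat) : {set 'I_n} :=
  [set v : 'I_n | mem s v.+1 == l].

(* Labels: 0 is V0; 1, 2, 3 are A1, B1, V1 \ (A1 u B1); 4, 5, 6 are A2, B2,
   V2 \ (A2 u B2). *)
Definition output_two_join (n : nat) (G : sgraph 'I_n) (s : state) : Prop :=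
  generalized_two_join G (part n s 0)
    (part n s 1 :|: part n s 2 :|: part n s 3)
    (part n s 4 :|: part n s 5 :|: part n s 6)
    (part n s 1) (part n s 2) (part n s 4) (part n s 5).

Definition correct_output (n : nat) (G : sgraph 'I_n) (s : state) : Prop :=
  (answer s = 1 /\ output_two_join G s) \/
  (answer s = 0 /\ ~ admits_generalized_two_join G).

(* Main.v *)
Require Import Defs.
From mathcomp Require Import all_boot zify.

Set Implicit Arguments.
Unset Strict Implicit.
Unset Printing Implicit Defensive.

(* Write L(u,v) = N[u] n N[v].  If a in A1 and b in A2, then L(a,b) is the clique
   K = V0 u A1 u A2, and likewise L(u,v) = V0 u B1 u B2 for u in B1, v in B2.
   So for every edge ab with K = L(a,b) a clique it remains to find an edge uv for
   which L = L(u,v) works.  Take an induced path p_0 = a, ..., p_k = b with inner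
   vertices outside K: some L_i = L(p_i, p_(i+1)) with 0 < i < k - 1 works, and only
   the first such i has to be found.  Grow a set S from {a, p_1}, following all
   edges except those inside K or inside the current L_i.  When S is closed and
   (K, L_i, S) describes a 2-join, stop; since G is connected and has no 1-join,
   nonemptiness of the A's and B's is automatic.  Otherwise, or as soon as S meets a
   later N[p_j] with j > i + 1, add L_i to S and pass to L_(i+1).  Every vertex
   enters S once, so this takes O(n D) steps per edge ab, and O(n m D) in total.

   The algorithm is written in a small language of bounded loops with a total
   semantics, whose only growing operation is the successor: every value stays below
   the initial maximum plus the running time, hence below a power N of n + m + 2,
   which can then serve as the row width of all tables.  Every edge ab works in
   fresh rows, which are still zero. *)

(** * Bounded-loop programs and their compilation *)

(** The obstacle is the choice of L: trying all pairs of edges would leave m^2 candidates. A hidden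
    2-join confines it. The inner vertices of the path avoid K, hence V0, so the path can pass from
    V1 to V2 only along an edge inside L; being induced, it does so once and meets L nowhere else.
    Before that edge every L_i lies inside V1, so adding a rejected L_i to S keeps S in V1; and a
    vertex of S in a later N[p_j] shows that the crossing edge has not been reached. Thus S stays
    inside V1 although V1 is unknown, and at the right i the closed set S must pass the test. Only
    completeness refers to the hidden join: whatever passes the test is a 2-join. Not every edge
    between A1 and A2 need have a suitable path; the absence of a 1-join provides one that has,
    because a component of V1 without the edges inside K or L that has a vertex outside K and L must
    meet both cliques. *)

Definition hupd (f : nat -> nat) (a v : nat) : nat -> nat :=
  fun b => if eqn b a then v else f b.
Arguments hupd f a v b /.

(** The table number is compared by [eqn] and separately, like registers in [hupd], so that [/=]
    decides it on literals and leaves only the comparisons of row and column. *)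
Definition tupd (T : nat -> nat -> nat -> nat) (k u c v : nat) :=
  fun k' u' c' =>
    if eqn k' k then (if (u' == u) && (c' == c) then v else T k' u' c')
    else T k' u' c'.
Arguments tupd T k u c v k' u' c' /.

Record hstate := HState { hr : nat -> nat; ht : nat -> nat -> nat -> nat }.

Definition hset (x v : nat) (st : hstate) : hstate :=
  HState (hupd (hr st) x v) (ht st).
Definition hput (k u c v : nat) (st : hstate) : hstate :=
  HState (hr st) (tupd (ht st) k u c v).

Inductive expr :=
| EV (x : nat)
| EC (v : nat)
| ES (e : expr)
| ET (k : nat) (e1 e2 : expr).

Inductive bexpr :=
| BNz (e : expr)
| BEq (e1 e2 : expr)
| BLt (e1 e2 : expr)
| BNot (b : bexpr)
| BAnd (b1 b2 : bexpr).

Inductive bound := Bn | Bm | BD.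

Inductive hcmd :=
| HSkip
| HAsg (x : nat) (e : expr)
| HPut (k : nat) (e1 e2 e3 : expr)
| HSeq (c1 c2 : hcmd)
| HIf (b : bexpr) (c1 c2 : hcmd)
| HFor (bd : bound) (x : nat) (c : hcmd).

Fixpoint eval (st : hstate) (e : expr) : nat :=
  match e with
  | EV x => hr st x
  | EC v => v
  | ES e => (eval st e).+1
  | ET k e1 e2 => ht st k (eval st e1) (eval st e2)
  end.

Fixpoint beval (st : hstate) (b : bexpr) : bool :=
  match b with
  | BNz e => 0 < eval st e
  | BEq e1 e2 => eval st e1 == eval st e2
  | BLt e1 e2 => eval st e1 < eval st e2
  | BNot b => ~~ beval st b
  | BAnd b1 b2 => beval st b1 && beval st b2
  end.

Section Run.
Variable env : bound -> nat.

Fixpoint run (c : hcmd) (st : hstate) : hstate :=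
  match c with
  | HSkip => st
  | HAsg x e => hset x (eval st e) st
  | HPut k e1 e2 e3 => hput k (eval st e1) (eval st e2) (eval st e3) st
  | HSeq c1 c2 => run c2 (run c1 st)
  | HIf b c1 c2 => if beval st b then run c1 st else run c2 st
  | HFor bd x c => iteri (env bd) (fun i st => run c (hset x i st)) st
  end.

(** The summands [v] and [k] are not time. The first pays for the size of the constant; the second
    makes a total cost below the row width force the table number below it, as addressing
    requires. *)
Fixpoint ecost (e : expr) : nat :=
  match e with
  | EV _ => 2
  | EC v => v.+1
  | ES e => ecost e + 2
  | ET k e1 e2 => ecost e1 + ecost e2 + k + 6
  end.

Fixpoint bcost (b : bexpr) : nat :=
  match b with
  | BNz e => ecost e + 2
  | BEq e1 e2 => ecost e1 + ecost e2 + 1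
  | BLt e1 e2 => ecost e1 + ecost e2 + 1
  | BNot b => bcost b + 2
  | BAnd b1 b2 => bcost b1 + bcost b2 + 2
  end.

(* Bounds both the running time of the compiled code and the growth of the
   largest value in the state. *)
Fixpoint hcost (c : hcmd) : nat :=
  match c with
  | HSkip => 1
  | HAsg _ e => ecost e + 2
  | HPut k e1 e2 e3 => ecost e1 + ecost e2 + ecost e3 + k + 6
  | HSeq c1 c2 => hcost c1 + hcost c2
  | HIf b c1 c2 => bcost b + hcost c1 + hcost c2 + 1
  | HFor bd _ c => env bd * (hcost c + 4) + 3
  end.

Definition bounded (B : nat) (st : hstate) : Prop :=
  (forall x, hr st x <= B) /\ (forall k u c, ht st k u c <= B).

Lemma boundedW B B' st : B <= B' -> bounded B st -> bounded B' st.
Proof. by move=> le [h1 h2]; split=> *; apply: leq_trans le. Qed.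

Lemma eval_bounded B st e : bounded B st -> eval st e <= B + ecost e.
Proof.
case=> h1 h2; elim: e => [x|v|e IH|k e1 IH1 e2 IH2] /=.
- by have := h1 x; lia.
- lia.
- lia.
- by have := h2 k (eval st e1) (eval st e2); lia.
Qed.

Lemma bounded_hset B B' st x v :
  bounded B st -> B <= B' -> v <= B' -> bounded B' (hset x v st).
Proof.
move=> h le hv; have [h1 h2] := boundedW le h; split=> //= y.
by case: ifP.
Qed.

Lemma run_bounded c B st : bounded B st -> bounded (B + hcost c) (run c st).
Proof.
elim: c B st => [|x e|k e1 e2 e3|c1 IH1 c2 IH2|b c1 IH1 c2 IH2|bd x c IH] B st h /=.
- by apply: boundedW h; lia.
- by apply: (bounded_hset _ h); [lia|have := eval_bounded e h; lia].
- have [h1 h2] := h; split=> [x|k' u c] /=; first by have := h1 x; lia.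
  have h3 := eval_bounded e3 h; have := h2 k' u c.
  by do 2?case: ifP => _; lia.
- by have := IH2 _ _ (IH1 _ _ h); rewrite addnA.
- by case: ifP => _; [apply: boundedW (IH1 _ _ h)|apply: boundedW (IH2 _ _ h)]; lia.
- suff: bounded (B + env bd * (hcost c + 4))
     (iteri (env bd) (fun i st => run c (hset x i st)) st).
    by apply: boundedW; lia.
  elim: (env bd) => [|i IHi] /=; first by rewrite mul0n addn0.
  rewrite mulSn.
  have hs: bounded (B + i * (hcost c + 4) + 1)
     (hset x i (iteri i (fun i st => run c (hset x i st)) st)).
    by apply: (bounded_hset _ IHi); nia.
  by apply: boundedW (IH _ _ hs); nia.
Qed.

End Run.

(** * Compilation to the random access machine *)

(** Even registers hold the variables of the loop program, odd ones the data of the compiler: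
    [treg 0] to [treg 2] the loop bounds, [treg 3] the row width, and [treg 4] onwards a stack of
    temporaries. *)
Definition vreg x := x.*2.
Definition treg d := d.*2.+1.
Definition breg bd := treg (match bd with Bn => 0 | Bm => 1 | BD => 2 end).

Lemma vreg_treg x d : (vreg x == treg d) = false.
Proof. rewrite /vreg /treg; lia. Qed.
Lemma treg_vreg x d : (treg d == vreg x) = false.
Proof. rewrite /vreg /treg; lia. Qed.
Lemma treg_eq d d' : (treg d == treg d') = (d == d').
Proof. rewrite /treg; lia. Qed.
Lemma vreg_eq d d' : (vreg d == vreg d') = (d == d').
Proof. rewrite /vreg; lia. Qed.

(* Register [treg 3] holds the width [N] of a table row; cell [c] of row [u] of
   table [k] is at address [(u * N + k) * N + c]. *)
Definition taddr N k u c := (u * N + k) * N + c.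

(** In base [N], the address has last digit [c] and next digit [k], so division by [N] recovers
    everything. *)
Lemma taddr_inj N k u c k' u' c' : k < N -> c < N -> k' < N -> c' < N ->
  (taddr N k u c == taddr N k' u' c') = [&& k == k', u == u' & c == c'].
Proof.
move=> hk hc hk' hc'; apply/eqP/and3P; last by case=> /eqP-> /eqP-> /eqP->.
rewrite /taddr => e.
have N0: 0 < N by lia.
have e1: u * N + k = u' * N + k'.
  by have := congr1 (divn^~ N) e; rewrite !divnMDl // (divn_small hc) (divn_small hc') !addn0.
have ec: c = c' by lia.
have eu: u = u'.
  by have := congr1 (divn^~ N) e1; rewrite !divnMDl // (divn_small hk) (divn_small hk') !addn0.
by rewrite ec eu; split=> //; apply/eqP; lia.
Qed.

Definition caddr k d :=
  Seq (Op Mul (treg d) (treg d) (treg 3))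
  (Seq (Const (treg d.+2) k)
  (Seq (Op Add (treg d) (treg d) (treg d.+2))
  (Seq (Op Mul (treg d) (treg d) (treg 3))
       (Op Add (treg d) (treg d) (treg d.+1))))).

(** The value ends up in [treg d]; temporaries above it are scratch, those below survive. A register
    is copied by adding zero, as the machine has no move. *)
Fixpoint cexpr (e : expr) (d : nat) : cmd :=
  match e with
  | EV x => Seq (Const (treg d) 0) (Op Add (treg d) (vreg x) (treg d))
  | EC v => Const (treg d) v
  | ES e => Seq (cexpr e d)
              (Seq (Const (treg d.+1) 1) (Op Add (treg d) (treg d) (treg d.+1)))
  | ET k e1 e2 => Seq (cexpr e1 d) (Seq (cexpr e2 d.+1)
       (Seq (caddr k d) (Fetch (treg d) (treg d))))
  end.

Fixpoint cbexpr (b : bexpr) (d : nat) : cmd :=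
  match b with
  | BNz e => Seq (cexpr e d)
      (Seq (Const (treg d.+1) 0) (Op Ltn (treg d) (treg d.+1) (treg d)))
  | BEq e1 e2 => Seq (cexpr e1 d)
      (Seq (cexpr e2 d.+1) (Op Eqn (treg d) (treg d) (treg d.+1)))
  | BLt e1 e2 => Seq (cexpr e1 d)
      (Seq (cexpr e2 d.+1) (Op Ltn (treg d) (treg d) (treg d.+1)))
  | BNot b => Seq (cbexpr b d)
      (Seq (Const (treg d.+1) 0) (Op Eqn (treg d) (treg d) (treg d.+1)))
  | BAnd b1 b2 => Seq (cbexpr b1 d)
      (If (treg d) (cbexpr b2 d) (Const (treg d) 0))
  end.

(** The loop counter [treg d] runs down to zero, while the index [x] is recomputed from it in every
    round; so [x] ascends, and the body may overwrite it. *)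
Fixpoint compile (c : hcmd) (d : nat) : cmd :=
  match c with
  | HSkip => Const (treg d) 0
  | HAsg x e => Seq (cexpr e d)
      (Seq (Const (treg d.+1) 0) (Op Add (vreg x) (treg d) (treg d.+1)))
  | HPut k e1 e2 e3 => Seq (cexpr e1 d) (Seq (cexpr e2 d.+1)
      (Seq (caddr k d) (Seq (cexpr e3 d.+1) (Store (treg d) (treg d.+1)))))
  | HSeq c1 c2 => Seq (compile c1 d) (compile c2 d)
  | HIf b c1 c2 => Seq (cbexpr b d) (If (treg d) (compile c1 d) (compile c2 d))
  | HFor bd x c =>
      Seq (Const (treg d) 0) (Seq (Op Add (treg d) (breg bd) (treg d))
        (While (treg d)
          (Seq (Op Defs.Sub (vreg x) (breg bd) (treg d))
          (Seq (compile c d.+1)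
          (Seq (Const (treg d.+1) 1)
               (Op Defs.Sub (treg d) (treg d) (treg d.+1)))))))
  end.

Section Compile.
Variables (env : bound -> nat) (W N : nat).

Record sim (st : hstate) (s : state) : Prop := Sim {
  sim_reg : forall x, reg s (vreg x) = hr st x;
  sim_env : forall bd, reg s (breg bd) = env bd;
  sim_width : reg s (treg 3) = N;
  sim_mem : forall k u c, k < N -> u < N -> c < N ->
     Defs.mem s (taddr N k u c) = ht st k u c
}.

Record frame (d : nat) (s s' : state) : Prop := Frame {
  frame_v : forall x, reg s' (vreg x) = reg s (vreg x);
  frame_t : forall j, j < d -> reg s' (treg j) = reg s (treg j);
  frame_m : Defs.mem s' = Defs.mem s
}.

Lemma frame_refl d s : frame d s s. Proof. by []. Qed.

Lemma frame_trans d d' s1 s2 s3 :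
  d <= d' -> frame d s1 s2 -> frame d' s2 s3 -> frame d s1 s3.
Proof.
move=> le [v1 t1 m1] [v2 t2 m2]; split=> [x|j hj|]; last by rewrite m2.
- by rewrite v2.
- by rewrite t2 ?t1 //; lia.
Qed.

Lemma frame_set d d' s s' v :
  d <= d' -> frame d s s' -> frame d s (set_reg s' (treg d') v).
Proof.
move=> le [v1 t1 m1]; split=> //= [x|j hj]; rewrite /upd.
- by rewrite vreg_treg.
- by rewrite treg_eq ltn_eqF ?t1 //; lia.
Qed.

Lemma sim_frame d st s s' : 3 < d -> sim st s -> frame d s s' -> sim st s'.
Proof.
move=> d3 [r b w m] [fv ft fm]; split=> [x|bd||k u c hk hu hc].
- by rewrite fv.
- by case: bd (b bd) => <-; apply: ft; lia.
- by rewrite ft.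
- by rewrite fm m.
Qed.

Definition code (c : cmd) (s : state) (t : nat) (P : state -> Prop) : Prop :=
  exists s' t', [/\ exec W c s s' t', t' <= t & P s'].

Lemma code_seq c1 c2 s t1 t2 (P Q : state -> Prop) t :
  code c1 s t1 P -> (forall s', P s' -> code c2 s' t2 Q) -> t1 + t2 <= t ->
  code (Seq c1 c2) s t Q.
Proof.
case=> s1 [u1 [e1 l1 p1]] /(_ _ p1) [s2 [u2 [e2 l2 p2]]] le.
by exists s2, (u1 + u2); split=> //; [apply: exec_seq e1 e2|lia].
Qed.

Lemma code_const r v s (P : state -> Prop) :
  v < W -> P (set_reg s r v) -> code (Const r v) s 1 P.
Proof. by move=> h p; exists (set_reg s r v), 1; split=> //; constructor. Qed.

Lemma code_op o r x y s (P : state -> Prop) :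
  eval_binop o (reg s x) (reg s y) < W ->
  P (set_reg s r (eval_binop o (reg s x) (reg s y))) -> code (Op o r x y) s 1 P.
Proof. by move=> h p; eexists; exists 1; split=> //; first by constructor. Qed.

Lemma code_imp c s t t' (P Q : state -> Prop) :
  code c s t P -> t <= t' -> (forall s', P s' -> Q s') -> code c s t' Q.
Proof.
by case=> s1 [u1 [e1 l1 p1]] le h; exists s1, u1; split=> //; [lia|apply: h].
Qed.

Lemma code_if x c1 c2 s t (b : bool) (P : state -> Prop) :
  reg s x = b -> (b -> code c1 s t P) -> (~~ b -> code c2 s t P) ->
  code (If x c1 c2) s t.+1 P.
Proof.
case: b => e h1 h2.
- have [//|s1 [u1 [e1 l1 p1]]] := h1; exists s1, u1.+1; split=> //.
  by apply: exec_if_true; rewrite ?e.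
- have [//|s1 [u1 [e1 l1 p1]]] := h2; exists s1, u1.+1; split=> //.
  by apply: exec_if_false; rewrite ?e.
Qed.

(** An address has three digits in base [N], so it fits into a word. *)
Hypothesis W_large : N * N * N <= W.

Definition esim d s v s' := frame d s s' /\ reg s' (treg d) = v.

Lemma upd_same f a v : upd f a v a = v. Proof. by rewrite /upd eqxx. Qed.
Lemma upd_treg f d d' v : upd f (treg d) v (treg d') = if d' == d then v else f (treg d').
Proof. by rewrite /upd treg_eq. Qed.
Lemma upd_vt f d x v : upd f (treg d) v (vreg x) = f (vreg x).
Proof. by rewrite /upd vreg_treg. Qed.

Lemma caddr_code k d s u c :
  3 < d -> reg s (treg 3) = N -> reg s (treg d) = u -> reg s (treg d.+1) = c ->
  k < N -> u < N -> c < N ->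
  code (caddr k d) s 5 (esim d s (taddr N k u c)).
Proof.
move=> d3 w eu ec hk hu hc.
have b1 : u * N < N * N by nia.
have b2 : N * N <= N * N * N by nia.
have b3 : N <= N * N by nia.
have b4 : (u * N + k) * N + c < N * N * N by nia.
apply: (code_seq (t1 := 1) (t2 := 4)
  (P := fun s' => esim d s (u * N) s' /\ reg s' (treg d.+1) = c)) => //.
  apply: code_op => /=; rewrite eu w; first lia.
  split; first split; rewrite /= ?upd_same //.
  - exact: frame_set.
  - by rewrite upd_treg ifF //; lia.
move=> s1 [[f1 r1] c1].
apply: (code_seq (t1 := 1) (t2 := 3)
  (P := fun s' => [/\ esim d s (u * N) s', reg s' (treg d.+1) = c
                    & reg s' (treg d.+2) = k])) => //.
  apply: code_const; first lia.
  split; first split; rewrite /= ?upd_treg ?eqxx //.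
  - by apply: frame_set f1; lia.
  - by rewrite ifF //; lia.
  - by rewrite ifF //; lia.
move=> s2 [[f2 r2] c2 k2].
apply: (code_seq (t1 := 1) (t2 := 2)
  (P := fun s' => esim d s (u * N + k) s' /\ reg s' (treg d.+1) = c)) => //.
  apply: code_op => /=; rewrite r2 k2; first nia.
  split; first split; rewrite /= ?upd_treg ?eqxx //.
  - exact: frame_set f2.
  - by rewrite ifF //; lia.
move=> s3 [[f3 r3] c3].
have w3: reg s3 (treg 3) = N by rewrite (frame_t f3).
apply: (code_seq (t1 := 1) (t2 := 1)
  (P := fun s' => esim d s ((u * N + k) * N) s' /\ reg s' (treg d.+1) = c)) => //.
  apply: code_op => /=; rewrite r3 w3; first nia.
  split; first split; rewrite /= ?upd_treg ?eqxx //.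
  - exact: frame_set f3.
  - by rewrite ifF //; lia.
move=> s4 [[f4 r4] c4].
apply: code_op => /=; rewrite r4 c4; first lia.
split; rewrite /= ?upd_treg ?eqxx //.
exact: frame_set f4.
Qed.

Lemma width_cube : N <= N * N * N.
Proof. nia. Qed.

Lemma cexpr_code e d B st s :
  3 < d -> sim st s -> bounded B st -> B + ecost e < N ->
  code (cexpr e d) s (ecost e) (esim d s (eval st e)).
Proof.
have WN := width_cube.
elim: e d s => [x|v|e IH|k e1 IH1 e2 IH2] d s d3 R hB lt; rewrite /= in lt *.
- apply: (code_seq (t1 := 1) (t2 := 1)
    (P := esim d s 0)) => //.
    apply: code_const; first lia.
    by split; rewrite /= ?upd_same //; apply: frame_set.
  move=> s1 [f1 r1].
  have R1 := sim_frame d3 R f1.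
  have hb: hr st x <= B by case: hB => + _; apply.
  apply: code_op => /=; rewrite r1 (sim_reg R1) addn0; first lia.
  split; rewrite /= ?upd_same //.
  exact: frame_set f1.
- apply: (code_imp (t := 1) (P := esim d s v)) => //.
  apply: code_const; first by lia.
  by split; rewrite /= ?upd_same //; apply: frame_set.
- have lt': B + ecost e < N by lia.
  apply: (code_seq (IH d s d3 R hB lt') (t2 := 2)) => // s1 [f1 r1].
  apply: (code_seq (t1 := 1) (t2 := 1)
    (P := fun s' => esim d s (eval st e) s' /\ reg s' (treg d.+1) = 1)) => //.
    apply: code_const; first lia.
    split; first split; rewrite /= ?upd_treg ?eqxx ?ifF ?r1 //; try lia.
    by apply: frame_set f1; lia.
  move=> s2 [[f2 r2] r2'].
  have hb := eval_bounded e hB.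
  apply: code_op => /=; rewrite r2 r2' addn1; first lia.
  by split; rewrite /= ?upd_treg ?eqxx //; apply: frame_set f2.
- have lt1: B + ecost e1 < N by lia.
  have lt2: B + ecost e2 < N by lia.
  have hb1 := eval_bounded e1 hB.
  have hb2 := eval_bounded e2 hB.
  apply: (code_seq (IH1 d s d3 R hB lt1) (t2 := ecost e2 + k + 6)); last lia.
  move=> s1 [f1 r1].
  have R1 := sim_frame d3 R f1.
  apply: (code_seq (IH2 d.+1 s1 _ R1 hB lt2) (t2 := k + 6)) => //; [lia| |lia].
  move=> s2 [f2 r2].
  have f02 := frame_trans (leqnSn d) f1 f2.
  have R2 := sim_frame d3 R f02.
  have hk : k < N by lia.
  apply: (code_seq (caddr_code d3 (sim_width R2) (u := eval st e1) _ r2 hk _ _)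
     (t2 := k + 1)) => //; [by rewrite (frame_t f2)|lia|lia| |lia].
  move=> s3 [f3 r3].
  have f03 := frame_trans (leqnn d) f02 f3.
  have R3 := sim_frame d3 R f03.
  apply: (code_imp (t := 1) (P := esim d s (ht st k (eval st e1) (eval st e2)))) => //; last lia.
  eexists; exists 1; split=> //; first by constructor.
  split; rewrite /= ?upd_same.
  + exact: frame_set f03.
  + by rewrite r3 (sim_mem R3) //; lia.
Qed.

Lemma cbexpr_code b d B st s :
  3 < d -> sim st s -> bounded B st -> B + bcost b < N ->
  code (cbexpr b d) s (bcost b) (esim d s (beval st b)).
Proof.
have WN := width_cube.
elim: b d s => [e|e1 e2|e1 e2|b IH|b1 IH1 b2 IH2] d s d3 R hB lt; rewrite /= in lt *.
- have lt': B + ecost e < N by lia.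
  apply: (code_seq (cexpr_code d3 R hB lt') (t2 := 2)) => // s1 [f1 r1].
  apply: (code_seq (t1 := 1) (t2 := 1)
    (P := fun s' => esim d s (eval st e) s' /\ reg s' (treg d.+1) = 0)) => //.
    apply: code_const; first lia.
    split; first split; rewrite /= ?upd_treg ?eqxx ?ifF ?r1 //; try lia.
    by apply: frame_set f1; lia.
  move=> s2 [[f2 r2] r2'].
  apply: code_op => /=; rewrite r2 r2'; first by apply: leq_ltn_trans (leq_b1 _) _; lia.
  by split; rewrite /= ?upd_treg ?eqxx //; apply: frame_set f2.
- have lt1: B + ecost e1 < N by lia.
  have lt2: B + ecost e2 < N by lia.
  apply: (code_seq (cexpr_code d3 R hB lt1) (t2 := ecost e2 + 1)); last lia.
  move=> s1 [f1 r1].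
  have R1 := sim_frame d3 R f1.
  apply: (code_seq (cexpr_code (d := d.+1) _ R1 hB lt2) (t2 := 1)) => //; [lia|].
  move=> s2 [f2 r2].
  have f02 := frame_trans (leqnSn d) f1 f2.
  have r2' : reg s2 (treg d) = eval st e1 by rewrite (frame_t f2).
  apply: code_op => /=; rewrite r2 r2'; first by apply: leq_ltn_trans (leq_b1 _) _; lia.
  by split; rewrite /= ?upd_treg ?eqxx //; apply: frame_set f02.
- have lt1: B + ecost e1 < N by lia.
  have lt2: B + ecost e2 < N by lia.
  apply: (code_seq (cexpr_code d3 R hB lt1) (t2 := ecost e2 + 1)); last lia.
  move=> s1 [f1 r1].
  have R1 := sim_frame d3 R f1.
  apply: (code_seq (cexpr_code (d := d.+1) _ R1 hB lt2) (t2 := 1)) => //; [lia|].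
  move=> s2 [f2 r2].
  have f02 := frame_trans (leqnSn d) f1 f2.
  have r2' : reg s2 (treg d) = eval st e1 by rewrite (frame_t f2).
  apply: code_op => /=; rewrite r2 r2'; first by apply: leq_ltn_trans (leq_b1 _) _; lia.
  by split; rewrite /= ?upd_treg ?eqxx //; apply: frame_set f02.
- have lt': B + bcost b < N by lia.
  apply: (code_seq (IH d s d3 R hB lt') (t2 := 2)) => // s1 [f1 r1].
  apply: (code_seq (t1 := 1) (t2 := 1)
    (P := fun s' => esim d s (beval st b) s' /\ reg s' (treg d.+1) = 0)) => //.
    apply: code_const; first lia.
    split; first split; rewrite /= ?upd_treg ?eqxx ?ifF ?r1 //; try lia.
    by apply: frame_set f1; lia.
  move=> s2 [[f2 r2] r2'].
  apply: code_op => /=; rewrite r2 r2' eqb0; first by apply: leq_ltn_trans (leq_b1 _) _; lia.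
  by split; rewrite /= ?upd_treg ?eqxx //; apply: frame_set f2.
- have lt1: B + bcost b1 < N by lia.
  have lt2: B + bcost b2 < N by lia.
  apply: (code_seq (IH1 d s d3 R hB lt1) (t2 := (bcost b2).+1)); last lia.
  move=> s1 [f1 r1].
  have R1 := sim_frame d3 R f1.
  apply: (code_if r1) => [hb1|/negbTE->] /=.
  + rewrite hb1; apply: (code_imp (IH2 d s1 d3 R1 hB lt2)) => // s2 [f2 r2].
    by split=> //; apply: frame_trans f2.
  + apply: (code_imp (t := 1) (P := esim d s 0)) => //.
      apply: code_const; first lia.
      by split; rewrite /= ?upd_same //; apply: frame_set.
    by case: (b2) => /= *; rewrite ?addn1 ?addn2.
Qed.

(** Values grow by at most the cost of the code, so [B + hcost env c < N] keeps all row and column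
    indices below [N] during the whole run. This lets simulation and time bound go through a single
    induction. *)
Lemma compile_code c d B st s :
  3 < d -> sim st s -> bounded B st -> B + hcost env c < N ->
  code (compile c d) s (hcost env c)
    (fun s' => sim (run env c st) s' /\
       forall j, j < d -> reg s' (treg j) = reg s (treg j)).
Proof.
have WN := width_cube.
elim: c d B st s => [|x e|k e1 e2 e3|c1 IH1 c2 IH2|b c1 IH1 c2 IH2|bd x c IH] d B st s d3 R hB lt; rewrite /= in lt *.
- apply: code_const; first lia.
  have f := frame_set 0 (leqnn d) (frame_refl d s).
  by split; [apply: (sim_frame d3 R f)|apply: (frame_t f)].
- have lt': B + ecost e < N by lia.
  apply: (code_seq (cexpr_code d3 R hB lt') (t2 := 2)) => // s1 [f1 r1].
  apply: (code_seq (t1 := 1) (t2 := 1)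
    (P := fun s' => esim d s (eval st e) s' /\ reg s' (treg d.+1) = 0)) => //.
    apply: code_const; first lia.
    split; first split; rewrite /= ?upd_treg ?eqxx ?ifF ?r1 //; try lia.
    by apply: frame_set f1; lia.
  move=> s2 [[f2 r2] r2'].
  have hb := eval_bounded e hB.
  apply: code_op => /=; rewrite r2 r2' addn0; first lia.
  have [rr rb rw rm] := sim_frame d3 R f2.
  split; first split=> //=.
  + by move=> y; rewrite /upd vreg_eq eqE /= rr; case: eqn.
  + by move=> bd; rewrite /upd /breg treg_vreg rb.
  + by rewrite /upd treg_vreg.
  + by move=> j hj; rewrite /= /upd treg_vreg (frame_t f2).
- have lt1: B + ecost e1 < N by lia.
  have lt2: B + ecost e2 < N by lia.
  have lt3: B + ecost e3 < N by lia.
  have hb1 := eval_bounded e1 hB.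
  have hb2 := eval_bounded e2 hB.
  apply: (code_seq (cexpr_code d3 R hB lt1) (t2 := ecost e2 + ecost e3 + k + 6)); last lia.
  move=> s1 [f1 r1].
  have R1 := sim_frame d3 R f1.
  apply: (code_seq (cexpr_code (d := d.+1) _ R1 hB lt2) (t2 := ecost e3 + k + 6)) => //; [lia| |lia].
  move=> s2 [f2 r2].
  have f02 := frame_trans (leqnSn d) f1 f2.
  have R2 := sim_frame d3 R f02.
  have hk : k < N by lia.
  apply: (code_seq (caddr_code d3 (sim_width R2) (u := eval st e1) _ r2 hk _ _)
     (t2 := ecost e3 + k + 1)) => //; [by rewrite (frame_t f2)|lia|lia| |lia].
  move=> s3 [f3 r3].
  have f03 := frame_trans (leqnn d) f02 f3.
  have R3 := sim_frame d3 R f03.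
  apply: (code_seq (cexpr_code (d := d.+1) _ R3 hB lt3) (t2 := k + 1)) => //; [lia| |lia].
  move=> s4 [f4 r4].
  have f04 := frame_trans (leqnSn d) f03 f4.
  have r4' : reg s4 (treg d) = taddr N k (eval st e1) (eval st e2) by rewrite (frame_t f4).
  have [rr rb rw rm] := sim_frame d3 R f04.
  eexists; exists 1; split; first exact: exec_store; first lia.
  split; last by move=> j hj /=; rewrite (frame_t f04).
  split=> //= k' u' c' hk' hu' hc'.
  rewrite /upd r4 r4' taddr_inj //; last lia.
  by rewrite -[eqn k' k]/(k' == k) rm //; case: eqP.
- have lt1: B + hcost env c1 < N by lia.
  have lt2: B + hcost env c1 + hcost env c2 < N by lia.
  apply: (code_seq (IH1 d B st s d3 R hB lt1) (t2 := hcost env c2)) => //.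
  move=> s1 [R1 r1].
  apply: (code_imp (IH2 d _ _ s1 d3 R1 (run_bounded env c1 hB) lt2)) => //.
  by move=> s2 [R2 r2]; split=> // j hj; rewrite r2 // r1.
- have lt0: B + bcost b < N by lia.
  have lt1: B + hcost env c1 < N by lia.
  have lt2: B + hcost env c2 < N by lia.
  apply: (code_seq (cbexpr_code d3 R hB lt0) (t2 := (hcost env c1 + hcost env c2).+1)); last lia.
  move=> s1 [f1 r1].
  have R1 := sim_frame d3 R f1.
  apply: (code_if r1) => [->|/negbTE->].
  + apply: (code_imp (IH1 d B st s1 d3 R1 hB lt1)); first lia.
    by move=> s2 [R2 r2]; split=> // j hj; rewrite r2 // (frame_t f1).
  + apply: (code_imp (IH2 d B st s1 d3 R1 hB lt2)); first lia.
    by move=> s2 [R2 r2]; split=> // j hj; rewrite r2 // (frame_t f1).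
- have ltE : env bd < N by nia.
  apply: (code_seq (t1 := 1) (t2 := env bd * (hcost env c + 4) + 2)
    (P := esim d s 0)); last lia.
    apply: code_const; first lia.
    by split; rewrite /= ?upd_same //; apply: frame_set.
  move=> s1 [f1 r1].
  have R1 := sim_frame d3 R f1.
  apply: (code_seq (t1 := 1) (t2 := env bd * (hcost env c + 4) + 1)
    (P := esim d s (env bd))); last lia.
    apply: code_op => /=; rewrite r1 (sim_env R1) addn0; first lia.
    by split; rewrite /= ?upd_same //; apply: frame_set.
  move=> s2 [f2 r2].
  have R2 := sim_frame d3 R f2.
  pose it i := iteri i (fun i st => run env c (hset x i st)) st.
  have bit i : bounded (B + i * (hcost env c + 4)) (it i).
    rewrite /it; elim: i => [|i IHi] /=; first by rewrite mul0n addn0.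
    rewrite mulSn.
    have hs: bounded (B + i * (hcost env c + 4) + 1) (hset x i (it i)).
      by apply: (bounded_hset _ IHi); nia.
    by apply: boundedW (run_bounded env c hs); nia.
  (* Induction on the number [j] of rounds left, which is the content of the counter register. *)
  suff: forall j, j <= env bd -> forall s', sim (it (env bd - j)) s' -> reg s' (treg d) = j ->
     (forall i, i < d -> reg s' (treg i) = reg s (treg i)) ->
     code (While (treg d)
          (Seq (Op Defs.Sub (vreg x) (breg bd) (treg d))
          (Seq (compile c d.+1)
          (Seq (Const (treg d.+1) 1)
               (Op Defs.Sub (treg d) (treg d) (treg d.+1)))))) s'
       (j * (hcost env c + 4) + 1)
       (fun s' => sim (it (env bd)) s' /\
       forall j, j < d -> reg s' (treg j) = reg s (treg j)).
    move/(_ _ (leqnn _) s2); apply=> //; first by rewrite subnn.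
    exact: (frame_t f2).
  elim=> [|j IHj] hj s' Rs rj rt.
    exists s', 1; split=> //; first exact: exec_while_false.
    by split=> //; rewrite subn0 in Rs.
  set i := env bd - j.+1.
  have ei : env bd - j = i.+1 by rewrite /i; lia.
  have bi := bit i.
  have lei : i.+1 * (hcost env c + 4) <= env bd * (hcost env c + 4).
    by rewrite leq_mul2r; apply/orP; right; rewrite /i; lia.
  suff [s3 [u3 [e3 l3 [R3 rd3 rt3]]]] : code
      (Seq (Op Defs.Sub (vreg x) (breg bd) (treg d))
          (Seq (compile c d.+1)
          (Seq (Const (treg d.+1) 1)
               (Op Defs.Sub (treg d) (treg d) (treg d.+1))))) s' (hcost env c + 3)
      (fun s3 => [/\ sim (it i.+1) s3, reg s3 (treg d) = j &
         forall i, i < d -> reg s3 (treg i) = reg s (treg i)]).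
    rewrite -ei in R3.
    have [s4 [u4 [e4 l4 p4]]] := IHj (ltnW hj) s3 R3 rd3 rt3.
    exists s4, (u3 + u4).+1; split=> //; last by nia.
    by apply: exec_while_true e3 e4; rewrite rj.
  have Ri : sim (hset x i (it i)) (set_reg s' (vreg x) i).
    have [rr rb rw rm] := Rs.
    split=> //=.
    + by move=> y; rewrite /upd vreg_eq eqE /= rr; case: eqn.
    + by move=> b; rewrite /upd /breg treg_vreg rb.
    + by rewrite /upd treg_vreg.
  have bi1 : bounded (B + i * (hcost env c + 4) + 1) (hset x i (it i)).
    by apply: (bounded_hset _ bi); nia.
  have lt1 : B + i * (hcost env c + 4) + 1 + hcost env c < N.
    by move: lei; rewrite mulSn; lia.
  apply: (code_seq (t1 := 1) (t2 := hcost env c + 2)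
     (P := fun s3 => s3 = set_reg s' (vreg x) i)); last lia.
    by apply: code_op => /=; rewrite (sim_env Rs) rj //; rewrite -/i; rewrite /i; lia.
  move=> s3 ->.
  apply: (code_seq (IH d.+1 _ _ _ _ Ri bi1 lt1) (t2 := 2)); [lia| |lia].
  move=> s4 [R4 rt4].
  apply: (code_seq (t1 := 1) (t2 := 1)
    (P := fun s' => frame d.+1 s4 s' /\ reg s' (treg d.+1) = 1)) => //.
    apply: code_const; first lia.
    by split; [apply: frame_set|rewrite /= upd_same].
  move=> s5 [f5 r5].
  have d4: 3 < d.+1 by lia.
  have R5 := sim_frame d4 R4 f5.
  have rd5 : reg s5 (treg d) = j.+1.
    by rewrite (frame_t f5) // rt4 //= /upd treg_vreg.
  apply: code_op => /=; rewrite rd5 r5; first by lia.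
  split=> /=.
  + by apply: (sim_frame d3 R5); apply: frame_set.
  + by rewrite upd_same; lia.
  + move=> y hy; rewrite upd_treg ifF; last lia.
    by rewrite (frame_t f5) ?rt4 /= /upd ?treg_vreg ?rt //; lia.
Qed.

End Compile.

(** * Graph-theoretic facts about 2-joins *)

(** Otherwise [zify] would preprocess the whole context, most of which concerns sets and graphs. *)
Ltac nat_lia :=
  repeat match goal with
  | H : ?P |- _ =>
    lazymatch P with
    | is_true (leq _ _) => fail
    | @eq nat _ _ => fail
    | nat => fail
    | _ => clear H
    end
  end; lia.

Section Joins.
Variables (T : finType) (G : sgraph T).
Implicit Types (K L S V X : {set T}) (a b x y z : T).

Definition cadj x y := (x == y) || G x y.

Lemma cadj_refl x : cadj x x.
Proof. by rewrite /cadj eqxx. Qed.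

Definition common x y : {set T} := [set z | cadj x z && cadj y z].

Definition within K L x y :=
  (x \in K) && (y \in K) || (x \in L) && (y \in L).

Lemma within_sym K L x y : within K L x y = within K L y x.
Proof. by rewrite /within andbC [(x \in L) && _]andbC. Qed.

Lemma withinC K L x y : within K L x y = within L K x y.
Proof. by rewrite /within orbC. Qed.

(** Together with [hub], this is what two cliques must satisfy to form a 2-join: [K :&: L] plays
    [V0], and a sealed set is one side up to vertices of [V0]. *)
Definition sealed K L X := forall x y, x \in X -> y \notin X -> G x y -> within K L x y.

Lemma sealedC K L X : sealed K L X -> sealed L K X.
Proof. by move=> h x y hx hy /(h x y hx hy); rewrite withinC. Qed.

Lemma sealed_setC K L X : sealed K L X -> sealed K L (~: X).
Proof.
move=> h x y; rewrite !inE negbK => hx hy; rewrite (adj_sym G) => /(h y x hy hx).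
by rewrite within_sym.
Qed.

Definition hub K L := forall v y, v \in K -> v \in L -> G v y -> (y \in K) || (y \in L).

(** A vertex of [K :&: L] has all its neighbours in [K :|: L], so the edges that start to leave the
    set when it is taken out are inside [K] or inside [L]. *)
Lemma sealed_setD K L X : hub K L -> sealed K L X -> sealed K L (X :\: (K :&: L)).
Proof.
move=> hKL hX x y; rewrite !inE /within negb_and => /andP [/orP hx xX].
rewrite negb_and negbK => /orP [/andP [yK yL]|yX] xy; last exact: hX.
have := hKL y x yK yL; rewrite (adj_sym G) => /(_ xy).
by rewrite yK yL !andbT.
Qed.

Hypothesis connG : connected G.
Hypothesis no1 : ~ admits_one_join G.

Lemma connected_cut X c d : c \in X -> d \notin X ->
  exists x y, [/\ x \in X, y \notin X & G x y].
Proof.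
move=> cX dX.
case: (pickP [pred p : T * T | [&& p.1 \in X, p.2 \notin X & G p.1 p.2]]) => [[x y] /and3P[]|none].
  by exists x, y.
suff cl : closed G (mem X).
  by have := closed_connect cl (connG c d); rewrite cX (negbTE dX).
apply: intro_closed; first exact: (sym_connect_sym (adj_sym G)).
move=> x y xy xX; apply: contraT => yX.
by have := none (x, y); rewrite /= xX yX xy.
Qed.

(** If [X] missed [K :\: L], it would miss [K], so all edges leaving [X] would be inside [L], and
    [X] and its complement would form a 1-join along the clique [L]. *)
Lemma sealed_meets K L X c d :
  clique G L -> sealed K L X -> [disjoint X & K :&: L] ->
  c \in X -> c \notin K :|: L -> d \notin X -> d \notin K :|: L ->
  exists2 a, a \in X & a \in K :\: L.
Proof.
move=> cL sX dX cX cKL dX' dKL.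
case: (pickP [pred x | (x \in X) && (x \in K :\: L)]) => [a /andP []|none]; first by exists a.
have XK x : x \in X -> x \notin K.
  move=> xX; apply/negP => xK; have := none x; rewrite /= xX !inE xK andbT => /negbFE xL.
  by have := disjointFr dX xX; rewrite inE xK xL.
have wL x y : x \in X -> y \notin X -> G x y -> (x \in L) && (y \in L).
  by move=> xX yX /(sX _ _ xX yX); rewrite /within (negbTE (XK _ xX)).
have [x [y [xX yX xy]]] := connected_cut cX dX'.
have /andP [xL yL] := wL x y xX yX xy.
case: no1; exists X, (~: X), (X :&: L), (L :\: X); split.
- by rewrite setUCr.
- by rewrite disjoints_subset setCK.
- by rewrite subsetIl; split=> //; apply/subsetP => z; rewrite !inE => /andP [].
- by move=> u v; rewrite !inE => hu hv; apply: cL; [case/orP: hu => /andP []|case/orP: hv => /andP []].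
- move=> u v; rewrite !inE => /andP [h uX] vX; apply: contra h => /(wL _ _ uX vX) /andP [-> _].
  by rewrite uX.
- move=> u v; rewrite !inE => /andP [h uX] vX; apply: contra h.
  rewrite (adj_sym G) => /(wL _ _ vX uX) /andP [_ ->]; by rewrite uX.
- split; apply/set0Pn.
  + by exists x; rewrite inE xX.
  + by exists y; rewrite inE yL yX.
  + by exists c; rewrite !inE; move: cKL; rewrite inE negb_or cX => /andP [_ ->].
  + by exists d; rewrite !inE; move: dKL; rewrite inE negb_or dX' => /andP [_ ->].
Qed.

(** [sealed_meets], applied to [S] and to its complement, both without [K :&: L], and with [K] and
    [L] in either role, makes the four clique parts nonempty; [c] and [d] do so for the two
    remaining parts. *)
Lemma sealed_join K L S c d :
  clique G K -> clique G L -> hub K L -> sealed K L S ->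
  c \in S -> c \notin K :|: L -> d \notin S -> d \notin K :|: L ->
  generalized_two_join G (K :&: L)
    ((K :\: L) :&: S :|: (L :\: K) :&: S :|: S :\: (K :|: L))
    ((K :\: L) :\: S :|: (L :\: K) :\: S :|: ~: S :\: (K :|: L))
    ((K :\: L) :&: S) ((L :\: K) :&: S) ((K :\: L) :\: S) ((L :\: K) :\: S).
Proof.
move=> cK cL hKL sS cS cKL dS dKL.
have hLK : hub L K by move=> v y vL vK /(hKL v y vK vL); rewrite orbC.
have cliqueS (U R : {set T}) : clique G R -> U \subset R -> clique G U.
  by move=> cR /subsetP sU u v hu hv; apply: cR; apply: sU.
have meet (X : {set T}) c' d' : sealed K L X -> c' \in X -> c' \notin K :|: L -> d' \notin X ->
    d' \notin K :|: L -> (exists2 a, a \in X & a \in K :\: L) /\ (exists2 a, a \in X & a \in L :\: K).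
  move=> sX cX cKL' dX dKL'.
  have sX' := sealed_setD hKL sX.
  have nKL z : z \notin K :|: L -> z \notin K :&: L.
    by rewrite !inE; case: (z \in K).
  have dj : [disjoint X :\: (K :&: L) & K :&: L].
    by rewrite disjoints_subset; apply/subsetP => z; rewrite in_setD in_setC => /andP [].
  have cX' : c' \in X :\: (K :&: L) by rewrite in_setD nKL.
  have dX' : d' \notin X :\: (K :&: L) by rewrite in_setD (negbTE dX) andbF.
  have [a aX aK] := sealed_meets cL sX' dj cX' cKL' dX' dKL'.
  rewrite setUC in cKL' dKL'; rewrite [K :&: L]setIC in dj cX' dX'.
  have sX'' := sealedC sX'; rewrite [K :&: L]setIC in sX''.
  have [a' aX' aL] := sealed_meets cK sX'' dj cX' cKL' dX' dKL'.
  by split; [exists a|exists a'] => //; [move: aX|move: aX']; rewrite in_setD => /andP [].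
have [[a1 a1S a1K] [b1 b1S b1L]] := meet S c d sS cS cKL dS dKL.
have nS : d \in ~: S by rewrite inE.
have nS' : c \notin ~: S by rewrite inE cS.
have [[a2 a2S a2K] [b2 b2S b2L]] := meet (~: S) d c (sealed_setC sS) nS dKL nS' cKL.
split.
- by apply/setP => z; rewrite !inE; case: (z \in K); case: (z \in L); case: (z \in S).
- by split; rewrite disjoints_subset; apply/subsetP => z; rewrite !inE;
    case: (z \in K); case: (z \in L); case: (z \in S).
- by split; try (rewrite disjoints_subset); apply/subsetP => z; rewrite !inE;
    case: (z \in K); case: (z \in L); case: (z \in S).
- by split; try (rewrite disjoints_subset); apply/subsetP => z; rewrite !inE;
    case: (z \in K); case: (z \in L); case: (z \in S).
- by apply: cliqueS cK _; apply/subsetP => z; rewrite !inE;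
    case: (z \in K); case: (z \in L); case: (z \in S).
- by apply: cliqueS cL _; apply/subsetP => z; rewrite !inE;
    case: (z \in K); case: (z \in L); case: (z \in S).
- move=> x y xy h.
  suff w : within K L x y.
    by case/orP: w => /andP [hx hy]; [left|right]; apply/subsetP => z;
      rewrite in_set2 => /orP [] /eqP ->; rewrite !inE ?hx ?hy /=;
      case: (_ \in _); case: (_ \in S).
  case: (boolP ((x \in K) && (x \in L))) => [/andP [xK xL]|nx].
    have := hKL x y xK xL xy; rewrite /within xK xL; exact.
  case: (boolP ((y \in K) && (y \in L))) => [/andP [yK yL]|ny].
    have := hKL y x yK yL; rewrite (adj_sym G) xy /within yK yL !andbT; exact.
  case xS : (x \in S); case yS : (y \in S).
  + case/negP: h; move: nx ny; rewrite !inE xS yS.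
    by case: (x \in K); case: (x \in L); case: (y \in K); case: (y \in L).
  + by apply: sS => //; rewrite yS.
  + by rewrite within_sym; apply: sS => //; [rewrite xS|rewrite (adj_sym G)].
  + case/negP: h; move: nx ny; rewrite !inE xS yS.
    by case: (x \in K); case: (x \in L); case: (y \in K); case: (y \in L).
- split; apply/set0Pn; [exists a1|exists b1|exists c]; rewrite ?inE.
  + by rewrite a1S andbT; move: a1K; rewrite inE.
  + by rewrite b1S andbT; move: b1L; rewrite inE.
  + move: cKL; rewrite !inE cS negb_or => /andP [/negbTE-> /negbTE->]; by [].
- split; apply/set0Pn; [exists a2|exists b2|exists d].
  + by rewrite inE a2K andbT; move: a2S; rewrite inE.
  + by rewrite inE b2L andbT; move: b2S; rewrite inE.
  + move: dKL; rewrite !inE dS negb_or => /andP [/negbTE-> /negbTE->]; by [].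
Qed.

Lemma join_swap V0 V1 V2 A1 B1 A2 B2 :
  generalized_two_join G V0 V1 V2 A1 B1 A2 B2 -> generalized_two_join G V0 V2 V1 A2 B2 A1 B1.
Proof.
case=> cov [d01 d02 d12] s1 s2 cA cB cr n1 n2; split=> //.
- by rewrite -cov -!setUA [V2 :|: _]setUC.
- by split=> //; rewrite disjoint_sym.
- by rewrite -setUA [A2 :|: _]setUC setUA.
- by rewrite -setUA [B2 :|: _]setUC setUA.
move=> x y xy h; rewrite -!setUA [A2 :|: _]setUC [B2 :|: _]setUC !setUA.
apply: cr => //; apply: contra h; rewrite !orbA => /orP [/orP []|] ->; by rewrite ?orbT.
Qed.

Lemma join_turn V0 V1 V2 A1 B1 A2 B2 :
  generalized_two_join G V0 V1 V2 A1 B1 A2 B2 -> generalized_two_join G V0 V1 V2 B1 A1 B2 A2.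
Proof.
case=> cov dj [sA1 sB1 d1] [sA2 sB2 d2] cA cB cr [nA1 nB1 nC1] [nA2 nB2 nC2]; split=> //.
- by split; rewrite // disjoint_sym.
- by split; rewrite // disjoint_sym.
- by move=> x y xy /(cr x y xy) []; [right|left].
- by rewrite [B1 :|: _]setUC.
- by rewrite [B2 :|: _]setUC.
Qed.

Section OneJoin.
Variables V0 V1 V2 A1 B1 A2 B2 : {set T}.
Hypothesis J : generalized_two_join G V0 V1 V2 A1 B1 A2 B2.
Let K := V0 :|: A1 :|: A2.
Let L := V0 :|: B1 :|: B2.

Lemma join_case x : [\/ x \in V0, x \in V1 | x \in V2].
Proof.
have := in_setT x; rewrite -(gj_cover J) !inE => /orP [/orP []|] h;
  by [constructor 1|constructor 2|constructor 3].
Qed.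

Lemma join_sealed1 : sealed K L V1.
Proof.
move=> x y xV yV xy; have [[d01 d02 d12] cr] := (gj_disjoint J, gj_crossing J).
have x0 := disjointFl d01 xV; have x2 := disjointFr d12 xV.
have : [set x; y] \subset K \/ [set x; y] \subset L.
  by apply: cr => //; rewrite x0 x2 xV (negbTE yV).
by rewrite /within => -[] /subsetP s; apply/orP; [left|right]; rewrite !s ?inE ?eqxx ?orbT.
Qed.

Lemma join_in1 x : x \in V1 -> [/\ x \notin V0, x \notin V2, (x \in K) = (x \in A1) & (x \in L) = (x \in B1)].
Proof.
move=> xV; have [d01 d02 d12] := gj_disjoint J.
have x0 := disjointFl d01 xV; have x2 := disjointFr d12 xV.
have [sA sB _] := gj_sub2 J.
have xA : x \in A2 = false by apply/negP => /(subsetP sA); rewrite x2.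
have xB : x \in B2 = false by apply/negP => /(subsetP sB); rewrite x2.
by rewrite x0 x2; split; rewrite // !inE x0 ?xA ?xB orbF.
Qed.

(** A vertex of both cliques lies in [V0], as [A1] is disjoint from [B1] and [A2] from [B2]; an edge
    from [V0] to another part is a crossing edge. *)
Lemma join_hub : hub K L.
Proof.
move=> v y vK vL vy; have [[d01 d02 d12] cr] := (gj_disjoint J, gj_crossing J).
have [[sA1 sB1 d1] [sA2 sB2 d2]] := (gj_sub1 J, gj_sub2 J).
have v0 : v \in V0.
  case: (join_case v) => // vV.
    have [_ _ eK eL] := join_in1 vV.
    by move: vK vL; rewrite eK eL => h; rewrite (disjointFr d1 h).
  have v1 := disjointFl d12 vV; have v0 := disjointFl d02 vV.
  move: vK vL; rewrite !inE v0 /=.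
  have -> : v \in A1 = false by apply/negP => /(subsetP sA1); rewrite v1.
  have -> : v \in B1 = false by apply/negP => /(subsetP sB1); rewrite v1.
  by move=> /= h; rewrite (disjointFr d2 h).
case: (boolP (y \in V0)) => [|y0]; first by rewrite !inE => ->.
have : [set v; y] \subset K \/ [set v; y] \subset L.
  by apply: cr => //; rewrite (disjointFr d01 v0) (disjointFr d02 v0) (negbTE y0) andbF.
by case=> /subsetP /(_ y); rewrite !inE eqxx orbT => -> //; rewrite orbT.
Qed.

End OneJoin.

Lemma join_sealed2 V0 V1 V2 A1 B1 A2 B2 :
  generalized_two_join G V0 V1 V2 A1 B1 A2 B2 ->
  sealed (V0 :|: A1 :|: A2) (V0 :|: B1 :|: B2) V2.
Proof.
move=> /join_swap /join_sealed1.
by rewrite -!setUA [A2 :|: _]setUC [B2 :|: _]setUC.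
Qed.

(** A common neighbour in [V1] or [V2] ends a crossing edge whose other end, [b] or [a], is outside
    the second clique; so that edge is inside the first. *)
Lemma common_join V0 V1 V2 A1 B1 A2 B2 a b :
  generalized_two_join G V0 V1 V2 A1 B1 A2 B2 -> a \in A1 -> b \in A2 ->
  common a b = V0 :|: A1 :|: A2.
Proof.
move=> J aA bA; have [[sA1 sB1 d1] [sA2 sB2 d2]] := (gj_sub1 J, gj_sub2 J).
have cK := gj_cliqueA J; set K := V0 :|: A1 :|: A2.
have aV := subsetP sA1 _ aA; have bV := subsetP sA2 _ bA.
have [a0 a2 _ aL] := join_in1 J aV.
have [b0 b1 _ bL] := join_in1 (join_swap J) bV.
have aK : a \in K by rewrite !inE aA orbT.
have bK : b \in K by rewrite !inE bA orbT.
have naL : a \notin V0 :|: B1 :|: B2 by rewrite aL (disjointFr d1 aA).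
have nbL : b \notin V0 :|: B1 :|: B2.
  by rewrite -setUA [B1 :|: _]setUC setUA bL (disjointFr d2 bA).
apply/setP => z; rewrite inE /cadj.
apply/andP/idP => [[/orP haz /orP hbz]|zK]; last first.
  by split; case: eqVneq => //= ne; apply: cK.
case: haz hbz => [/eqP<- //|az] [/eqP<- //|bz].
case: (join_case J z) => [|zV|zV]; first by rewrite !inE => ->.
  have b1' : z \notin V2 by have [] := join_in1 J zV.
  by have := join_sealed2 J bV b1' bz; rewrite /within (negbTE nbL) orbF => /andP [].
have b1' : z \notin V1 by have [] := join_in1 (join_swap J) zV.
by have := join_sealed1 J aV b1' az; rewrite /within (negbTE naL) orbF => /andP [].
Qed.

(** * Edges from which a 2-join can be recovered *)

Definition hedge K L x y := G x y && ~~ within K L x y.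
Definition outer K x y := [&& G x y, x \notin K & y \notin K].

(** The first half makes every sealed set that contains [a] reach a vertex outside [K :|: L]. The
    second half provides, for either end of the edge, its part of a path that joins the ends through
    [L] and otherwise avoids [K]. *)
Definition side K L V a :=
  (exists2 c, c \in V :\: (K :|: L) & connect (hedge K L) a c) /\
  (exists b r, [/\ b \in V :&: L, b \notin K, connect (outer K) b r, r \notin K & G r a]).

Lemma sym_hedge K L : connect_sym (hedge K L).
Proof. by apply: sym_connect_sym => x y; rewrite /hedge (adj_sym G) within_sym. Qed.

(** Let [X] be the component of a vertex outside [K :|: L] in the graph without the edges inside [K]
    or [L]. It is sealed and lies in [V1], so by [sealed_meets] it meets both cliques. On a walk in
    [X] from [L] to [K], the first vertex of [K] is the [a] sought. *)
Lemma join_side V0 V1 V2 A1 B1 A2 B2 :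
  generalized_two_join G V0 V1 V2 A1 B1 A2 B2 ->
  exists2 a, a \in A1 & side (V0 :|: A1 :|: A2) (V0 :|: B1 :|: B2) V1 a.
Proof.
move=> J; set K := _ :|: A2; set L := _ :|: B2.
have [_ _ /set0Pn [c]] := gj_nonempty1 J; rewrite inE => /andP [cAB cV].
have [_ _ /set0Pn [d]] := gj_nonempty2 J; rewrite inE => /andP [dAB dV].
have [c0 c2 cK cL] := join_in1 J cV.
have [d0 d1 dK dL] := join_in1 (join_swap J) dV.
rewrite -setUA [A2 :|: _]setUC setUA -/K in dK; rewrite -setUA [B2 :|: _]setUC setUA -/L in dL.
have cKL : c \notin K :|: L by rewrite in_setU cK cL -in_setU.
have dKL : d \notin K :|: L by rewrite in_setU dK dL -in_setU.
pose X := [set y | connect (hedge K L) c y].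
have cX : c \in X by rewrite inE connect0.
have stepX x y : x \in X -> hedge K L x y -> y \in X.
  by rewrite !inE => h1 h2; apply: connect_trans h1 (connect1 h2).
have sX : sealed K L X.
  move=> x y xX yX xy; apply: contraNT yX => nw; apply: stepX xX _.
  by rewrite /hedge xy nw.
have XV x : x \in X -> x \in V1.
  rewrite inE => h.
  have cl : closed (hedge K L) (mem V1).
    apply: intro_closed; first exact: sym_hedge.
    move=> u v /andP [uv nw] uV; apply: contraNT nw => vV.
    exact: (join_sealed1 J uV vV uv).
  by have := closed_connect cl h; rewrite cV => <-.
have dX : d \notin X by apply: contraL dV => /XV /(join_in1 J) [].
have djX : [disjoint X & K :&: L].
  rewrite disjoints_subset; apply/subsetP => x /XV xV; have [_ _ eK eL] := join_in1 J xV.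
  rewrite !inE -/K in eK eL *; rewrite eK eL.
  by case: (boolP (x \in A1)) => //= h; have [_ _ dj] := gj_sub1 J; rewrite (disjointFr dj h).
have cK' : clique G K := gj_cliqueA J; have cL' : clique G L := gj_cliqueB J.
have [a0 a0X] := sealed_meets cL' sX djX cX cKL dX dKL.
rewrite inE => /andP [a0L a0K].
have [b0 b0X] : exists2 b, b \in X & b \in L :\: K.
  have := sealed_meets cK' (sealedC sX) _ cX _ dX _.
  by rewrite setIC setUC; apply.
rewrite inE => /andP [b0K b0L].
have hc x y : x \in X -> y \in X -> connect (hedge K L) x y.
  rewrite !inE sym_hedge => h1 h2; exact: connect_trans h1 h2.
case: (pickP [pred p : T * T | [&& p.1 \in X, p.1 \in K, p.2 \notin K,
   connect (outer K) b0 p.2 & G p.2 p.1]]) => [[a r] /and5P [aX aK rK br ra]|none].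
  exists a; first by have [_ _ <- _] := join_in1 J (XV _ aX).
  split.
    by exists c; [rewrite inE cKL|apply: hc].
  by exists b0, r; rewrite inE (XV _ b0X) b0L b0K.
(* Without such a pair, the vertices of [X] outside [K] that [b0] reaches outside [K] would be
   closed under [hedge], hence all of [X], which contains [a0]. *)
pose R := [set x | [&& x \in X, x \notin K & connect (outer K) b0 x]].
have inR x : (x \in mem R) = [&& x \in X, x \notin K & connect (outer K) b0 x].
  exact: in_set.
have cl : closed (hedge K L) (mem R).
  apply: intro_closed; first exact: sym_hedge.
  move=> x y xy; rewrite !inR => /and3P [xX xK bx].
  have yX := stepX _ _ xX xy; rewrite yX /=.
  have /andP [xy' _] := xy.
  case: (boolP (y \in K)) => yK /=.
    by have := none (y, x); rewrite /= yX yK xK bx xy'.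
  by apply: connect_trans bx (connect1 _); rewrite /outer xy' xK.
have := closed_connect cl (hc _ _ b0X a0X).
by rewrite !inR b0X a0X b0K a0K connect0.
Qed.

Definition good a b := exists V0 V1 V2 A1 B1 A2 B2,
  let K := V0 :|: A1 :|: A2 in let L := V0 :|: B1 :|: B2 in
  [/\ generalized_two_join G V0 V1 V2 A1 B1 A2 B2,
      a \in A1, b \in A2, side K L V1 a & side K L V2 b].

Lemma good_sym a b : good a b -> good b a.
Proof.
move=> [V0 [V1 [V2 [A1 [B1 [A2 [B2 [J aA bA sa sb]]]]]]]].
exists V0, V2, V1, A2, B2, A1, B1; rewrite -!setUA [A2 :|: _]setUC [B2 :|: _]setUC !setUA.
by split=> //; apply: join_swap.
Qed.

Lemma good_exists : admits_generalized_two_join G -> exists a b, good a b.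
Proof.
move=> [V0 [V1 [V2 [A1 [B1 [A2 [B2 J]]]]]]].
have [a aA sa] := join_side J; have [b bA sb] := join_side (join_swap J).
exists a, b, V0, V1, V2, A1, B1, A2, B2; split=> //.
by move: sb; rewrite -!setUA [A2 :|: _]setUC [B2 :|: _]setUC.
Qed.

Lemma good_edge a b : good a b -> G a b /\ clique G (common a b).
Proof.
move=> [V0 [V1 [V2 [A1 [B1 [A2 [B2 [J aA bA _ _]]]]]]]].
have [[sA1 _ _] [sA2 _ _]] := (gj_sub1 J, gj_sub2 J).
have cK := gj_cliqueA J; rewrite (common_join J aA bA); split=> //.
apply: cK; rewrite ?inE ?aA ?bA ?orbT //.
by apply: contraTneq bA => <-; apply: contraT => /negPn /(subsetP sA2); have [_ /negbTE-> _ _] := join_in1 J (subsetP sA1 _ aA).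
Qed.

(* The path from [a] to [b] is searched for in this (oriented) graph, whose
   paths from [b] to [a] have their inner vertices outside [K]. *)
Definition gsearch K a x y :=
  [&& G x y, ~~ ((x \in K) && (y \in K)) & (y \notin K) || (y == a)].

(** The path goes from [b] outside [K] to a vertex [b2] of [L], along an edge of the clique [L] to
    [b1], and outside [K] on to [a]. *)
Lemma good_connect a b : good a b -> connect (gsearch (common a b) a) b a.
Proof.
move=> [V0 [V1 [V2 [A1 [B1 [A2 [B2 [J aA bA [_ sa] [_ sb]]]]]]]]].
rewrite (common_join J aA bA); set K := _ :|: A2 in sa sb *.
have [b1 [r1 [b1L b1K c1 r1K r1a]]] := sa; have [b2 [r2 [b2L b2K c2 r2K r2b]]] := sb.
have aK : a \in K by rewrite !inE aA orbT.
have sub : subrel (outer K) (connect (gsearch K a)).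
  by move=> x y /and3P [xy xK yK]; apply: connect1; rewrite /gsearch xy (negbTE xK) yK.
have so : connect_sym (outer K).
  apply: sym_connect_sym => x y; rewrite /outer (adj_sym G).
  by congr (_ && _); rewrite andbC.
have b_r2 : connect (gsearch K a) b r2.
  by apply: connect1; rewrite /gsearch (adj_sym G) r2b (negbTE r2K) andbF.
have r2_b2 : connect (gsearch K a) r2 b2 by apply: (connect_sub sub); rewrite so.
have b2_b1 : connect (gsearch K a) b2 b1.
  case: (eqVneq b2 b1) => [->|ne]; first exact: connect0.
  apply: connect1; rewrite /gsearch (negbTE b1K) andbF !andbT /=.
  by apply: (gj_cliqueB J) => //; [move: b2L|move: b1L]; rewrite inE => /andP [].
have b1_r1 : connect (gsearch K a) b1 r1 by apply: (connect_sub sub).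
have r1_a : connect (gsearch K a) r1 a.
  by apply: connect1; rewrite /gsearch r1a (negbTE r1K) eqxx orbT.
by do 4?[apply: connect_trans; first eassumption].
Qed.

(** * Induced paths and the edge where they cross a 2-join *)

(** The search starts at [b], so its edges lead from [p i.+1] to [p i]. As [gsearch] excludes edges
    inside [K], the edge between the ends [a] and [b] is no chord. *)
Record induced_path K a b (p : nat -> T) (k : nat) : Prop := InducedPath {
  ip_first : p 0 = a;
  ip_last : p k = b;
  ip_edge : forall i, i < k -> gsearch K a (p i.+1) (p i);
  ip_chord : forall i j, i.+1 < j -> j <= k -> ~~ gsearch K a (p j) (p i);
  ip_inj : forall i j, i <= k -> j <= k -> p i = p j -> i = j
}.

(** All that the sweep needs of a hidden 2-join: [V] is its side containing [a], and the path leaves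
    that side along the edge from [p i0] to [p i0.+1]. *)
Record target K a (p : nat -> T) (k : nat) V i0 : Prop := Target {
  tg_range : 0 < i0 /\ i0.+1 < k;
  tg_start : a \in V /\ p 1 \in V;
  tg_edge : G (p i0) (p i0.+1);
  tg_sealed : sealed K (common (p i0) (p i0.+1)) V;
  tg_high : forall y j, y \in V -> i0.+1 < j -> j < k -> ~~ cadj (p j) y;
  tg_open : forall i, 0 < i -> i < i0 -> common (p i) (p i.+1) \subset V;
  tg_clique : clique G (common (p i0) (p i0.+1));
  tg_hub : hub K (common (p i0) (p i0.+1));
  tg_in : forall S, a \in S -> sealed K (common (p i0) (p i0.+1)) S ->
    exists2 c, c \in S & c \notin K :|: common (p i0) (p i0.+1);
  tg_out : exists2 d, d \notin V & d \notin K :|: common (p i0) (p i0.+1)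
}.

Lemma good_target a b p k : good a b -> induced_path (common a b) a b p k ->
  exists V i0, target (common a b) a p k V i0.
Proof.
move=> [V0 [V1 [V2 [A1 [B1 [A2 [B2 [J aA bA [[c cV hc] _] _]]]]]]]].
rewrite (common_join J aA bA); set K := _ :|: A2 in cV hc *; set L := _ :|: B2 in cV hc.
case=> p0 pk pe pc pinj.
have [[sA1 sB1 d1] [sA2 sB2 d2]] := (gj_sub1 J, gj_sub2 J).
have aV := subsetP sA1 _ aA; have bV := subsetP sA2 _ bA.
have aK : a \in K by rewrite !inE aA orbT.
have bK : b \in K by rewrite !inE bA orbT.
have [_ a2 _ aL] := join_in1 J aV; rewrite -/L (disjointFr d1 aA) in aL.
have bL : b \notin L.
  have [_ _ _] := join_in1 (join_swap J) bV.
  by rewrite -setUA [B2 :|: _]setUC setUA -/L (disjointFr d2 bA) => ->.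
have inner i : 0 < i -> i < k -> p i \notin K.
  move=> i0 ik; have /and3P [_ _ /orP [//|/eqP e]] := pe i ik.
  by move: i0; rewrite (pinj i 0 (ltnW ik) (leq0n _)) // e p0.
(* In [G], only the two ends of the path, both in [K], may be adjacent without being consecutive. *)
have chord i j : i.+1 < j -> j <= k -> (0 < i) || (j < k) -> ~~ G (p j) (p i).
  move=> ij jk h; apply: contra (pc i j ij jk) => g; rewrite /gsearch g /=.
  apply/andP; split.
    apply/negP => /andP [pj pi]; case/orP: h => [i0|jk'].
      by have := inner i i0 ltac:(nat_lia); rewrite pi.
    by have := inner j ltac:(nat_lia) jk'; rewrite pj.
  case: (posnP i) => [->|i0]; first by rewrite p0 eqxx orbT.
  by rewrite inner //; nat_lia.
(* The crossing edge leads to the first vertex of the path in [V2]. It is not inside [K], so it is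
   inside [L], and since [a] and [b] are outside [L], it is neither the first nor the last edge. *)
have ex2 : exists i, p i \in V2 by exists k; rewrite pk.
case: (ex_minnP ex2) => i1 i1V i1min.
have i1k : i1 <= k by apply: i1min; rewrite pk.
have i1_0 : 0 < i1.
  by case: (posnP i1) => // e; move: i1V; rewrite e p0 (negbTE a2).
have notV0 i : 0 < i -> i < k -> p i \notin V0.
  by move=> h1 h2; apply: contra (inner i h1 h2); rewrite !inE => ->.
have lowV i : i < i1 -> p i \in V1.
  move=> h; case: (posnP i) => [->|i0]; first by rewrite p0.
  case: (join_case J (p i)) => // pi; first by have := notV0 i i0 ltac:(nat_lia); rewrite pi.
  by have := i1min i pi; rewrite leqNgt h.
case: i1 => // i0 in i1V i1min i1k i1_0 lowV *.
have w0 : within K L (p i0) (p i0.+1).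
  apply: (join_sealed1 J) => //; first exact: lowV.
    by have [] := join_in1 (join_swap J) i1V.
  by have /and3P [] := pe i0 i1k; rewrite (adj_sym G).
have /and3P [g0 nK0 _] := pe i0 i1k.
have L0 : (p i0 \in L) && (p i0.+1 \in L).
  by move: w0; rewrite /within => /orP [] //; rewrite andbC (negbTE nK0).
case/andP: L0 => L0 L1.
have i0_0 : 0 < i0.
  by case: (posnP i0) => // e; move: L0; rewrite e p0 aL.
have i1k' : i0.+1 < k.
  by rewrite ltn_neqAle i1k andbT; apply: contraNneq bL => e; rewrite -pk -e.
have pB1 : p i0 \in B1 by have [_ _ _ <-] := join_in1 J (lowV i0 (leqnn _)).
have pB2 : p i0.+1 \in B2.
  have [_ _ _] := join_in1 (join_swap J) i1V.
  by rewrite -setUA [B2 :|: _]setUC setUA -/L L1.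
have eL : common (p i0) (p i0.+1) = L := common_join (join_turn J) pB1 pB2.
have highL j : i0.+1 < j -> j < k -> p j \notin L.
  move=> h1 h2; rewrite -eL inE; apply/negP => /andP [] /orP [/eqP e|g] _.
    by move: h1; rewrite -(pinj i0 j ltac:(nat_lia) ltac:(nat_lia) e) ltnNge leqnSn.
  by have := chord i0 j h1 ltac:(nat_lia); rewrite i0_0 (adj_sym G) g => /(_ isT).
(* No edge leaves [V2] from a vertex outside both cliques, so after the crossing the path stays in
   [V2]. *)
have highV j : i0 < j -> j < k -> p j \in V2.
  elim: j => // j IH; rewrite ltnS leq_eqVlt => /orP [/eqP<- //|h1] h2.
  have pj := IH h1 (ltnW h2).
  have n1 := inner j.+1 (ltn0Sn _) h2; have n2 : p j.+1 \notin L by apply: highL.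
  apply: contraNT n1 => n3.
  have /and3P [g _ _] := pe j (ltnW h2); rewrite (adj_sym G) in g.
  have := join_sealed2 J pj n3 g; rewrite -/K -/L /within (negbTE n2) andbF orbF => /andP [].
  by [].
exists V1, i0; split; rewrite ?eL //.
- by split=> //; apply: lowV.
- by rewrite (adj_sym G).
- exact: (join_sealed1 J).
- move=> y j yV h1 h2; have pj : p j \in V2 by apply: highV; nat_lia.
  have [_ nj _ _] := join_in1 (join_swap J) pj.
  apply/negP => /orP [/eqP e|g]; first by move: nj; rewrite e yV.
  have ny : y \notin V2 by have [] := join_in1 J yV.
  have := join_sealed2 J pj ny g.
  by rewrite -/K -/L /within (negbTE (inner j ltac:(nat_lia) h2)) (negbTE (highL j h1 h2)).
(* A vertex of [common (p i) (p i.+1)] outside [V1] would put [p i] into [L], next to [p i0.+1],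
   which is a chord. *)
- move=> i h1 h2; apply/subsetP => z; rewrite inE => /andP [/orP [/eqP<-|g] _].
    by apply: lowV; nat_lia.
  apply: contraT => zV.
  have pi : p i \in V1 by apply: lowV; nat_lia.
  have := join_sealed1 J pi zV g; rewrite -/K -/L /within.
  have nK : p i \notin K by apply: inner; nat_lia.
  rewrite (negbTE nK) /= -eL inE => /andP [/andP [_ /orP [/eqP e|g']] _].
    have e' := pinj i0.+1 i ltac:(nat_lia) ltac:(nat_lia) e.
    by move: h2; rewrite -e' ltnNge leqnSn.
  by have := chord i i0.+1 ltac:(nat_lia) ltac:(nat_lia); rewrite g' h1 => /(_ isT).
- by have := gj_cliqueB J.
- exact: (join_hub J).
(* A sealed set is closed under [hedge], so with [a] it contains the vertex [c] that [side] connects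
   to [a]. *)
- move=> S aS sS; exists c; last by move: cV; rewrite inE => /andP [].
  have cl : closed (hedge K L) (mem S).
    apply: intro_closed; first exact: sym_hedge.
    move=> x y /andP [xy nw] xS; apply: contraNT nw => yS.
    exact: sS.
  by have := closed_connect cl hc; rewrite aS => <-.
- have [_ _ /set0Pn [d]] := gj_nonempty2 J; rewrite inE => /andP [dAB dV].
  have [d0 nd1 dK dL] := join_in1 (join_swap J) dV.
  rewrite -setUA [A2 :|: _]setUC setUA -/K in dK; rewrite -setUA [B2 :|: _]setUC setUA -/L in dL.
  by exists d => //; rewrite in_setU dK dL -in_setU.
Qed.

End Joins.

(** * The algorithm *)

Local Notation "c1 ;; c2" := (HSeq c1 c2) (at level 60, right associativity).
Local Notation "x ::= e" := (HAsg x e) (at level 55).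
Local Notation "$ x" := (EV x) (at level 1, x at level 0).
Local Notation "k @[ e1 ; e2 ]" := (ET k e1 e2) (at level 2, left associativity, e1 at level 54, e2 at level 54).
Local Notation "k ~[ e1 ; e2 ] ::= e3" := (HPut k e1 e2 e3)
  (at level 55, e1 at level 54, e2 at level 54).
Local Notation "'When' b 'Do' c" := (HIf b c HSkip) (at level 58, b at level 57, c at level 57).
Local Notation "'If' b 'Then' c 'Else' c'" := (HIf b c c')
  (at level 58, b at level 57, c at level 57, c' at level 57).

(** * Frames and loop rules *)

Fixpoint modv (c : hcmd) : seq nat :=
  match c with
  | HSkip | HPut _ _ _ _ => [::]
  | HAsg x _ => [:: x]
  | HSeq c1 c2 | HIf _ c1 c2 => modv c1 ++ modv c2
  | HFor _ x c => x :: modv c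
  end.

Fixpoint modt (c : hcmd) : seq nat :=
  match c with
  | HSkip | HAsg _ _ => [::]
  | HPut k _ _ _ => [:: k]
  | HSeq c1 c2 | HIf _ c1 c2 => modt c1 ++ modt c2
  | HFor _ x c => modt c
  end.

(** Every edge works in the row of its own index; this syntactic check guarantees that the rows of
    later edges stay zero. *)
Fixpoint rowonly (v : nat) (c : hcmd) : bool :=
  match c with
  | HSkip | HAsg _ _ => true
  | HPut k e _ _ => if e is EV x then x == v else false
  | HSeq c1 c2 | HIf _ c1 c2 => rowonly v c1 && rowonly v c2
  | HFor _ x c => rowonly v c
  end.

Definition agree (vs ks : seq nat) (st st' : hstate) : Prop :=
  (forall x, x \notin vs -> hr st' x = hr st x) /\
  (forall k u c, k \notin ks -> ht st' k u c = ht st k u c).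

Lemma agree_trans vs ks st1 st2 st3 :
  agree vs ks st1 st2 -> agree vs ks st2 st3 -> agree vs ks st1 st3.
Proof.
move=> [v1 t1] [v2 t2]; split=> [x hx|k u c hk]; first by rewrite v2 ?v1.
by rewrite t2 ?t1.
Qed.

Lemma agree_sub vs ks vs' ks' st st' : {subset vs <= vs'} -> {subset ks <= ks'} ->
  agree vs ks st st' -> agree vs' ks' st st'.
Proof.
move=> sv sk [v t]; split=> [x hx|k u c hk].
- by apply: v; apply: contra hx; apply: sv.
- by apply: t; apply: contra hk; apply: sk.
Qed.

Lemma agree_hset vs ks x v st : x \in vs -> agree vs ks st (hset x v st).
Proof.
move=> h; split=> //= y hy; case: ifP => // e.
by move: e; rewrite -[eqn y x]/(y == x) => /eqP e; rewrite e h in hy.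
Qed.

Section Semantics.
Variable env : bound -> nat.
Local Notation run := (run env).

Lemma run_agree c st : agree (modv c) (modt c) st (run c st).
Proof.
elim: c st => [|x e|k e1 e2 e3|c1 IH1 c2 IH2|b c1 IH1 c2 IH2|bd x c IH] st //=.
- exact/agree_hset/mem_head.
- split=> //= k' u c; rewrite inE -[eqn k' k]/(k' == k) => /negbTE ->; by [].
- by apply: agree_trans (agree_sub _ _ (IH1 st)) (agree_sub _ _ (IH2 _)) => y;
    rewrite mem_cat => ->; rewrite ?orbT.
- by case: ifP => _; [apply: agree_sub (IH1 st)|apply: agree_sub (IH2 st)] => y;
    rewrite mem_cat => ->; rewrite ?orbT.
- elim: (env bd) => [|i IHi] //=; apply: agree_trans IHi _.
  apply: agree_trans (agree_hset _ _ _ (mem_head _ _)) (agree_sub _ _ (IH _)) => // y.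
  by rewrite inE => ->; rewrite orbT.
Qed.

Lemma run_row v c st k u i : rowonly v c -> v \notin modv c -> u != hr st v ->
  ht (run c st) k u i = ht st k u i.
Proof.
elim: c st => [|x e|k' e1 e2 e3|c1 IH1 c2 IH2|b c1 IH1 c2 IH2|bd x c IH] st //=.
- case: e1 => //= x /eqP -> _ h; rewrite (negbTE h) /=; by case: eqn.
- move=> /andP [r1 r2]; rewrite mem_cat negb_or => /andP [m1 m2] h.
  by rewrite IH2 ?IH1 // (run_agree c1 st).1.
- move=> /andP [r1 r2]; rewrite mem_cat negb_or => /andP [m1 m2] h.
  by case: ifP => _; [apply: IH1|apply: IH2].
- move=> rc; rewrite inE negb_or => /andP [vx m] h.
  suff: forall j, ht (iteri j (fun i st => run c (hset x i st)) st) k u i = ht st k u i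
     /\ hr (iteri j (fun i st => run c (hset x i st)) st) v = hr st v.
    by move=> /(_ (env bd)) [].
  elim=> [//|j [IHj IHv]] /=.
  have e : hr (hset x j (iteri j (fun i st => run c (hset x i st)) st)) v = hr st v.
    by rewrite /= -[eqn v x]/(v == x) (negbTE vx).
  by rewrite IH // ?e // IHj (run_agree c _).1.
Qed.

Lemma run_for bd x c st (P : nat -> hstate -> Prop) :
  P 0 st ->
  (forall i st', i < env bd -> agree (x :: modv c) (modt c) st st' -> P i st' ->
     P i.+1 (run c (hset x i st'))) ->
  P (env bd) (run (HFor bd x c) st).
Proof.
move=> P0 Pi /=.
suff: forall j, j <= env bd ->
    P j (iteri j (fun i st => run c (hset x i st)) st) /\
    agree (x :: modv c) (modt c) st (iteri j (fun i st => run c (hset x i st)) st).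
  by case/(_ _ (leqnn _)).
elim=> [|j IHj] //= hj; have [Pj aj] := IHj (ltnW hj); split; first exact: Pi.
apply: agree_trans aj _.
apply: agree_trans (agree_hset _ _ _ (mem_head _ _)) (agree_sub _ _ (run_agree _ _)) => // y.
by rewrite inE => ->; rewrite orbT.
Qed.

Lemma run_seq c1 c2 st : run (c1 ;; c2) st = run c2 (run c1 st).
Proof. by []. Qed.

Lemma run_if b c1 c2 st :
  run (If b Then c1 Else c2) st = if beval st b then run c1 st else run c2 st.
Proof. by []. Qed.

Lemma run_when b c st : run (When b Do c) st = if beval st b then run c st else st.
Proof. by []. Qed.

End Semantics.

(** * Text of the loop program *)

Local Notation ve := 0. Local Notation vq := 1. Local Notation vu := 2. Local Notation vv := 3.
Local Notation vj := 4. Local Notation vl := 5. Local Notation vx := 6. Local Notation vy := 7.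
Local Notation vz := 8. Local Notation vok := 9. Local Notation vkc := 10. Local Notation vtl := 11.
Local Notation vh := 12. Local Notation via := 13. Local Notation vlen := 14. Local Notation vhd := 15.
Local Notation vi := 16. Local Notation vmx := 17. Local Notation vks := 18. Local Notation vp := 19.
Local Notation vc := 20. Local Notation vdm := 21. Local Notation vkl := 22. Local Notation vsl := 23.
Local Notation vt2 := 24. Local Notation vfd := 25. Local Notation vfr := 26. Local Notation vD := 27.

(* The tables at row u:
   - kI: the input and output cells (u = 0); kM: the reflexive adjacency matrix;
     kA: the list of N[u], whose length is in column u of kd (row 0);
     kF: at column v, whether L(u,v) is a clique;
   - with u the index of the current edge ab: kK, kV, kS mark the members of K, the
     vertices visited by the search and the members of S; kQ and kR are the queues
     of the search and of S; kpr holds at t the queue index of the parent of the t-th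
     visited vertex; kP is the path; khi holds at x the largest j with 0 < j < k and
     x in N[p_j], or 0. *)
Local Notation kI := 0. Local Notation kM := 1. Local Notation kA := 2. Local Notation kd := 3.
Local Notation kF := 4. Local Notation kK := 5. Local Notation kV := 6. Local Notation kQ := 7.
Local Notation kpr := 8. Local Notation kP := 9. Local Notation khi := 10. Local Notation kS := 11.
Local Notation kR := 12.

(** Loop bounds are fixed, so every list is run through in [BD] rounds, those past its end being
    idle. *)
Definition nbrs (x j y : nat) (body : hcmd) : hcmd :=
  HFor BD j (When BLt $j kd@[EC 0; $x] Do (y ::= kA@[$x; $j] ;; body)).

Definition read_edge : hcmd :=
  vu ::= kI@[EC 0; $vq] ;; vv ::= kI@[EC 0; ES $vq] ;; vq ::= ES (ES $vq).

Definition add_arc (u v : nat) : hcmd :=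
  kM~[$u; $v] ::= EC 1 ;;
  kA~[$u; kd@[EC 0; $u]] ::= $v ;;
  kd~[EC 0; $u] ::= ES kd@[EC 0; $u].

Definition build : hcmd :=
  HFor Bn vx (kM~[$vx; $vx] ::= EC 1 ;; kA~[$vx; EC 0] ::= $vx ;;
              kd~[EC 0; $vx] ::= EC 1) ;;
  vq ::= EC 2 ;;
  HFor Bm ve (read_edge ;; add_arc vu vv ;; add_arc vv vu) ;;
  vD ::= EC 0 ;;
  HFor Bn vx (When BLt $vD kd@[EC 0; $vx] Do vD ::= kd@[EC 0; $vx]).

Definition check_clique : hcmd :=
  vok ::= EC 1 ;;
  nbrs vu vj vx (When BNz kM@[$vv; $vx] Do
    nbrs vu vl vy (When BAnd (BNz kM@[$vv; $vy]) (BNot (BNz kM@[$vx; $vy])) Do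
      vok ::= EC 0)).

(** All clique tests together cost [O(m D^2)]; inside the sweeps they would be repeated for each of
    the [m] edges. Both orientations are stored, as a path may use an edge either way. *)
Definition flags : hcmd :=
  vq ::= EC 2 ;;
  HFor Bm ve (read_edge ;; check_clique ;;
    kF~[$vu; $vv] ::= $vok ;; kF~[$vv; $vu] ::= $vok).

Definition mark_K : hcmd :=
  vkc ::= EC 0 ;;
  nbrs vu vj vx (When BNz kM@[$vv; $vx] Do
    (kK~[$ve; $vx] ::= EC 1 ;; vkc ::= ES $vkc)).

(** In [via], zero stands for not found: queue index zero belongs to [b]. *)
Definition search_visit : hcmd :=
  When BAnd (BNot (BNz kV@[$ve; $vy]))
    (BAnd (BNot (BAnd (BNz kK@[$ve; $vx]) (BNz kK@[$ve; $vy])))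
          (BNot (BAnd (BNz kK@[$ve; $vy]) (BNot (BEq $vy $vu))))) Do
   ((When BEq $vy $vu Do via ::= $vtl) ;;
    kV~[$ve; $vy] ::= EC 1 ;; kQ~[$ve; $vtl] ::= $vy ;;
    kpr~[$ve; $vtl] ::= $vh ;; vtl ::= ES $vtl).

Definition search : hcmd :=
  vtl ::= EC 1 ;; via ::= EC 0 ;;
  kV~[$ve; $vv] ::= EC 1 ;; kQ~[$ve; EC 0] ::= $vv ;;
  HFor Bn vh (When BLt $vh $vtl Do
    (vx ::= kQ@[$ve; $vh] ;; nbrs vx vj vy search_visit)).

(** [khi] is overwritten with increasing positions on the path, so the largest one remains. The ends
    are left out: [a] precedes the first step, and [b] has queue index zero. *)
Definition trace_step : hcmd :=
  vz ::= kpr@[$ve; $vz] ;; vlen ::= ES $vlen ;; vx ::= kQ@[$ve; $vz] ;;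
  kP~[$ve; $vlen] ::= $vx ;;
  (When BNz $vz Do nbrs vx vj vy (khi~[$ve; $vy] ::= $vlen)).

Definition trace : hcmd :=
  vlen ::= EC 0 ;; vz ::= $via ;; kP~[$ve; EC 0] ::= $vu ;;
  HFor Bn vh (When BNz $vz Do trace_step).

Definition add_y : hcmd :=
  kS~[$ve; $vy] ::= EC 1 ;; kR~[$ve; $vtl] ::= $vy ;; vtl ::= ES $vtl ;;
  (When BLt $vmx khi@[$ve; $vy] Do vmx ::= khi@[$ve; $vy]) ;;
  (When BNot (BNz kK@[$ve; $vy]) Do vks ::= ES $vks).

(* [vi] holds i - 1 when the clique under consideration is the one of the i-th
   edge of the path. *)
Definition open_clique : hcmd :=
  nbrs vc vj vy (When BAnd (BNz kM@[$vp; $vy]) (BNot (BNz kS@[$ve; $vy])) Do add_y) ;;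
  vi ::= ES $vi.

Definition in_clique (y : nat) : bexpr := BAnd (BNz kM@[$vp; $y]) (BNz kM@[$vc; $y]).

Definition scan : hcmd :=
  vx ::= kR@[$ve; $vhd] ;; vhd ::= ES $vhd ;;
  nbrs vx vj vy
   (When BAnd (BNot (BNz kS@[$ve; $vy]))
     (BAnd (BNot (BAnd (BNz kK@[$ve; $vx]) (BNz kK@[$ve; $vy])))
           (BNot (BAnd (in_clique vx) (in_clique vy)))) Do add_y).

(** Walks along the clique [L] of the edge [vp], [vc] only, so that a test takes [O(D)] steps. It
    finds the sizes of [K :|: L], [K :|: L :&: S] and [K :|: S :|: L] and the largest closed degree
    in [K :&: L]. Comparing these numbers decides the hub condition and whether some vertex of [S],
    and some vertex outside [S], avoids [K :|: L]. *)
Definition count_clique : hcmd :=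
  vdm ::= EC 0 ;; vkl ::= $vkc ;; vsl ::= $vkc ;; vt2 ::= $vks ;;
  nbrs vc vj vy (When BNz kM@[$vp; $vy] Do
    (If BNz kK@[$ve; $vy] Then
       (When BLt $vdm kd@[EC 0; $vy] Do vdm ::= kd@[EC 0; $vy])
     Else (vkl ::= ES $vkl ;;
       (If BNz kS@[$ve; $vy] Then vsl ::= ES $vsl Else vt2 ::= ES $vt2)))).

(** After a success [vfr], [vp] and [vc] are left alone: [output] reads [K], [S] and the second
    clique through them. *)
Definition step : hcmd :=
  When BAnd (BEq $vfd (EC 0)) (BLt (ES $vi) $vlen) Do
   (vp ::= kP@[$ve; $vi] ;; vc ::= kP@[$ve; ES $vi] ;;
    (If BLt (ES $vi) $vmx Then open_clique Else
    (If BLt $vhd $vtl Then scan Else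
     (count_clique ;;
      (If BAnd (BNz kF@[$vp; $vc]) (BAnd (BNot (BLt $vkl $vdm))
          (BAnd (BLt $vsl $vks) (BLt $vt2 kI@[EC 0; EC 0]))) Then
        (vfd ::= EC 1 ;; vfr ::= $ve)
       Else open_clique))))).

(** A step that neither succeeds nor is idle advances the head of the queue or [vi]. Either happens
    at most [n] times, hence the two loops. *)
Definition sweep : hcmd :=
  vtl ::= EC 0 ;; vhd ::= EC 0 ;; vi ::= EC 1 ;; vmx ::= EC 0 ;; vks ::= $vkc ;;
  vy ::= $vu ;; add_y ;; vy ::= kP@[$ve; EC 1] ;; add_y ;;
  HFor Bn vh step ;; HFor Bn vh step.

Definition try_edge : hcmd :=
  mark_K ;; search ;;
  (When BNz $via Do (trace ;; (When BLt (EC 2) $vlen Do sweep))).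

Definition try_edges : hcmd :=
  vq ::= EC 2 ;; vfd ::= EC 0 ;;
  HFor Bm ve (read_edge ;;
    (When BAnd (BEq $vfd (EC 0)) (BNz kF@[$vu; $vv]) Do try_edge)).

Definition label : hcmd :=
  If BNz kK@[$vfr; $vx] Then
    (If in_clique vx Then vz ::= EC 0 Else
     (If BNz kS@[$vfr; $vx] Then vz ::= EC 1 Else vz ::= EC 4))
  Else
    (If in_clique vx Then
      (If BNz kS@[$vfr; $vx] Then vz ::= EC 2 Else vz ::= EC 5)
     Else
      (If BNz kS@[$vfr; $vx] Then vz ::= EC 3 Else vz ::= EC 6)).

Definition output : hcmd :=
  kI~[EC 0; EC 0] ::= $vfd ;;
  (When BNz $vfd Do HFor Bn vx (label ;; kI~[EC 0; ES $vx] ::= $vz)).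

(** The program is cut here because the bound [BD] of the later loops is computed by [build], in
    [vD]. *)
Definition phase1 := build.
Definition phase2 := flags ;; try_edges ;; output.

(** * Adjacency lists *)

Lemma eqn_eqE a b : eqn a b = (a == b). Proof. by []. Qed.

Lemma gt0b (b : bool) : (0 < b) = b. Proof. by case: b. Qed.

Section Lists.
Variable n : nat.
Implicit Types (x y u v : 'I_n) (S : {set 'I_n}) (q : seq 'I_n).

Definition tset (f : nat -> nat) S := forall x, f x = (x \in S).

Definition tseq (f : nat -> nat) q := forall i, i < size q -> f i = nth 0 (map val q) i.

Lemma tseq_nth f q x0 i : tseq f q -> i < size q -> f i = nth x0 q i.
Proof. by move=> h hi; rewrite h // (nth_map x0). Qed.

Lemma tset_add (f g : nat -> nat) S x : tset f S -> (forall c, g c = if c == x then 1 else f c) -> tset g (x |: S).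
Proof.
move=> h e y; rewrite e !inE h -val_eqE.
by case: ifP.
Qed.

Lemma tseq_rcons (f g : nat -> nat) q x : tseq f q -> (forall c, g c = if c == size q then val x else f c) ->
  tseq g (rcons q x).
Proof.
move=> h e i; rewrite size_rcons ltnS e map_rcons nth_rcons size_map.
by rewrite leq_eqVlt; case: eqVneq => [->|ne] /= hi; [rewrite ltnn|rewrite hi h].
Qed.

Definition has_lists (R : rel 'I_n) (f : 'I_n -> seq 'I_n) (st : hstate) : Prop :=
  [/\ forall x y, ht st kM x y = R x y,
      forall x, ht st kd 0 x = size (f x)
    & forall x, tseq (ht st kA x) (f x)].

Lemma has_lists_agree vs ks R f st st' :
  kM \notin ks -> kd \notin ks -> kA \notin ks ->
  agree vs ks st st' -> has_lists R f st -> has_lists R f st'.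
Proof.
move=> nM nd nA [_ t] [hM hd hA]; split=> [x y|x|x i hi]; rewrite t //.
exact: hA.
Qed.

Lemma has_lists_ext R R' f f' st : R =2 R' -> f =1 f' -> has_lists R f st -> has_lists R' f' st.
Proof.
move=> eR ef [hM hd hA]; split=> [x y|x|x]; rewrite -?eR -?ef //; exact: hA.
Qed.

Section Nbrs.
Variables (env : bound -> nat) (R : rel 'I_n) (nb : 'I_n -> seq 'I_n).
Hypothesis nb_bound : forall x, size (nb x) <= env BD.

(** The invariant depends on the part of the list done so far. It must survive a change of the loop
    index, which is all that an idle round does. *)
Lemma run_nbrs (P : seq 'I_n -> hstate -> Prop) a j b body st v :
  [&& a != j, a != b, a \notin modv body, kM \notin modt body, kA \notin modt body
    & kd \notin modt body] ->
  hr st a = v -> has_lists R nb st ->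
  (forall s st' i, P s st' -> P s (hset j i st')) -> P [::] st ->
  (forall s w t st', nb v = s ++ w :: t -> P s st' -> hr st' a = v ->
     agree (j :: b :: modv body) (modt body) st st' -> has_lists R nb st' ->
     P (rcons s w) (run env body (hset b w (hset j (size s) st')))) ->
  P (nb v) (run env (nbrs a j b body) st).
Proof.
case/and5P=> aj ab am nM /andP [nA nd] ev hl Pj P0 Ps.
pose Q i st' := [/\ P (take i (nb v)) st' & agree (j :: b :: modv body) (modt body) st st'].
suff [] : Q (env BD) (run env (nbrs a j b body) st) by rewrite take_oversize.
rewrite /nbrs; apply: (run_for (P := Q)).
  by split; rewrite ?take0.
move=> i st' hi _ [PQ aQ].
have ea : hr st' a = v by rewrite aQ.1 // !inE !negb_or aj ab am.
have hl' : has_lists R nb st' by apply: has_lists_agree aQ hl.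
have [hM hd hA] := hl'.
rewrite /= !eqn_eqE eqxx (negbTE aj) ea hd.
have aj' : agree (j :: b :: modv body) (modt body) st (hset j i st').
  by apply: agree_trans aQ (agree_hset _ _ _ (mem_head _ _)).
case: ltnP => hs; last first.
  split=> //; rewrite take_oversize; last by rewrite ltnW.
  by apply: Pj; rewrite -(take_oversize hs).
rewrite (tseq_nth v (hA v)) //.
split.
  rewrite (take_nth v) //.
  have e : nb v = take i (nb v) ++ nth v (nb v) i :: drop i.+1 (nb v).
    by rewrite -drop_nth // cat_take_drop.
  by have := Ps _ _ _ _ e PQ ea aQ hl'; rewrite size_takel // ltnW.
apply: agree_trans aj' _.
have hb : b \in j :: b :: modv body by rewrite !inE eqxx orbT.
apply: agree_trans (agree_hset _ _ _ hb) _.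
by apply: agree_sub (run_agree _ _ _) => // y; rewrite !inE => ->; rewrite !orbT.
Qed.

End Nbrs.
End Lists.

Section Build.
Variables (n : nat) (G : sgraph 'I_n) (es : seq ('I_n * 'I_n)).
Hypothesis esG : edge_list G es.
Implicit Types x y : 'I_n.

Definition add_list (u v : 'I_n) (f : 'I_n -> seq 'I_n) x :=
  if x == u then rcons (f x) v else f x.

Definition add_edge f (p : 'I_n * 'I_n) := add_list p.2 p.1 (add_list p.1 p.2 f).

Definition nbl (s : seq ('I_n * 'I_n)) : 'I_n -> seq 'I_n := foldl add_edge (fun x => [:: x]) s.

Definition rel_of (s : seq ('I_n * 'I_n)) : rel 'I_n :=
  fun x y => [|| x == y, (x, y) \in s | (y, x) \in s].

Lemma mem_nbl s x y : (y \in nbl s x) = rel_of s x y.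
Proof.
rewrite /nbl /rel_of; elim/last_ind: s => [|s [u v] IH]; first by rewrite /= !inE eq_sym !orbF.
rewrite foldl_rcons /add_edge /add_list /= !mem_rcons !in_cons !xpair_eqE.
case xv : (x == v); case xu : (x == u);
  rewrite ?mem_rcons ?in_cons ?mem_rcons ?in_cons -/(nbl s) IH /rel_of ?andbF ?andbT /= ?orbF //;
  case: (x == y); case: (_ \in s); case: (_ \in s); case: (y == u); case: (y == v);
  by rewrite ?orbT ?orbF.
Qed.

Lemma rel_of_edges : rel_of es =2 cadj G.
Proof.
move=> x y; rewrite /rel_of /cadj; case: eqVneq => //= _.
have [_ h1 h2] := esG.
case xy : (G x y); first by have := h2 x y xy; do 2!case: (_ \in _).
apply/negbTE; rewrite negb_or; apply/andP; split.
- by apply/negP => /h1; rewrite xy.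
- by apply/negP => /h1; rewrite (adj_sym G) xy.
Qed.

(** By induction on prefixes of [es]: [edge_list] keeps the next edge, in either orientation, out of
    the prefix, so the two lists it extends do not yet have the new entries. *)
Lemma uniq_nbl x : uniq (nbl es x).
Proof.
have [u h1 h2] := esG.
suff : forall s t, es = s ++ t -> uniq (nbl s x) by move/(_ es [::]); rewrite cats0; apply.
elim/last_ind => [//|s [a b] IH] t; rewrite cat_rcons => e.
have := IH _ e; have ab : (a, b) \in es by rewrite e mem_cat mem_head orbT.
have gab := h1 _ _ ab.
have nab : a == b = false by apply/negP => /eqP ab'; move: gab; rewrite ab' (adj_irr G).
have ns : ~~ rel_of s a b.
  rewrite /rel_of nab /=; apply/norP; split; apply/negP => hs.
    by move: u; rewrite e cat_uniq => /and3P [_ /hasPn /(_ (a, b)) ]; rewrite mem_head hs => /(_ isT).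
  have := h2 _ _ gab; rewrite ab e mem_cat hs; by [].
have ns' : ~~ rel_of s b a by move: ns; rewrite /rel_of eq_sym orbC -!orbA orbCA; case: (_ == _); do 2!case: (_ \in _).
have m1 := mem_nbl s a b; have m2 := mem_nbl s b a.
rewrite /nbl foldl_rcons /add_edge /add_list /=.
rewrite -/(nbl s).
case: (eqVneq x b) => [->|xb].
  by rewrite [b == a]eq_sym nab rcons_uniq m2 ns' .
by case: (eqVneq x a) => [->|xa] //; rewrite rcons_uniq m1 ns.
Qed.

Lemma size_nbl x : size (nbl es x) = #|[set y | G x y]|.+1.
Proof.
have -> : size (nbl es x) = #|x |: [set y | G x y]|.
  rewrite -(card_uniqP (uniq_nbl x)); apply: eq_card => y.
  by rewrite mem_nbl rel_of_edges !inE /cadj eq_sym.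
by rewrite cardsU1 inE (adj_irr G).
Qed.

Lemma size_edges : size es = num_edges G.
Proof.
have [u h1 h2] := esG.
rewrite -(size_map (fun p => [set p.1; p.2]) es) /num_edges.
have um : uniq (map (fun p : 'I_n * 'I_n => [set p.1; p.2]) es).
  rewrite map_inj_in_uniq // => -[a b] [c d] /= h h' /setP e.
  have gab := h1 _ _ h; have gcd := h1 _ _ h'.
  have := h2 _ _ gab; rewrite h => hba.
  have := e a; have := e b; rewrite !inE !eqxx orbT /=.
  move=> /esym/orP [] /eqP eb /esym/orP [] /eqP ea; subst.
  - by move: gab; rewrite (adj_irr G).
  - by move: hba; rewrite h'.
  - by [].
  - by move: gab; rewrite (adj_irr G).
rewrite -(card_uniqP um); apply: eq_card => X.
apply/mapP/imsetP => [[[a b] h ->]|[[a b] h ->]].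
  by exists (a, b); rewrite // inE /= h1.
rewrite inE /= in h; have := h2 _ _ h.
case ab : (_ \in _) => /= hba; first by exists (a, b).
by exists (b, a); [move: hba; case: (_ \in _)|rewrite setUC].
Qed.

Variable env : bound -> nat.
Hypothesis envn : env Bn = n.
Hypothesis envm : env Bm = size es.

Definition input_cells : nat -> nat := Defs.mem (input es).

(** Row 0 of table 0 occupies the addresses below the row width, so the input is in place from the
    start. *)
Definition hinit : hstate :=
  HState (fun=> 0) (fun k u c => if (k == 0) && (u == 0) then input_cells c else 0).

Definition has_input (st : hstate) := forall c, ht st kI 0 c = input_cells c.

Lemma nth_flatten_pairs (s : seq ('I_n * 'I_n)) (x0 : 'I_n * 'I_n) i : i < size s ->
  nth 0 (flatten [seq [:: val p.1; val p.2] | p <- s]) i.*2 = (nth x0 s i).1 /\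
  nth 0 (flatten [seq [:: val p.1; val p.2] | p <- s]) i.*2.+1 = (nth x0 s i).2.
Proof. by elim: s i => [|p s IH] [|i] // /IH. Qed.

Lemma input_edge (x0 : 'I_n * 'I_n) i : i < size es ->
  input_cells i.*2.+2 = (nth x0 es i).1 /\ input_cells i.*2.+3 = (nth x0 es i).2.
Proof. exact: nth_flatten_pairs. Qed.

Lemma run_read_edge i st (x0 : 'I_n * 'I_n) : i < size es -> has_input st -> hr st vq = i.*2.+2 ->
  run env read_edge st = hset vq i.+1.*2.+2 (hset vv (nth x0 es i).2 (hset vu (nth x0 es i).1 st)).
Proof.
move=> hi hI hq; have [e1 e2] := input_edge x0 hi.
by rewrite /= hq !hI e1 e2 doubleS.
Qed.

Lemma run_add_arc R (f : 'I_n -> seq 'I_n) st a b (u v : 'I_n) :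
  hr st a = u -> hr st b = v -> has_lists R f st ->
  has_lists (fun x y => R x y || (x == u) && (y == v)) (add_list u v f) (run env (add_arc a b) st).
Proof.
move=> ea eb [hM hd hA]; split=> [x y|x|x]; rewrite /= ?ea ?eb /=.
- have e : (x == u) && (y == v) = (x == u :> nat) && (y == v :> nat) by [].
  rewrite hM e; case: (_ && _); by rewrite ?orbT ?orbF.
- by rewrite /add_list !hd -val_eqE /=; case: eqP => //= /val_inj ->; rewrite size_rcons.
- rewrite /add_list -val_eqE /=; case: (eqVneq (val x) u) => [/val_inj->|ne].
    by apply: tseq_rcons (hA u) _ => c /=; rewrite eqxx hd.
  by move=> i hi; rewrite /= (negbTE ne) /=; apply: hA.
Qed.

Definition built st := has_input st /\ has_lists (cadj G) (nbl es) st.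

Lemma run_build :
  let st := run env build hinit in
  [/\ built st, forall k u c, 3 < k -> ht st k u c = 0,
      forall x, size (nbl es x) <= hr st vD
    & hr st vD <= (0 < n) * (max_degree G).+1].
Proof.
rewrite /build.
set l1 := HFor Bn vx _; set l2 := HFor Bm ve _; set l3 := HFor Bn vx (When _ Do _).
rewrite -[run env _ hinit]/(run env l3 (hset vD 0 (run env l2 (hset vq 2 (run env l1 hinit))))).
have I1 : has_lists (fun x y => x == y) (fun x => [:: x]) (run env l1 hinit).
  pose P i st := [/\ forall x y, ht st kM x y = (x < i) && (x == y),
    forall x, ht st kd 0 x = (x < i) & forall x, x < i -> ht st kA x 0 = x].
  have [] : P (env Bn) (run env l1 hinit).
    apply: (run_for (P := P)); first by split.
    move=> i st' hi _ [h1 h2 h3]; split=> [x y|x|x] /=.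
    - rewrite h1 [in RHS]ltnS [in RHS]leq_eqVlt -[x == y]val_eqE /=.
      case: (eqVneq (val x) i) => [e|ne] //=; rewrite e ?ltnn /= [i == _]eq_sym.
      by case: (_ == i).
    - by rewrite h2 [in RHS]ltnS [in RHS]leq_eqVlt; case: (_ == i).
    - rewrite ltnS leq_eqVlt /=; case: (eqVneq (x : nat) i) => [->|ne] //=.
      exact: h3.
  rewrite envn => h1 h2 h3; split=> [x y|x|x [|]//=]; rewrite ?h1 ?h2 ?h3 ?ltn_ord //.
have a1 := run_agree env l1 hinit.
have I2 : let st := run env l2 (hset vq 2 (run env l1 hinit)) in built st.
  pose P i st := [/\ hr st vq = i.*2.+2, has_input st &
     has_lists (rel_of (take i es)) (nbl (take i es)) st].
  have [] : P (env Bm) (run env l2 (hset vq 2 (run env l1 hinit))).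
    apply: (run_for (P := P)).
      split=> //; first by move=> c; rewrite [LHS](a1.2).
      by rewrite take0; case: I1 => h1 h2 h3; split=> //= x y; rewrite h1 /rel_of /= orbF.
    move=> i st' hi _ [hq hI hl]; rewrite envm in hi.
    have x0 : 'I_n * 'I_n by case: (es) hi.
    set c := HSeq _ _.
    have := run_read_edge (st := hset ve i st') x0 hi hI hq.
    set st1 := run env read_edge _ => e1.
    rewrite -[run env c _]/(run env (add_arc vv vu) (run env (add_arc vu vv) st1)).
    set u := (nth x0 es i).1 in e1; set v := (nth x0 es i).2 in e1.
    have hl1 : has_lists (rel_of (take i es)) (nbl (take i es)) st1 by rewrite e1.
    have r1 : hr st1 vu = u /\ hr st1 vv = v by rewrite e1.
    have hl2 := run_add_arc r1.1 r1.2 hl1.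
    set st2 := run env (add_arc vu vv) st1 in hl2 *.
    have a2 := run_agree env (add_arc vu vv) st1; rewrite -/st2 in a2.
    have r2 : hr st2 vu = u /\ hr st2 vv = v by rewrite !a2.1.
    have hl3 := run_add_arc r2.2 r2.1 hl2.
    have a3 := run_agree env (add_arc vv vu) st2.
    split.
    + by rewrite a3.1 // a2.1 // e1.
    + by move=> d; rewrite a3.2 // a2.2 // e1 //=; apply: hI.
    rewrite (take_nth x0) //; apply: has_lists_ext hl3.
      move=> x y; rewrite /rel_of !mem_rcons !in_cons [nth _ _ _]surjective_pairing !xpair_eqE -/u -/v.
      rewrite [(y == u) && _]andbC -!orbA; congr (_ || _).
      by case: (_ \in take _ _); case: (_ \in take _ _); case: (_ && _); case: (_ && _).
    by move=> x; rewrite /nbl foldl_rcons.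
  rewrite envm take_size => _ hI hl; split=> //.
  exact: has_lists_ext rel_of_edges _ hl.
set st2 := run env l2 _ in I2 *.
have a2 := run_agree env l2 (hset vq 2 (run env l1 hinit)); rewrite -/st2 in a2.
have a3 := run_agree env l3 (hset vD 0 st2).
pose P i st := (forall x, x < i -> size (nbl es x) <= hr st vD) /\
  hr st vD <= (0 < i) * (max_degree G).+1.
have [P1 P2] : P (env Bn) (run env l3 (hset vD 0 st2)).
  apply: run_for; first by split.
  move=> i st' hi a [h1 h2].
  rewrite envn in hi; have [_ hl] := I2.
  have [_ hd _] : has_lists (cadj G) (nbl es) st' by apply: has_lists_agree a _.
  rewrite /= -[i]/(val (Ordinal hi)) hd.
  have hs : size (nbl es (Ordinal hi)) <= (max_degree G).+1.
    by rewrite size_nbl ltnS; apply: (leq_bigmax (Ordinal hi)).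
  case: ltnP => hlt; split=> [x|] /=; rewrite ?mul1n //.
  - rewrite ltnS leq_eqVlt => /orP [/eqP e|/h1 h]; last nat_lia.
    by have -> : x = Ordinal hi; [apply: val_inj|nat_lia].
  - rewrite ltnS leq_eqVlt => /orP [/eqP e|/h1 h]; last nat_lia.
    by have -> : x = Ordinal hi; [apply: val_inj|nat_lia].
  - nat_lia.
split.
- have [hI hl] := I2; split; first by move=> c; rewrite a3.2 //; apply: hI.
  exact: (has_lists_agree _ _ _ a3 (st := hset vD 0 st2)).
- move=> k u c hk.
  have nk : k \notin [:: kI; kM; kA; kd; kM; kA; kd].
    by rewrite !inE !negb_or; do !(apply/andP; split); apply: contraTneq hk => ->.
  have s1 : {subset modt l1 <= [:: kI; kM; kA; kd; kM; kA; kd]} by apply/allP.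
  have s2 : {subset modt l2 <= [:: kI; kM; kA; kd; kM; kA; kd]} by apply/allP.
  rewrite a3.2 // [LHS]a2.2; last by apply: contra nk; apply: s2.
  rewrite [LHS]a1.2; last by apply: contra nk; apply: s1.
  by case: k hk {nk}.
- by move=> x; apply: P1; rewrite envn.
- have -> : (0 < n) = (0 < env Bn) by rewrite envn.
  exact: P2.
Qed.

End Build.

(** * Cliques and induced paths *)

Section Search.
Variables (n : nat) (G : sgraph 'I_n) (nb : 'I_n -> seq 'I_n) (env : bound -> nat).
Hypothesis nb_uniq : forall x, uniq (nb x).
Hypothesis nb_mem : forall x y, (y \in nb x) = cadj G x y.
Hypothesis nb_bound : forall x, size (nb x) <= env BD.
Hypothesis envn : env Bn = n.
Implicit Types (x y a b : 'I_n) (K S : {set 'I_n}) (q s : seq 'I_n).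

Local Notation has_graph := (has_lists (cadj G) nb).

Let nbrsP := run_nbrs (R := cadj G) nb_bound.

Definition cliqueb K := [forall x in K, forall y in K, cadj G x y].

Lemma cliqueP K : reflect (clique G K) (cliqueb K).
Proof.
apply: (iffP forall_inP) => [h x y xK yK ne|h x xK].
  by have /forall_inP/(_ y yK) := h x xK; rewrite /cadj (negbTE ne).
by apply/forall_inP => y yK; rewrite /cadj; case: eqVneq => //= ne; apply: h.
Qed.

Lemma run_check_clique st a b :
  hr st vu = a -> hr st vv = b -> has_graph st ->
  hr (run env check_clique st) vok = cliqueb (common G a b).
Proof.
move=> ea eb hl.
pose inner w (s : seq 'I_n) := all (fun y => cadj G b y ==> cadj G w y) s.
pose P s st' := hr st' vok = all (fun w => cadj G b w ==> inner w (nb a)) s.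
have : P (nb a) (run env check_clique st).
  rewrite /check_clique run_seq; set bd1 := When _ Do _.
  apply: (nbrsP (P := P) (v := a)) => //.
  move=> s w t st' es Ps ea' ag hl'.
  rewrite /P all_rcons /bd1 run_when [beval _ _]/=; have [hM _ _] := hl'.
  have eb' : hr st' vv = b by rewrite ag.1.
  rewrite eb' hM gt0b; case bw : (cadj G b w); last exact: Ps.
  pose P2 s2 st2 := hr st2 vok = inner w s2 && all (fun w => cadj G b w ==> inner w (nb a)) s.
  apply: (nbrsP (P := P2) (v := a)) => //.
  move=> s2 w2 t2 st2 es2 Ps2 ea2 ag2 hl2.
  have [hM2 _ _] := hl2.
  have eb2 : hr st2 vv = b by rewrite ag2.1.
  have ew2 : hr st2 vx = w by rewrite ag2.1.
  rewrite /P2 /inner all_rcons run_when [beval _ _]/= eb2 ew2 !hM2 !gt0b.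
  case bw2 : (cadj G b w2) => /=; last by move: Ps2; rewrite /P2.
  by case aw : (cadj G w w2) => //=; rewrite Ps2.
rewrite /P => ->; congr nat_of_bool; apply/allP/cliqueP => [h|/cliqueP /forall_inP h x].
  apply/cliqueP; apply/forall_inP => x; rewrite inE => /andP [ax bx].
  have := h x; rewrite nb_mem ax => /(_ isT); rewrite bx => /allP h2.
  by apply/forall_inP => y; rewrite inE => /andP [ay by_]; have := h2 y; rewrite nb_mem ay by_; apply.
rewrite nb_mem => ax; apply/implyP => bx; apply/allP => y; rewrite nb_mem => ay.
apply/implyP => by_.
have := h x; rewrite inE ax bx => /(_ isT) /forall_inP; apply.
by rewrite inE ay by_.
Qed.

Lemma common_sym x y : common G x y = common G y x.
Proof. by apply/setP => z; rewrite !inE andbC. Qed.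

Lemma run_flags es st : edge_list G es -> env Bm = size es ->
  has_input es st -> has_graph st -> (forall u c, ht st kF u c = 0) ->
  forall x y, ht (run env flags st) kF x y = G x y && cliqueb (common G x y).
Proof.
move=> esG envm hI hl hF.
pose P i st := [/\ hr st vq = i.*2.+2, has_input es st, has_graph st &
  forall x y, ht st kF x y =
    (((x, y) \in take i es) || ((y, x) \in take i es)) && cliqueb (common G x y)].
rewrite /flags run_seq.
set st0 := run env (vq ::= EC 2) st; set bd := _ ;; _.
have [] : P (env Bm) (run env (HFor Bm ve bd) st0).
  apply: (run_for (P := P)); first by split=> // x y; rewrite take0 hF.
  move=> i st' hi _ [hq hI' hl' hF']; rewrite envm in hi.
  have x0 : 'I_n * 'I_n by case: (es) hi.
  have := run_read_edge env (st := hset ve i st') x0 hi hI' hq.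
  rewrite /bd 3!run_seq; set st1 := run env read_edge _ => e1.
  set u := (nth x0 es i).1 in e1; set v := (nth x0 es i).2 in e1.
  have hl1 : has_graph st1 by rewrite e1.
  have r1 : hr st1 vu = u /\ hr st1 vv = v by rewrite e1.
  have ok := run_check_clique r1.1 r1.2 hl1.
  have a2 := run_agree env check_clique st1.
  set st2 := run env check_clique st1 in a2 ok *.
  have r2 : hr st2 vu = u /\ hr st2 vv = v by rewrite !a2.1.
  have hl2 : has_graph st2 by apply: has_lists_agree a2 _.
  split.
  - by rewrite /= a2.1 // e1.
  - by move=> c; rewrite /= a2.2 // e1 /=; apply: hI'.
  - by case: hl2.
  move=> x y /=; rewrite r2.1 r2.2 a2.2 // e1 /= hF' ok (take_nth x0) // !mem_rcons !in_cons.
  rewrite [nth x0 es i]surjective_pairing !xpair_eqE -/u -/v.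
  have -> : (x == v :> nat) && (y == u :> nat) = (x == v) && (y == u) by [].
  have -> : (x == u :> nat) && (y == v :> nat) = (x == u) && (y == v) by [].
  case: ifP => [/andP [/eqP-> /eqP->]|h1]; first by rewrite !eqxx orbT common_sym.
  case: ifP => [/andP [/eqP-> /eqP->]|h2]; first by [].
  by rewrite [(y == u) && _]andbC h1.
move=> _ _ _ hF' x y; rewrite hF' envm take_size; congr nat_of_bool; congr (_ && _).
have := rel_of_edges esG x y; rewrite /rel_of /cadj; case: eqVneq => //= <- _.
have [_ h1 _] := esG; rewrite orbb (adj_irr G).
by apply/negP => /h1; rewrite (adj_irr G).
Qed.

(** * Breadth-first search for one edge *)

Section Row.
Variables (r : nat) (a b : 'I_n).

Lemma run_mark_K st : hr st ve = r -> hr st vu = a -> hr st vv = b -> has_graph st ->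
  (forall c, ht st kK r c = 0) ->
  tset (ht (run env mark_K st) kK r) (common G a b) /\
  hr (run env mark_K st) vkc = #|common G a b|.
Proof.
move=> er ea eb hl z.
pose X s := [set x in s | cadj G b x].
pose P s st' := tset (ht st' kK r) (X s) /\ hr st' vkc = #|X s|.
have : P (nb a) (run env mark_K st).
  rewrite /mark_K run_seq.
  apply: (nbrsP (P := P) (v := a)) => //.
    split=> [x|] /=; first by rewrite z !inE.
    by rewrite (_ : X [::] = set0) ?cards0 //; apply/setP => x; rewrite !inE.
  move=> s w t st' es [P1 P2] ea' ag hl'.
  have [hM _ _] := hl'.
  have eb' : hr st' vv = b by rewrite ag.1.
  have er' : hr st' ve = r by rewrite ag.1.
  have ws : w \notin s.
    by have := nb_uniq a; rewrite es cat_uniq => /and3P [_ /hasPn h _]; apply: h; rewrite mem_head.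
  rewrite run_when /= eb' hM gt0b.
  rewrite /P; case bw : (cadj G b w) => /=; last first.
    have -> : X (rcons s w) = X s.
      apply/setP => x; rewrite !inE mem_rcons in_cons.
      by case: eqVneq => // ->; rewrite bw (negbTE ws).
    by [].
  have e : X (rcons s w) = w |: X s.
    apply/setP => x; rewrite !inE mem_rcons in_cons.
    by case: eqVneq => // ->; rewrite bw.
  split; rewrite e.
    by apply: (tset_add P1) => c /=; rewrite er' eqxx.
  by rewrite /= P2 cardsU1 !inE (negbTE ws).
have -> : common G a b = X (nb a) by apply/setP => x; rewrite !inE nb_mem.
by [].
Qed.

Variable K : {set 'I_n}.

(** [h] is the queue index being scanned and [s] the part of its list done. [sv_done] records more
    than reachability: a vertex seen from index [i] has its parent at an index at most [i], which is
    what makes the traced path induced. *)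
Record sinv (h : nat) (s q : seq 'I_n) (st : hstate) : Prop := SInv {
  sv_uniq : uniq q;
  sv_first : 0 < size q /\ nth b q 0 = b;
  sv_tl : hr st vtl = size q;
  sv_vis : tset (ht st kV r) [set x in q];
  sv_q : tseq (ht st kQ r) q;
  sv_pr0 : ht st kpr r 0 = 0;
  sv_par : forall t, 0 < t -> t < size q -> [/\ ht st kpr r t < t, ht st kpr r t <= h
     & gsearch G K a (nth b q (ht st kpr r t)) (nth b q t)];
  sv_done : forall i y, i < h \/ (i = h /\ y \in s) -> i < size q ->
     gsearch G K a (nth b q i) y ->
     exists t, [/\ t < size q, nth b q t = y & ht st kpr r t <= i];
  sv_a : hr st via = if a \in q then index a q else 0
}.

Lemma sinv_ext h s q st st' :
  sinv h s q st -> (forall k c, k \in [:: kV; kQ; kpr] -> ht st' k r c = ht st k r c) ->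
  hr st' vtl = hr st vtl -> hr st' via = hr st via -> sinv h s q st'.
Proof.
case=> u f tl vis sq p0 par dn sa hk e1 e2; split=> //; rewrite ?e1 ?e2 //.
- by move=> x; rewrite hk.
- by move=> i hi; rewrite hk // sq.
- by rewrite hk.
- by move=> t h1 h2; rewrite !hk //; apply: par.
- by move=> i y h1 h2 h3; have [t] := dn i y h1 h2 h3; exists t; rewrite hk.
Qed.

Lemma run_visit h s q st w :
  sinv h s q st -> h < size q -> cadj G (nth b q h) w ->
  hr st vh = h -> hr st vx = nth b q h -> hr st vy = w -> hr st vu = a -> hr st ve = r ->
  tset (ht st kK r) K ->
  exists q', sinv h (rcons s w) q' (run env search_visit st) /\ take (size q) q' = q.
Proof.
move=> I hq xw eh ex ey ea er tK; set x := nth b q h in xw ex.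
have [u [f1 f2] tl vis sq p0 par dn sa] := I.
rewrite /search_visit run_when [beval _ _]/= er ex ey ea vis !tK !gt0b !inE.
case: ifP => cond; last first.
  exists q; rewrite take_size; split=> //; split=> // i y hi his g.
  case: hi => [hi|[ei]]; first by apply: dn => //; left.
  rewrite mem_rcons in_cons => /orP [/eqP ey'|ys]; last by apply: dn => //; right.
  move: g; rewrite ei ey' -/x => g.
  have wq : w \in q.
    apply: contraFT cond => wq; case/and3P: g => _ -> /= h3; rewrite wq /=.
    by case/orP: h3 => [/negbTE -> //|/eqP ->]; rewrite eqxx andbF.
  exists (index w q); rewrite index_mem wq nth_index //; split=> //.
  case: (posnP (index w q)) => [->|i0]; first by rewrite p0.
  by have [] := par _ i0; rewrite ?index_mem.
case/and3P: cond => wq nK wK.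
have g : gsearch G K a x w.
  apply/and3P; split=> //; last first.
    by move: wK; rewrite negb_and negbK.
  case/orP: xw => // /eqP e; move: wq; rewrite -e mem_nth //.
exists (rcons q w); split; last by rewrite -cats1 take_size_cat.
have sz : size (rcons q w) = (size q).+1 by rewrite size_rcons.
set st' := run env _ st.
have hV c : ht st' kV r c = if c == w then 1 else ht st kV r c.
  by rewrite /st' run_seq run_when; case: (beval _ _); rewrite /= er ey eqxx.
have hQ c : ht st' kQ r c = if c == size q then val w else ht st kQ r c.
  by rewrite /st' run_seq run_when; case: (beval _ _); rewrite /= er ey eqxx tl.
have hpr c : ht st' kpr r c = if c == size q then h else ht st kpr r c.
  by rewrite /st' run_seq run_when; case: (beval _ _); rewrite /= er eh eqxx tl.
have htl : hr st' vtl = (size q).+1.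
  by rewrite /st' run_seq run_when; case: (beval _ _); rewrite /= tl.
have hia : hr st' via = if w == a then size q else hr st via.
  by rewrite /st' run_seq run_when [beval _ _]/= ea ey -val_eqE; case: (_ == _); rewrite /= ?tl.
have qlt t : t < size q -> t == size q = false by move=> lt; rewrite ltn_eqF.
split.
- by rewrite rcons_uniq wq.
- by rewrite sz nth_rcons f1.
- by rewrite htl sz.
- have -> : [set y in rcons q w] = w |: [set y in q].
    by apply/setP => y; rewrite !inE mem_rcons.
  exact: tset_add vis _.
- exact: tseq_rcons sq _.
- by rewrite hpr qlt.
- move=> t t0; rewrite sz ltnS leq_eqVlt hpr.
  case: eqVneq => [-> _|ne /= lt].
    by rewrite hq leqnn !nth_rcons hq ltnn eqxx.
  have [h1 h2 h3] := par t t0 lt; split=> //.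
  by rewrite !nth_rcons lt (ltn_trans h1 lt).
- move=> i y hi his gi.
  have done_old : forall i y, i < h \/ (i = h /\ y \in s) -> i < size q ->
     gsearch G K a (nth b q i) y ->
     exists t, [/\ t < size (rcons q w), nth b (rcons q w) t = y & ht st' kpr r t <= i].
    move=> i' y' h1 h2 h3; have [t [t1 t2 t3]] := dn i' y' h1 h2 h3.
    by exists t; rewrite sz ltnW // nth_rcons t1 hpr qlt.
  have hi' : i <= h by case: hi => [/ltnW|[->]].
  have lt : i < size q by apply: leq_ltn_trans hi' hq.
  rewrite nth_rcons lt in gi.
  case: hi => [hi|[ei]]; first by apply: done_old => //; left.
  rewrite mem_rcons in_cons => /orP [/eqP ->|ys]; last by apply: done_old => //; right.
  by exists (size q); rewrite sz ltnSn nth_rcons ltnn eqxx hpr eqxx ei.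
- rewrite hia mem_rcons in_cons [a == w]eq_sym sa -cats1 index_cat /=.
  case: eqVneq => [e|_]; first by rewrite -e (negbTE wq) ?eqxx addn0.
  by case: (a \in q).
Qed.

Lemma run_search st :
  hr st ve = r -> hr st vu = a -> hr st vv = b -> has_graph st -> tset (ht st kK r) K ->
  (forall k c, k \in [:: kV; kQ; kpr] -> ht st k r c = 0) ->
  exists q, sinv n [::] q (run env search st).
Proof.
move=> er ea eb hl tK z.
pose P h st' := exists q, sinv h [::] q st'.
rewrite /search 4!run_seq.
set st1 := run env (kQ~[_; _] ::= _) _.
have : P (env Bn) (run env (HFor Bn vh (When BLt $vh $vtl Do
    (vx ::= kQ@[$ve; $vh] ;; nbrs vx vj vy search_visit))) st1).
  apply: (run_for (P := P)).
    exists [:: b]; split=> //.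
    - by rewrite /st1 /= er eb => x; rewrite /= eqxx z // !inE -val_eqE /=; case: (_ == _).
    - by rewrite /st1 /= er eb => -[|//] _ /=; rewrite !eqxx.
    - by rewrite /st1 /= z.
    - by move=> [|[|t]].
    - by move=> i y [//|[_]]; rewrite in_nil.
    - by rewrite /st1 /= inE; case: ifP => // /eqP->; rewrite eqxx.
  move=> h st' hn ag [q I].
  have er' : hr st' ve = r by rewrite ag.1.
  have ea' : hr st' vu = a by rewrite ag.1.
  have hl' : has_graph st' by apply: (has_lists_agree _ _ _ ag) => //; apply: hl.
  have tK' : tset (ht st' kK r) K by move=> x; rewrite ag.2 // /st1 /= tK.
  rewrite run_when [beval _ _]/= (sv_tl I).
  case: ltnP => hq; last first.
    exists q; case: I => u f tl vis sq p0 par dn sa; split=> //.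
    - by move=> t h1 h2; have [p1 p2 p3] := par t h1 h2; split=> //; apply: leqW.
    - move=> i y [h1|[//]] h2; apply: dn => //; left; exact: leq_trans h2 hq.
  have I' : sinv h [::] q (run env (vx ::= kQ@[$ve; $vh]) (hset vh h st')) by apply: sinv_ext I _ _ _.
  rewrite run_seq; set st2 := run env (vx ::= _) _ in I' *.
  set x := nth b q h.
  have ex : hr st2 vx = x by rewrite /st2 /= er' (tseq_nth b (sv_q I)).
  pose P2 s st3 := exists q', sinv h s q' st3 /\ take (size q) q' = q.
  have : P2 (nb x) (run env (nbrs vx vj vy search_visit) st2).
    apply: (nbrsP (P := P2) (v := x)) => //.
    - by move=> s st3 i [q' [I3 tk]]; exists q'; split=> //; apply: sinv_ext I3 _ _ _.
    - by exists q; rewrite take_size.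
    move=> s w t st3 es [q' [I3 tk]] ex3 ag3 hl3.
    have sq : size q <= size q' by rewrite -tk size_take; case: ltnP => // /ltnW.
    have ex' : nth b q' h = x by rewrite /x -tk nth_take.
    have hq' := leq_trans hq sq.
    have xw : cadj G (nth b q' h) w by rewrite ex' -nb_mem es mem_cat mem_head orbT.
    set st4 := hset vy w _.
    have I4 : sinv h s q' st4 by apply: sinv_ext I3 _ _ _.
    have e1 : hr st4 vh = h by rewrite /st4 /= ag3.1.
    have e2 : hr st4 vx = nth b q' h by rewrite /st4 /= ex3 ex'.
    have e3 : hr st4 vu = a by rewrite /st4 /= ag3.1.
    have e4 : hr st4 ve = r by rewrite /st4 /= ag3.1.
    have e5 : tset (ht st4 kK r) K by move=> y; rewrite /st4 /= ag3.2 //= tK'.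
    have [q'' [I5 tk']] := run_visit I4 hq' xw e1 e2 (erefl _) e3 e4 e5.
    exists q''; split=> //.
    by rewrite -(take_takel _ sq) tk' tk.
  move=> [q' [I3 tk]]; exists q'.
  have sq : size q <= size q' by rewrite -tk size_take; case: ltnP => // /ltnW.
  have ex' : nth b q' h = x by rewrite /x -tk nth_take.
  case: I3 => u f tl vis sq' p0 par dn sa; split=> //.
  - by move=> t h1 h2; have [p1 p2 p3] := par t h1 h2; split=> //; apply: leqW.
  - move=> i y [h1|[//]] h2 g; rewrite ltnS leq_eqVlt in h1.
    case/orP: h1 => [/eqP e|h1]; last by apply: dn => //; left.
    apply: dn => //; right; split=> //.
    by move: g; rewrite e ex' nb_mem /cadj => /and3P [-> _ _]; rewrite orbT.
by rewrite envn.
Qed.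

Lemma run_trace q st : sinv n [::] q st -> a \in q -> a != b ->
  hr st ve = r -> hr st vu = a -> has_graph st -> (forall c, ht st khi r c = 0) ->
  let st' := run env trace st in
  exists (p : nat -> 'I_n) k, [/\ hr st' vlen = k, forall i, i <= k -> ht st' kP r i = p i,
     induced_path G K a b p k,
     forall j x, 0 < j -> j < k -> cadj G (p j) x -> j <= ht st' khi r x
   & forall x, 0 < ht st' khi r x ->
       ht st' khi r x < k /\ cadj G (p (ht st' khi r x)) x].
Proof.
case=> u [f1 f2] tl vis sq p0 par dn; set pr := ht st kpr r in p0 par dn *.
move=> sa aq ab er ea hl zhi st'; rewrite {}/st' aq in sa *.
(* The queue index of the [i]-th ancestor of [a]; index zero, that of [b], is its own parent. *)
pose js i := iter i pr (index a q); pose p i := nth b q (js i).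
have sqn : size q <= n by rewrite -(card_uniqP u) (leq_trans (max_card _)) ?card_ord.
have jslt i : js i < size q.
  elim: i => [|i IH] /=; first by rewrite index_mem.
  case: (posnP (js i)) => [e|j0]; first by rewrite -/(js i) e p0.
  by have [h _ _] := par _ j0 IH; apply: ltn_trans h IH.
have jsS i : 0 < js i -> js i.+1 < js i /\ gsearch G K a (p i.+1) (p i).
  by move=> h; have [] := par _ h (jslt i).
have jsm m : (forall i, i < m -> 0 < js i) -> js m + m <= index a q.
  elim: m => [|m IH] h; first by rewrite addn0.
  have := IH (fun i hi => h i (ltnW hi)); have [] := jsS m (h m (ltnSn _)); lia.
pose T c st' := exists len, [/\ [/\ len <= c, hr st' vlen = len, hr st' vz = js len,
    js len = 0 \/ len = c & forall i, i < len -> 0 < js i],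
   forall i, i <= len -> ht st' kP r i = p i,
   forall j x, 0 < j -> j <= len -> 0 < js j -> cadj G (p j) x -> j <= ht st' khi r x
 & forall x, 0 < ht st' khi r x -> [/\ ht st' khi r x <= len, 0 < js (ht st' khi r x)
       & cadj G (p (ht st' khi r x)) x]].
rewrite /trace 3!run_seq; set st1 := run env (kP~[_; _] ::= _) _.
have : T (env Bn) (run env (HFor Bn vh (When BNz $vz Do trace_step)) st1).
  apply: (run_for (P := T)).
    exists 0; split=> /=.
    - by split=> //; right.
    - by move=> i; rewrite leqn0 => /eqP->; rewrite er ea !eqxx /p /= nth_index.
    - by move=> j x; lia.
    - by move=> x; rewrite zhi.
  move=> c st' hc ag [len [[l1 l2 l3 l4 l5] hP H1 H2]].
  rewrite run_when [beval _ _]/= l3; case: (posnP (js len)) => [e|jpos].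
    exists len; split=> //; split=> //; [exact: leqW|by left].
  have el : len = c by case: l4 => // e; rewrite e in jpos.
  have er' : hr st' ve = r by rewrite ag.1.
  have hl' : has_graph st' by apply: (has_lists_agree _ _ _ ag) => //; apply: hl.
  have hpr t : ht st' kpr r t = pr t by rewrite ag.2.
  have hq t : ht st' kQ r t = ht st kQ r t by rewrite ag.2.
  have l5' : forall i, i < len.+1 -> 0 < js i.
    by move=> i; rewrite ltnS leq_eqVlt => /orP [/eqP->|/l5].
  rewrite /trace_step 4!run_seq; set st2 := run env (kP~[_; _] ::= _) _.
  have z2 : hr st2 vz = js len.+1 by rewrite /st2 /= l3 er' hpr.
  have x2 : hr st2 vx = p len.+1.
    by rewrite /st2 /= l3 er' hpr hq (tseq_nth b sq) //; exact: (jslt len.+1).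
  have n2 : hr st2 vlen = len.+1 by rewrite /st2 /= l2.
  have e2 : hr st2 ve = r by rewrite /st2 /= er'.
  have hl2 : has_graph st2 by case: hl'.
  have hi2 x : ht st2 khi r x = ht st' khi r x by [].
  have P2 i : i <= len.+1 -> ht st2 kP r i = p i.
    have -> : ht st2 kP r i = if i == len.+1 then (p len.+1 : nat) else ht st' kP r i.
      by rewrite -x2 -n2 /st2 /= er' eqxx.
    by rewrite leq_eqVlt; case: eqVneq => [->|ne] //= h; apply: hP.
  rewrite run_when -[beval _ _]/(0 < hr st2 vz) z2; case: (posnP (js len.+1)) => [e|jpos'].
    exists len.+1; split=> //.
    - by split=> //; left.
    - move=> j x j0; rewrite leq_eqVlt => /orP [/eqP->|]; first by rewrite e.
      exact: H1.
    - by move=> x; rewrite hi2 => /H2 [h1 h2 h3]; split=> //; apply: leqW.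
  pose Q s st3 := forall x, ht st3 khi r x = if x \in s then len.+1 else ht st' khi r x.
  set st3 := run env (nbrs _ _ _ _) st2.
  have hQ : Q (nb (p len.+1)) st3.
    apply: (nbrsP (P := Q) (v := p len.+1)) => //.
    move=> s w t st4 es Qs ex4 ag4 hl4 x /=.
    rewrite (ag4.1 ve) // e2 eqxx (ag4.1 vlen) // n2 mem_rcons in_cons Qs -val_eqE /=.
    by case: (_ == _).
  have ag3 := run_agree env (nbrs vx vj vy (khi~[$ve; $vy] ::= $vlen)) st2; rewrite -/st3 in ag3.
  exists len.+1; split=> //.
  - by split; rewrite ?ag3.1 //; right; rewrite el.
  - by move=> i hi; rewrite ag3.2 // P2.
  - move=> j x j0 jl jp jx; rewrite hQ nb_mem; case: ifP => // nx.
    apply: H1 => //; move: jl; rewrite leq_eqVlt => /orP [/eqP e|//].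
    by move: nx; rewrite -e jx.
  - move=> x; rewrite hQ nb_mem; case: ifP => // _ /H2 [h1 h2 h3]; split=> //.
    exact: leqW.
case=> k [[l1 l2 l3 l4 l5] hP H1 H2].
(* Otherwise the trace would have made [n] strict descents starting below [size q <= n]. *)
have jk : js k = 0.
  case: l4 => // ek; rewrite envn in ek; have := jsm k l5.
  have : index a q < size q by rewrite index_mem.
  by rewrite ek; lia.
have jdec i j : i < j -> j <= k -> js j < js i.
  elim: j => // j IH; rewrite ltnS leq_eqVlt => /orP [/eqP->|lt] hj.
    by have [] := jsS j (l5 j hj).
  by have := IH lt (ltnW hj); have [] := jsS j (l5 j hj); lia.
have pinj i j : i <= k -> j <= k -> p i = p j -> i = j.
  move=> hi hj /eqP; rewrite nth_uniq ?jslt // => /eqP e.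
  by case: (ltngtP i j) => // h; have := jdec _ _ h; rewrite e ltnn => /(_ ltac:(assumption)).
exists p, k; split=> //.
- split=> //.
  + by rewrite /p /= nth_index.
  + by rewrite /p jk.
  + by move=> i hi; have [] := jsS i (l5 i hi).
  (* If the search saw [p i] from [p j], the parent [p i.+1] of [p i] would have an index at most
     that of [p j]; but indices decrease along the path. *)
  + move=> i j ij jk'; apply/negP => g.
    have [t [t1 t2 t3]] := dn (js j) (p i) (or_introl (leq_trans (jslt j) sqn)) (jslt j) g.
    move/eqP: t2; rewrite nth_uniq ?jslt // => /eqP e; rewrite e in t3.
    by have := jdec _ _ ij jk'; rewrite /= -/(js i) ltnNge t3.
- move=> j x j0 jk'; apply: H1 => //; [exact: ltnW|exact: l5].
- move=> x /H2 [h1 h2 h3]; split=> //.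
  by rewrite ltn_neqAle h1 andbT; apply: contraTneq h2 => ->; rewrite jk.
Qed.

End Row.
End Search.

(** * Growing one side of the join *)

Section Sweep.
Variables (n : nat) (G : sgraph 'I_n) (nb : 'I_n -> seq 'I_n) (env : bound -> nat).
Hypothesis nb_uniq : forall x, uniq (nb x).
Hypothesis nb_mem : forall x y, (y \in nb x) = cadj G x y.
Hypothesis nb_bound : forall x, size (nb x) <= env BD.
Hypothesis envn : env Bn = n.
Implicit Types (x y v w : 'I_n) (S : {set 'I_n}) (q s : seq 'I_n).

Local Notation has_graph := (has_lists (cadj G) nb).
Let nbrsP := run_nbrs (R := cadj G) nb_bound.

(** The hypotheses of [sealed_join] for the sets stored in row [r], without reference to any hidden
    2-join. *)
Definition found st := exists r K S u w,
  [/\ [/\ hr st vfd = 1, hr st vfr = r, hr st vp = nat_of_ord u & hr st vc = nat_of_ord w],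
      tset (ht st kK r) K, tset (ht st kS r) S &
      [/\ clique G K, clique G (common G u w), hub G K (common G u w),
          sealed G K (common G u w) S &
          (exists2 c, c \in S & c \notin K :|: common G u w) /\
          (exists2 d, d \notin S & d \notin K :|: common G u w)]].

Variables (r : nat) (K : {set 'I_n}) (a : 'I_n) (p : nat -> 'I_n) (k : nat) (hi : 'I_n -> nat).
Hypothesis cliqueK : clique G K.
Hypothesis hi_ge : forall j x, 0 < j -> j < k -> cadj G (p j) x -> j <= hi x.
Hypothesis hi_adj : forall x, 0 < hi x -> hi x < k /\ cadj G (p (hi x)) x.

Local Notation L i := (common G (p i) (p i.+1)).

Record static st : Prop := Static {
  st_graph : has_graph st;
  st_ve : hr st ve = r;
  st_vlen : hr st vlen = k;
  st_vkc : hr st vkc = #|K|;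
  st_K : tset (ht st kK r) K;
  st_P : forall i, i <= k -> ht st kP r i = p i;
  st_F : forall x y, ht st kF x y = G x y && cliqueb G (common G x y);
  st_hi : forall x, ht st khi r x = hi x;
  st_n : ht st kI 0 0 = n
}.

Lemma static_agree vs ks st st' :
  all (fun z => z \notin vs) [:: ve; vlen; vkc] ->
  all (fun z => z \notin ks) [:: kI; kM; kA; kd; kF; kK; kP; khi] ->
  agree vs ks st st' -> static st -> static st'.
Proof.
move=> /and4P [v1 v2 v3 _] /= /and5P [k0 k1 k2 k3 /and5P [k4 k5 k6 k7 _]] ag.
case=> hg e1 e2 e3 tK tP tF th tn; split; rewrite ?ag.1 //.
- exact: has_lists_agree ag hg.
- by move=> x; rewrite ag.2.
- by move=> i ik; rewrite ag.2 // tP.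
- by move=> x y; rewrite ag.2.
- by move=> x; rewrite ag.2.
- by rewrite ag.2.
Qed.

Record dyn S q hd i mx st : Prop := Dyn {
  dy_S : tset (ht st kS r) S;
  dy_q : tseq (ht st kR r) q;
  dy_uniq : uniq q;
  dy_mem : S =i q;
  dy_tl : hr st vtl = size q;
  dy_hd : hr st vhd = hd;
  dy_i : hr st vi = i;
  dy_mx : hr st vmx = mx;
  dy_ks : hr st vks = #|K :|: S|
}.

Lemma dyn_agree vs ks S q hd i mx st st' :
  all (fun z => z \notin vs) [:: vtl; vhd; vi; vmx; vks] ->
  all (fun z => z \notin ks) [:: kS; kR] ->
  agree vs ks st st' -> dyn S q hd i mx st -> dyn S q hd i mx st'.
Proof.
move=> /and5P [v1 v2 v3 v4 /andP [v5 _]] /and3P [k1 k2 _] ag.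
case=> tS tq u m e1 e2 e3 e4 e5; split; rewrite ?ag.1 //.
- by move=> x; rewrite ag.2.
- by move=> j hj; rewrite ag.2 // tq.
Qed.

Lemma run_add_y S q hd i mx st y :
  static st -> dyn S q hd i mx st -> hr st vy = y -> y \notin S ->
  dyn (y |: S) (rcons q y) hd i (maxn mx (hi y)) (run env add_y st).
Proof.
move=> sta [tS tq u m e1 e2 e3 e4 e5] ey yS.
have er := st_ve sta.
rewrite /add_y; set c4 := When BLt _ _ Do _; set c5 := When BNot _ Do _.
rewrite 4!run_seq; set st3 := run env (vtl ::= _) _.
have h3 : hr st3 vy = y /\ hr st3 ve = r by rewrite /st3 /= ey er.
have s3 : ht st3 kK r y = (y \in K) /\ ht st3 khi r y = hi y.
  by split; [apply: (st_K sta)|apply: (st_hi sta)].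
set st4 := run env c4 st3.
have E4 : st4 = if mx < hi y then hset vmx (hi y) st3 else st3.
  rewrite /st4 /c4 run_when.
  rewrite -[beval _ _]/(hr st3 vmx < ht st3 khi (hr st3 ve) (hr st3 vy)).
  rewrite -[run _ _ _]/(hset vmx (ht st3 khi (hr st3 ve) (hr st3 vy)) st3).
  by rewrite h3.1 h3.2 s3.2 (_ : hr st3 vmx = mx).
have ag4 : agree [:: vmx] [::] st3 st4.
  by rewrite E4; case: ifP => // _; apply: agree_hset; rewrite mem_head.
have e4' : hr st4 vmx = maxn mx (hi y).
  by rewrite E4; case: ltnP.
set st5 := run env c5 st4.
have E5 : st5 = if y \notin K then hset vks (hr st4 vks).+1 st4 else st4.
  rewrite /st5 /c5 run_when.
  rewrite -[beval _ _]/(~~ (0 < ht st4 kK (hr st4 ve) (hr st4 vy))).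
  by rewrite ag4.2 // (ag4.1 ve) // (ag4.1 vy) // h3.1 h3.2 s3.1 gt0b.
have ag5 : agree [:: vks] [::] st4 st5.
  by rewrite E5; case: ifP => // _; apply: agree_hset; rewrite mem_head.
split.
- apply: (tset_add tS) => c; rewrite ag5.2 // ag4.2 // /st3 /= er eqxx ey.
  by [].
- apply: (tseq_rcons tq) => c; rewrite ag5.2 // ag4.2 // /st3 /= er eqxx ey e1.
  by [].
- by rewrite rcons_uniq u -m yS.
- by move=> x; rewrite !inE mem_rcons in_cons m.
- by rewrite ag5.1 // ag4.1 // /st3 /= e1 size_rcons.
- by rewrite ag5.1 // ag4.1.
- by rewrite ag5.1 // ag4.1.
- by rewrite ag5.1.
- have -> : K :|: (y |: S) = y |: (K :|: S) by rewrite setUCA.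
  rewrite cardsU1 in_setU (negbTE yS) orbF E5.
  have e5' : hr st4 vks = #|K :|: S| by rewrite ag4.1.
  by case: (y \in K) => /=; rewrite e5'.
Qed.

(** Common to [open_clique] and [scan], which differ in the list walked and in the test [g]. The
    maximum [mx'] is described by bounds from below and above, the only form in which it is used. *)
Lemma run_adds (c : nat) (B : bexpr) (g : pred 'I_n) v S q hd i mx st :
  c \in [:: vx; vc] -> hr st c = v -> static st -> dyn S q hd i mx st ->
  (forall S' st' w, agree [:: vj; vy; vtl; vmx; vks] [:: kS; kR] st st' ->
     tset (ht st' kS r) S' -> hr st' vy = w -> beval st' B = (w \notin S') && g w) ->
  exists q' mx',
    [/\ dyn (S :|: [set w in nb v | g w]) q' hd i mx' (run env (nbrs c vj vy (When B Do add_y)) st),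
        take (size q) q' = q, mx <= mx',
        forall w, w \in nb v -> g w -> w \notin S -> hi w <= mx' &
        forall M, mx <= M -> (forall w, w \in nb v -> g w -> hi w <= M) -> mx' <= M].
Proof.
move=> hc ev sta dy hB.
pose P s st' := exists q' mx',
    [/\ dyn (S :|: [set w in s | g w]) q' hd i mx' st',
        take (size q) q' = q, mx <= mx',
        forall w, w \in s -> g w -> w \notin S -> hi w <= mx' &
        forall M, mx <= M -> (forall w, w \in s -> g w -> hi w <= M) -> mx' <= M].
apply: (nbrsP (P := P) (v := v)) => //.
- by move: hc; rewrite !inE => /orP [] /eqP ->.
- exact: st_graph sta.
- move=> s st' j [q' [mx' [d1 d2 d3 d4 d5]]]; exists q', mx'; split=> //.
  by apply: dyn_agree (agree_hset [::] _ _ (mem_head vj [::])) d1.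
- exists q, mx; split=> //; last by rewrite take_size.
  by have -> : [set w in [::] | g w] = set0; [apply/setP => w; rewrite !inE|rewrite setU0].
move=> s w t st' es [q' [mx' [d1 d2 d3 d4 d5]]] ev' ag hl.
have ag' : agree [:: vj; vy; vtl; vmx; vks] [:: kS; kR] st st'.
  apply: agree_sub ag; first by apply/allP.
  by apply/allP.
set st1 := hset vy w _.
have ag1 : agree [:: vj; vy; vtl; vmx; vks] [:: kS; kR] st st1.
  apply: agree_trans ag' _; apply: agree_trans (agree_hset _ _ _ _) (agree_hset _ _ _ _) => //.
have d1' : dyn (S :|: [set w in s | g w]) q' hd i mx' st1 by case: d1.
have sta1 : static st1 by apply: static_agree ag1 sta.
rewrite run_when (hB _ _ w ag1 (dy_S d1')) //.
set S1 := S :|: [set w in s | g w] in d1 d1' *.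
have eS : S :|: [set x in rcons s w | g x] = if g w then w |: S1 else S1.
  apply/setP => x; rewrite (fun_if (fun A : {set _} => x \in A)) !inE mem_rcons in_cons.
  by case gw : (g w); case: eqVneq => [->|_] //=; rewrite ?gw ?orbT ?andbF ?orbF ?andbT.
case gw : (g w) eS => eS; last first.
  rewrite andbF; exists q', mx'; rewrite eS; split=> //.
  - move=> x; rewrite mem_rcons in_cons => /orP [/eqP->|]; [by rewrite gw|exact: d4].
  - by move=> M h1 h2; apply: d5 => // x xs; apply: h2; rewrite mem_rcons in_cons xs orbT.
case: (boolP (w \in S1)) => wS /=.
  exists q', mx'; rewrite eS (setUidPr _) ?sub1set //; split=> //.
  - move=> x; rewrite mem_rcons in_cons => /orP [/eqP->|]; last exact: d4.
    by move=> _ nS; move: wS; rewrite inE (negbTE nS) inE gw andbT => ws; apply: d4.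
  - by move=> M h1 h2; apply: d5 => // x xs; apply: h2; rewrite mem_rcons in_cons xs orbT.
exists (rcons q' w), (maxn mx' (hi w)); rewrite eS; split=> //.
- exact: run_add_y.
- have sq : size q <= size q' by rewrite -d2 size_take; case: ltnP => // /ltnW.
  by rewrite -cats1 takel_cat.
- by rewrite leq_max d3.
- move=> x; rewrite mem_rcons in_cons => /orP [/eqP->|xs gx nx]; first by rewrite leq_max leqnn orbT.
  by rewrite leq_max d4.
- move=> M h1 h2; rewrite geq_max h2 ?mem_rcons ?mem_head // andbT.
  by apply: d5 => // x xs; apply: h2; rewrite mem_rcons in_cons xs orbT.
Qed.

Lemma run_count_clique S q hd i mx st (u v : 'I_n) :
  static st -> dyn S q hd i mx st -> hr st vp = u -> hr st vc = v ->
  let st' := run env count_clique st in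
  [/\ hr st' vdm = \max_(x <- nb v | cadj G u x && (x \in K)) size (nb x),
      hr st' vkl = #|K :|: common G u v|,
      hr st' vsl = #|K :|: common G u v :&: S| &
      hr st' vt2 = #|K :|: S :|: common G u v|].
Proof.
move=> sta dy eu ev st'.
pose X s := [set x in s | cadj G u x].
pose P s st' := [/\ hr st' vdm = \max_(x <- s | cadj G u x && (x \in K)) size (nb x),
      hr st' vkl = #|K :|: X s|, hr st' vsl = #|K :|: X s :&: S| &
      hr st' vt2 = #|K :|: S :|: X s|].
have eX : common G u v = X (nb v).
  by apply/setP => x; rewrite !inE nb_mem andbC.
rewrite eX /st'; rewrite /count_clique 4!run_seq.
set st1 := run env (vt2 ::= _) _; set bd := When _ Do _.
have ag1 : agree [:: vdm; vkl; vsl; vt2] [::] st st1.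
  have ag z e st0 : z \in [:: vdm; vkl; vsl; vt2] ->
      agree [:: vdm; vkl; vsl; vt2] [::] st0 (run env (z ::= e) st0).
    exact: agree_hset.
  by do 3![apply: agree_trans; last exact: ag]; apply: ag.
suff : P (nb v) (run env (nbrs vc vj vy bd) st1) by [].
apply: (nbrsP (P := P) (v := v)) => //.
- exact: st_graph sta.
- have X0 : X [::] = set0 by apply/setP => x; rewrite !inE.
  by rewrite /P X0 big_nil set0I !setU0 /st1 /= (st_vkc sta) (dy_ks dy).
move=> s w t st2 es [P1 P2 P3 P4] ev2 ag2 hl.
set st3 := hset vy w _.
have ws : w \notin s.
  by have := nb_uniq v; rewrite es cat_uniq => /and3P [_ /hasPn h _]; apply: h; rewrite mem_head.
have [hM hd' _] := hl.
have e1 : ht st3 kM (hr st3 vp) (hr st3 vy) = cadj G u w.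
  by rewrite /st3 /= -hM ag2.1 // ag1.1 // eu.
have er3 : hr st3 ve = r by rewrite /st3 /= ag2.1 // ag1.1 // (st_ve sta).
have e2 : ht st3 kK r w = (w \in K) by rewrite /st3 /= ag2.2 // ag1.2 // (st_K sta).
have e3 : ht st3 kS r w = (w \in S) by rewrite /st3 /= ag2.2 // ag1.2 // (dy_S dy).
have e4 : ht st3 kd 0 w = size (nb w) by rewrite /st3 /= hd'.
have ew : hr st3 vy = w by [].
have P' : P s st3 by [].
pose bm t := \max_(x <- t | cadj G u x && (x \in K)) size (nb x).
have eB : bm (rcons s w) = if cadj G u w && (w \in K) then maxn (bm s) (size (nb w)) else bm s.
  by rewrite /bm -cats1 big_cat big_cons big_nil /=; case: ifP => _; rewrite ?maxn0.
rewrite /P -/st3 -/(bm (rcons s w)) eB.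
have eXr : X (rcons s w) = if cadj G u w then w |: X s else X s.
  apply/setP => x; rewrite (fun_if (fun A : {set _} => x \in A)) !inE mem_rcons in_cons.
  by case: eqVneq => [->|_] /=; case uw : (cadj G u w) => //=; rewrite (negbTE ws).
rewrite eXr; move: (st3) P' e1 er3 e2 e3 e4 ew => st4 [Q1 Q2 Q3 Q4] e1 er4 e2 e3 e4 ew.
rewrite /bd run_when -[beval _ _]/(0 < ht st4 kM (hr st4 vp) (hr st4 vy)) e1 gt0b.
case uw : (cadj G u w) => //; rewrite andTb.
rewrite run_if -[beval _ _]/(0 < ht st4 kK (hr st4 ve) (hr st4 vy)) er4 ew e2 gt0b.
have wX : w \in X s = false by rewrite inE (negbTE ws).
case wK : (w \in K).
  have -> : K :|: (w |: X s) = K :|: X s.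
    by apply/setP => x; rewrite !inE; case: eqVneq => [->|]; rewrite ?wK.
  have -> : K :|: (w |: X s) :&: S = K :|: X s :&: S.
    by apply/setP => x; rewrite !inE; case: eqVneq => [->|]; rewrite ?wK.
  have -> : K :|: S :|: (w |: X s) = K :|: S :|: X s.
    by apply/setP => x; rewrite !inE; case: eqVneq => [->|]; rewrite ?wK.
  rewrite run_when -[beval _ _]/(hr st4 vdm < ht st4 kd 0 (hr st4 vy)).
  rewrite ew e4 /bm -Q1; case: ltnP => h //.
  by split=> //=; rewrite ew e4.
rewrite run_seq run_if.
set st5 := run env (vkl ::= _) st4.
rewrite -[beval _ _]/(0 < ht st4 kS (hr st4 ve) (hr st4 vy)) er4 ew e3 gt0b.
have -> : K :|: (w |: X s) = w |: (K :|: X s) by rewrite setUCA.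
have -> : K :|: S :|: (w |: X s) = w |: (K :|: S :|: X s) by rewrite setUCA.
rewrite !cardsU1 !in_setU wK wX.
case wS : (w \in S).
  have -> : K :|: (w |: X s) :&: S = w |: (K :|: X s :&: S).
    by apply/setP => x; rewrite !inE; case: eqVneq => [->|]; rewrite ?wK ?wS ?orbT.
  rewrite cardsU1 !in_setU in_setI wK wX.
  by split; rewrite /= ?Q1 ?Q2 ?Q3 ?Q4.
have -> : K :|: (w |: X s) :&: S = K :|: X s :&: S.
  by apply/setP => x; rewrite !inE; case: eqVneq => [->|]; rewrite ?wS ?andbF.
by split; rewrite /= ?Q1 ?Q2 ?Q3 ?Q4.
Qed.

Lemma run_open S q hd i mx st :
  static st -> dyn S q hd i mx st -> hr st vp = p i -> hr st vc = p i.+1 ->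
  exists q' mx',
    [/\ dyn (S :|: L i) q' hd i.+1 mx' (run env open_clique st),
        take (size q) q' = q, mx <= mx',
        forall w, w \in L i -> w \notin S -> hi w <= mx' &
        forall M, mx <= M -> (forall w, w \in L i -> hi w <= M) -> mx' <= M].
Proof.
move=> sta dy ep ec; rewrite /open_clique run_seq.
set b := BAnd _ _.
have hB S' st' w : agree [:: vj; vy; vtl; vmx; vks] [:: kS; kR] st st' ->
     tset (ht st' kS r) S' -> hr st' vy = w -> beval st' b = (w \notin S') && cadj G (p i) w.
  move=> ag tS ew; have [hM _ _] := st_graph sta.
  rewrite -[beval _ _]/((0 < ht st' kM (hr st' vp) (hr st' vy)) &&
    ~~ (0 < ht st' kS (hr st' ve) (hr st' vy))).
  rewrite (ag.1 vp) // ep (ag.1 ve) // (st_ve sta) ew ag.2 // hM tS !gt0b.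
  by rewrite andbC.
have hc : vc \in [:: vx; vc] by [].
have [q' [mx' [d1 d2 d3 d4 d5]]] := run_adds hc ec sta dy hB.
have eL : [set w in nb (p i.+1) | cadj G (p i) w] = L i.
  by apply/setP => w; rewrite !inE nb_mem andbC.
exists q', mx'; split=> //.
- rewrite -eL; set st1 := run env (nbrs _ _ _ _) st in d1 *.
  by case: d1 => h1 h2 h3 h4 h5 h6 h7 h8 h9; split; rewrite //= h7.
- by move=> w; rewrite -eL inE => /andP [h1 h2]; apply: d4.
- by move=> M h1 h2; apply: d5 => // w w1 w2; apply: h2; rewrite -eL inE w1.
Qed.

Definition keep i x w := ~~ ((x \in K) && (w \in K)) && ~~ ((x \in L i) && (w \in L i)).

Lemma keepE i x w : keep i x w = ~~ within K (L i) x w.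
Proof. by rewrite /keep /within negb_or. Qed.

Lemma run_scan S q hd i mx st x :
  static st -> dyn S q hd i mx st -> hr st vp = p i -> hr st vc = p i.+1 ->
  hd < size q -> x = nth a q hd ->
  exists q' mx',
    [/\ dyn (S :|: [set w in nb x | keep i x w]) q' hd.+1 i mx' (run env scan st),
        take (size q) q' = q, mx <= mx',
        forall w, w \in nb x -> keep i x w -> w \notin S -> hi w <= mx' &
        forall M, mx <= M -> (forall w, w \in nb x -> keep i x w -> hi w <= M) -> mx' <= M].
Proof.
move=> sta dy ep ec hq ex; rewrite /scan 2!run_seq.
set st1 := run env (vhd ::= _) _; set b := BAnd _ _.
have ag1 : agree [:: vx; vhd] [::] st st1.
  have ag z e st0 : z \in [:: vx; vhd] -> agree [:: vx; vhd] [::] st0 (run env (z ::= e) st0).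
    exact: agree_hset.
  by apply: agree_trans (ag _ _ _ _) (ag _ _ _ _).
have sta1 : static st1 by apply: static_agree ag1 sta.
have ex1 : hr st1 vx = x.
  by rewrite /st1 /= (st_ve sta) (dy_hd dy) (tseq_nth a (dy_q dy)) // ex.
have dy1 : dyn S q hd.+1 i mx st1.
  by case: dy => h1 h2 h3 h4 h5 h6 h7 h8 h9; split; rewrite // /st1 /= h6.
have hB S' st' w : agree [:: vj; vy; vtl; vmx; vks] [:: kS; kR] st1 st' ->
     tset (ht st' kS r) S' -> hr st' vy = w -> beval st' b = (w \notin S') && keep i x w.
  move=> ag tS ew; have [hM _ _] := st_graph sta1.
  have K1 z : ht st' kK r (nat_of_ord z) = (z \in K) by rewrite ag.2 // (st_K sta1).
  have M1 (u z : 'I_n) : ht st' kM u z = cadj G u z by rewrite ag.2 // hM.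
  have e1 : hr st' ve = r by rewrite ag.1 // (st_ve sta1).
  have e2 : hr st' vx = x by rewrite ag.1.
  have e3 : hr st' vp = p i by rewrite ag.1 // ag1.1.
  have e4 : hr st' vc = p i.+1 by rewrite ag.1 // ag1.1.
  by rewrite /= e1 e2 e3 e4 ew !K1 !M1 tS !gt0b /keep !inE.
have hc : vx \in [:: vx; vc] by [].
exact: run_adds hc ex1 sta1 dy1 hB.
Qed.

(** [co_sound] says that the vertices before [hd] are completely scanned. [co_target] speaks of all
    targets at once, since the algorithm knows none: [S] has not left [V], and the crossing edge has
    not been passed. *)
Record core S q hd i mx st : Prop := Core {
  co_static : static st;
  co_dyn : dyn S q hd i mx st;
  co_hd : hd <= size q;
  co_sound : forall t y, t < hd -> G (nth a q t) y ->
    y \in S \/ within K (L i) (nth a q t) y;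
  co_start : a \in S;
  co_i : 0 < i;
  co_target : forall V i0, target G K a p k V i0 ->
    [/\ S \subset V, i <= i0, mx <= i0.+1 & forall x, x \in S -> hi x <= mx]
}.

Lemma core_agree vs ks S q hd i mx st st' :
  all (fun z => z \notin vs) [:: ve; vlen; vkc; vtl; vhd; vi; vmx; vks] ->
  all (fun z => z \notin ks) [:: kI; kM; kA; kd; kF; kK; kP; khi; kS; kR] ->
  agree vs ks st st' -> core S q hd i mx st -> core S q hd i mx st'.
Proof.
move=> hv hk ag [h1 h2 h3 h4 h5 h6 h7]; split=> //.
- apply: static_agree ag h1; first by move: hv => /= /and4P [-> -> ->].
  by move: hk => /= /and4P [-> -> -> /and5P [-> -> -> -> /andP [->]]].
- apply: dyn_agree ag h2; first by move: hv => /= /and4P [_ _ _ ->].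
  by move: hk => /= /and4P [_ _ _ /and5P [_ _ _ _ /andP [_ ->]]].
Qed.

Lemma target_hi V i0 y : target G K a p k V i0 -> y \in V -> hi y <= i0.+1.
Proof.
move=> tg yV; rewrite leqNgt; apply/negP => h.
have [hk hy] := hi_adj (leq_trans (ltn0Sn _) h).
by have := tg_high tg yV h hk; rewrite hy.
Qed.

(** Scanned vertices stay scanned: an edge that was exempt for being inside [L i] has its other end
    in the new [S]. So no vertex is scanned twice, however many cliques are tried. *)
Lemma core_open S q hd i mx st :
  core S q hd i mx st -> hr st vp = p i -> hr st vc = p i.+1 ->
  (forall V i0, target G K a p k V i0 -> i < i0) ->
  exists S' q' mx', core S' q' hd i.+1 mx' (run env open_clique st).
Proof.
move=> [sta dy hq snd aS ipos tg] ep ec lt.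
have [q' [mx' [d1 d2 d3 d4 d5]]] := run_open sta dy ep ec.
have sq : size q <= size q' by rewrite -d2 size_take; case: ltnP => // /ltnW.
exists (S :|: L i), q', mx'; split=> //.
- by apply: static_agree (run_agree env open_clique st) sta.
- exact: leq_trans hq sq.
- move=> t y th; have -> : nth a q' t = nth a q t.
    by rewrite -d2 nth_take //; apply: leq_trans th hq.
  move=> g; have [yS|] := snd t y th g; first by left; rewrite inE yS.
  rewrite /within => /orP [h|/andP [_ h]]; first by right; rewrite h.
  by left; rewrite in_setU h orbT.
- by rewrite inE aS.
- move=> V i0 hV; have [SV ii0 mxi hx] := tg V i0 hV; have ilt := lt V i0 hV.
  have LV : L i \subset V by apply: (tg_open hV).
  split=> //; first by rewrite subUset SV.
    by apply: d5 => // w /(subsetP LV); apply: target_hi hV.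
  move=> x; rewrite in_setU; case: (boolP (x \in S)) => xS /=.
    by move=> _; apply: leq_trans (hx x xS) d3.
  by move=> xL; apply: d4.
Qed.

Lemma core_scan S q hd i mx st :
  core S q hd i mx st -> hr st vp = p i -> hr st vc = p i.+1 -> hd < size q -> mx <= i.+1 ->
  exists S' q' mx', core S' q' hd.+1 i mx' (run env scan st).
Proof.
move=> [sta dy hq snd aS ipos tg] ep ec lt mxi.
set x := nth a q hd.
have [q' [mx' [d1 d2 d3 d4 d5]]] := run_scan sta dy ep ec lt (erefl x).
have sq : size q <= size q' by rewrite -d2 size_take; case: ltnP => // /ltnW.
have xS : x \in S by rewrite (dy_mem dy) mem_nth.
exists (S :|: [set w in nb x | keep i x w]), q', mx'; split=> //.
- by apply: static_agree (run_agree env scan st) sta.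
- exact: leq_trans lt sq.
- move=> t y th; have -> : nth a q' t = nth a q t.
    by rewrite -d2 nth_take //; apply: leq_trans th lt.
  move=> g; move: th; rewrite ltnS leq_eqVlt => /orP [/eqP et|th]; last first.
    by have [yS|] := snd t y th g; [left; rewrite inE yS|right].
  rewrite et -/x in g *; case: (boolP (within K (L i) x y)) => [|w]; [by right|left].
  by rewrite in_setU in_set keepE w nb_mem /cadj g !orbT.
- by rewrite inE aS.
- move=> V i0 hV; have [SV ii0 mxi0 hx] := tg V i0 hV.
  (* An edge from [S] that leaves [V] is inside [K] or inside the target clique. In the second case
     [x] is in the closed neighbourhood of [p i0.+1], so [i0.+1 <= hi x <= mx <= i.+1] and [i = i0].
     Either way [keep] rejects the edge. *)
  have addV w : w \in nb x -> keep i x w -> w \in V.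
    rewrite nb_mem keepE => /orP [/eqP<- _|g nw]; first exact: (subsetP SV).
    apply: contraNT nw => wV; have := tg_sealed hV (subsetP SV _ xS) wV g.
    case/orP => [h|h]; first by apply/orP; left.
    have [_ r2] := tg_range hV.
    have e : i = i0.
      apply/eqP; rewrite eqn_leq ii0 /= -ltnS.
      apply: leq_trans (leq_trans (hx x xS) mxi).
      apply: hi_ge => //; by move: h; rewrite inE => /andP [/andP []].
    by apply/orP; right; rewrite e.
  split=> //.
  - rewrite subUset SV; apply/subsetP => w; rewrite in_set => /andP [w1 w2]; exact: addV.
  - by apply: d5 => // w w1 w2; apply: target_hi hV _; apply: addV.
  - move=> y; rewrite in_setU; case: (boolP (y \in S)) => yS /=.
      by move=> _; apply: leq_trans (hx y yS) d3.
    by rewrite in_set => /andP [y1 y2]; apply: d4.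
Qed.

Lemma clique_setU_sub v i : v \in K -> v \in L i -> clique G (L i) -> {subset K :|: L i <= nb v}.
Proof.
move=> vK vL cL x; rewrite in_setU nb_mem /cadj => h.
by case: eqVneq => //= ne; case/orP: h => h; [apply: cliqueK|apply: cL].
Qed.

(** [c] counts steps: each raises [hd + i], initially one, by one, unless the path is used up. *)
Definition invariant c st := found st \/
  (hr st vfd = 0 /\ exists S q hd i mx,
     core S q hd i mx st /\ (k <= i.+1 \/ hd + i = c.+1)).

Lemma run_step c st : invariant c st -> invariant c.+1 (run env step st).
Proof.
case=> [fd|[f0 [S [q [hd [i [mx [co hc]]]]]]]].
  have f1 : hr st vfd = 1 by case: fd => ? [? [? [? [? [[]]]]]].
  rewrite /step run_when -[beval _ _]/((hr st vfd == 0) && ((hr st vi).+1 < hr st vlen)) f1.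
  by left.
have [sta dy hq snd aS ipos tg] := co.
rewrite /step run_when -[beval _ _]/((hr st vfd == 0) && ((hr st vi).+1 < hr st vlen)).
rewrite f0 (dy_i dy) (st_vlen sta) eqxx andTb; case: ltnP => hik; last first.
  by right; split=> //; exists S, q, hd, i, mx; split=> //; left.
case: hc => [|hc]; first by rewrite leqNgt hik.
rewrite 2!run_seq; set st1 := run env (vc ::= _) _.
have ag1 : agree [:: vp; vc] [::] st st1.
  have ag z e st0 : z \in [:: vp; vc] -> agree [:: vp; vc] [::] st0 (run env (z ::= e) st0).
    exact: agree_hset.
  by apply: agree_trans (ag _ _ _ _) (ag _ _ _ _).
have co1 : core S q hd i mx st1 by apply: core_agree ag1 co.
have ep : hr st1 vp = p i by rewrite /st1 /= (st_ve sta) (dy_i dy) (st_P sta) // ltnW // ltnW.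
have ec : hr st1 vc = p i.+1 by rewrite /st1 /= (st_ve sta) (dy_i dy) (st_P sta) // ltnW.
have f1 : hr st1 vfd = 0 by rewrite ag1.1.
move: (st1) co1 ep ec f1 {ag1} => {}st1 co1 ep ec f1.
have [sta1 dy1 _ _ _ _ _] := co1.
have after_open st2 : hr st2 vfd = 0 -> (exists S' q' mx', core S' q' hd i.+1 mx' st2) -> invariant c.+1 st2.
  move=> e [S' [q' [mx' co']]]; right; split=> //.
  by exists S', q', hd, i.+1, mx'; split=> //; right; rewrite addnS hc.
rewrite run_if -[beval _ _]/((hr st1 vi).+1 < hr st1 vmx) (dy_i dy1) (dy_mx dy1).
case: ltnP => himx.
  apply: after_open; first by rewrite (run_agree _ _ _).1.
  apply: core_open co1 ep ec _ => V i0 hV; have [_ _ h _] := tg V i0 hV.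
  exact: leq_trans himx h.
rewrite run_if -[beval _ _]/(hr st1 vhd < hr st1 vtl) (dy_hd dy1) (dy_tl dy1).
case: ltnP => hhd.
  right; split; first by rewrite (run_agree _ _ _).1.
  have [S' [q' [mx' co']]] := core_scan co1 ep ec hhd himx.
  by exists S', q', hd.+1, i, mx'; split=> //; right; rewrite addSn hc.
rewrite run_seq; set st2 := run env count_clique st1.
have [c1 c2 c3 c4] := run_count_clique sta1 dy1 ep ec; rewrite -/st2 in c1 c2 c3 c4.
have ag2 : agree (modv count_clique) (modt count_clique) st1 st2 := run_agree env _ _.
have co2 : core S q hd i mx st2 by apply: core_agree ag2 co1.
have ep2 : hr st2 vp = p i by rewrite ag2.1.
have ec2 : hr st2 vc = p i.+1 by rewrite ag2.1.
have f2 : hr st2 vfd = 0 by rewrite ag2.1.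
have [sta2 dy2 _ _ _ _ _] := co2.
(* The queue is exhausted, so every vertex of [S] has been scanned. *)
have sealedS : sealed G K (L i) S.
  move=> x y xS yS g; have xq : x \in q by rewrite -(dy_mem dy).
  have := snd (index x q) y; rewrite nth_index // g.
  have lt : index x q < hd by apply: leq_trans hhd; rewrite index_mem.
  by case/(_ lt isT) => [h|//]; rewrite h in yS.
rewrite run_if; set tb := beval _ _.
have etb : tb = [&& G (p i) (p i.+1) && cliqueb G (L i),
    \max_(x <- nb (p i.+1) | cadj G (p i) x && (x \in K)) size (nb x) <= #|K :|: L i|,
    #|K :|: L i :&: S| < #|K :|: S| & #|K :|: S :|: L i| < n].
  rewrite /tb -[beval _ _]/[&& 0 < ht st2 kF (hr st2 vp) (hr st2 vc),
     ~~ (hr st2 vkl < hr st2 vdm), hr st2 vsl < hr st2 vks & hr st2 vt2 < ht st2 kI 0 0].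
  by rewrite ep2 ec2 (st_F sta2) gt0b c1 c2 c3 c4 (dy_ks dy2) (st_n sta2) -leqNgt.
(* A vertex of the cliques [K] and [L i] has [K :|: L i] in its closed neighbourhood, so it has no
   further neighbour iff its closed degree does not exceed the size of that union. *)
have hubP : clique G (L i) -> reflect (hub G K (L i))
    (\max_(x <- nb (p i.+1) | cadj G (p i) x && (x \in K)) size (nb x) <= #|K :|: L i|).
  move=> cL; apply: (iffP (bigmax_leqP_seq _ _ _ _)) => [h v y vK vL g|h v].
    have := h v; rewrite nb_mem; have := vL; rewrite inE => /andP [-> ->] /(_ isT vK) hv.
    rewrite -in_setU; have /subset_cardP : #|K :|: L i| = #|nb v|.
      apply/eqP; rewrite eqn_leq (card_uniqP (nb_uniq v)) hv andbT -(card_uniqP (nb_uniq v)).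
      by apply: subset_leq_card; apply/subsetP; apply: clique_setU_sub.
    have s : K :|: L i \subset nb v by apply/subsetP; apply: clique_setU_sub.
    by move=> /(_ s) ->; rewrite nb_mem /cadj g orbT.
  rewrite nb_mem => v1 /andP [v2 vK]; have vL : v \in L i by rewrite inE v1 v2.
  rewrite -(card_uniqP (nb_uniq v)); apply: subset_leq_card; apply/subsetP => y.
  by rewrite nb_mem in_setU => /orP [/eqP<-|/(h v y vK vL) //]; rewrite vK.
have inP : reflect (exists2 c, c \in S & c \notin K :|: L i) (#|K :|: L i :&: S| < #|K :|: S|).
  apply: (iffP idP) => [lt|[z zS zn]].
    have /subsetPn [z zS zn] : ~~ (S \subset K :|: L i).
      apply: contraTN lt => /subsetP s; rewrite -leqNgt; apply: subset_leq_card.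
      apply/subsetP => z; rewrite !in_setU in_setI; case zK : (z \in K) => //= zS.
      by have := s z zS; rewrite in_setU zK zS /= => ->.
    by exists z.
  apply: proper_card; apply/properP; split.
    by apply: setUS; apply: subsetIr.
  exists z; first by rewrite in_setU zS orbT.
  by move: zn; rewrite !in_setU in_setI => /norP [/negbTE-> /negbTE->].
have outP : reflect (exists2 d, d \notin S & d \notin K :|: L i) (#|K :|: S :|: L i| < n).
  apply: (iffP idP) => [lt|[z zS zn]].
    have /subsetPn [z _ zn] : ~~ ([set: 'I_n] \subset K :|: S :|: L i).
      by apply: contraTN lt => /subset_leq_card; rewrite cardsT card_ord -leqNgt.
    move: zn; rewrite !in_setU => /norP [/norP [z1 z2] z3].
    by exists z; rewrite // in_setU negb_or z1.
  rewrite -[X in _ < X]card_ord -cardsT; apply: proper_card; rewrite properT.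
  apply: contraNneq zS => e; have := in_setT z; rewrite -e !in_setU.
  by move: zn; rewrite in_setU => /norP [/negbTE-> /negbTE->]; rewrite orbF.
case: ifP => test.
  move: test; rewrite etb => /and4P [/andP [g /cliqueP cL] /(hubP cL) hb /inP hin /outP hout].
  left; exists r, K, S, (p i), (p i.+1); split.
  - by split=> //=; rewrite (st_ve sta2).
  - exact: (st_K sta2).
  - exact: (dy_S dy2).
  - by split.
apply: after_open; first by rewrite (run_agree _ _ _).1.
apply: core_open co2 ep2 ec2 _ => V i0 hV; have [SV ii0 _ _] := tg V i0 hV.
(* If [i] were the index of a target, every part of the test would hold. So a failed test gives
   [i < i0], and [L i] may be added without leaving [V]. *)
rewrite ltn_neqAle ii0 andbT; apply: contraFneq test => e; rewrite -e in hV.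
rewrite etb (tg_edge hV) /=; have cL := tg_clique hV.
apply/and4P; split; [exact/cliqueP|apply/(hubP cL); exact: (tg_hub hV)| |].
  by apply/inP; apply: (tg_in hV).
by apply/outP; have [d dV dL] := tg_out hV; exists d => //; apply: contra dV; apply: (subsetP SV).
Qed.

Lemma invariant_hset c st j : invariant c st -> invariant c (hset vh j st).
Proof.
case=> [fd|[f0 [S [q [hd [i [mx [co hc]]]]]]]]; first by left.
right; split=> //; exists S, q, hd, i, mx; split=> //.
by apply: core_agree (agree_hset [::] _ _ (mem_head vh [::])) co.
Qed.

Lemma run_sweep st :
  static st -> hr st vu = a -> hr st vfd = 0 -> (forall c, ht st kS r c = 0) ->
  a != p 1 -> 2 < k -> k < n ->
  let st' := run env sweep st in
  found st' \/ (hr st' vfd = 0 /\ forall V i0, ~ target G K a p k V i0).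
Proof.
move=> sta ea f0 zS ap k2 kn st'; rewrite {}/st' /sweep.
set lp := HFor Bn vh step.
rewrite 6!run_seq; set st0 := run env (vy ::= $vu) _.
have ag0 : agree [:: vtl; vhd; vi; vmx; vks; vy] [::] st st0.
  have ag z e st1 : z \in [:: vtl; vhd; vi; vmx; vks; vy] ->
     agree [:: vtl; vhd; vi; vmx; vks; vy] [::] st1 (run env (z ::= e) st1).
    exact: agree_hset.
  by do 5![apply: agree_trans; last exact: ag]; apply: ag.
have sta0 : static st0 by apply: static_agree ag0 sta.
have dy0 : dyn set0 [::] 0 1 0 st0.
  split=> //; first by move=> x; rewrite inE ag0.2.
  - by move=> x; rewrite inE.
  - by rewrite setU0 /st0 /= (st_vkc sta).
have ey0 : hr st0 vy = a by [].
have := run_add_y sta0 dy0 ey0; rewrite inE => /(_ isT) dy1.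
rewrite 3!run_seq; set st1 := run env add_y st0 in dy1 *.
have sta1 : static st1 by apply: static_agree (run_agree env add_y st0) sta0.
set st2 := run env (vy ::= _) st1.
have ag2 : agree [:: vy] [::] st1 st2 by apply: agree_hset; rewrite mem_head.
have sta2 : static st2 by apply: static_agree ag2 sta1.
have dy2 : dyn (a |: set0) (rcons [::] a) 0 1 (maxn 0 (hi a)) st2.
  exact: dyn_agree ag2 dy1.
have ey2 : hr st2 vy = p 1.
  by rewrite /st2 /= (st_ve sta1) (st_P sta1) //; apply: ltn_trans k2.
have := run_add_y sta2 dy2 ey2; rewrite setU0 inE eq_sym => /(_ ap) dy3.
set st3 := run env add_y st2 in dy3 *.
have sta3 : static st3 by apply: static_agree (run_agree env add_y st2) sta2.
have ag3 := run_agree env add_y st2; rewrite -/st3 in ag3.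
have f3 : hr st3 vfd = 0.
  by rewrite ag3.1 // ag2.1 // (run_agree env add_y st0).1 // ag0.1.
have inv3 : invariant 0 st3.
  right; split=> //.
  exists (p 1 |: (a |: set0)), (rcons (rcons [::] a) (p 1)), 0, 1, (maxn (maxn 0 (hi a)) (hi (p 1))).
  split; last by right.
  split=> //; first by rewrite setU0.
    by rewrite !inE eqxx orbT.
  move=> V i0 hV; have [aV pV] := tg_start hV; have [r1 r2] := tg_range hV.
  have h0 := target_hi hV aV; have h1 := target_hi hV pV.
  split=> //.
  - by apply/subsetP => x; rewrite !inE orbF => /orP [] /eqP->.
  - by rewrite max0n geq_max h0.
  - by move=> x; rewrite !inE orbF => /orP [] /eqP->; rewrite !leq_max leqnn ?orbT.
have inv4 : invariant (env Bn) (run env lp st3).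
  apply: (run_for (P := invariant)) => // i st' _ _ h.
  by apply: run_step; apply: invariant_hset.
have inv5 : invariant (n + env Bn) (run env lp (run env lp st3)).
  apply: (run_for (P := fun c => invariant (n + c))).
    by rewrite addn0 -[n in invariant n]envn.
  by move=> i st' _ _ h; rewrite addnS; apply: run_step; apply: invariant_hset.
(* After [2n] steps, a target is impossible: [i <= i0] and [i0.+1 < k] exclude [k <= i.+1], and
   [hd <= n] with [i < n] excludes that [hd + i] is [2n + 1]. *)
case: inv5 => [|[f5 [S [q [hd [i [mx [co hc]]]]]]]]; [by left|right].
split=> // V i0 hV; have [_ ii0 _ _] := co_target co hV.
have [_ r2] := tg_range hV; have hdq := co_hd co.
have qn : size q <= n.
  by rewrite -(card_uniqP (dy_uniq (co_dyn co))) (leq_trans (max_card _)) ?card_ord.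
by rewrite envn in hc; case: hc => hc; nat_lia.
Qed.

End Sweep.

(** * Correctness of the algorithm *)

Section Main.
Variables (n : nat) (G : sgraph 'I_n) (nb : 'I_n -> seq 'I_n) (env : bound -> nat).
Hypothesis nb_uniq : forall x, uniq (nb x).
Hypothesis nb_mem : forall x y, (y \in nb x) = cadj G x y.
Hypothesis nb_bound : forall x, size (nb x) <= env BD.
Hypothesis envn : env Bn = n.
Implicit Types (x y v w : 'I_n) (S : {set 'I_n}) (q s : seq 'I_n).

Local Notation has_graph := (has_lists (cadj G) nb).

Definition has_flags st := forall x y, ht st kF x y = G x y && cliqueb G (common G x y).

(** Each way to fail refutes [good]: an unsuccessful search by [good_connect], a path with at most
    two edges and an unsuccessful sweep by [good_target]. *)
Lemma run_try_edge st r (a b : 'I_n) :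
  has_graph st -> has_flags st -> ht st kI 0 0 = n ->
  hr st ve = r -> hr st vu = a -> hr st vv = b -> hr st vfd = 0 ->
  G a b -> cliqueb G (common G a b) -> (forall k c, 4 < k -> ht st k r c = 0) ->
  let st' := run env try_edge st in
  found G st' \/ (hr st' vfd = 0 /\ ~ good G a b).
Proof.
move=> hl hF hn er ea eb f0 gab /cliqueP cK z st'; rewrite {}/st'.
set K := common G a b in cK.
have ab : a != b by apply: contraTneq gab => ->; rewrite (adj_irr G).
have aK : a \in K by rewrite inE cadj_refl /cadj adj_sym gab orbT.
have bK : b \in K by rewrite inE cadj_refl /cadj gab orbT.
rewrite /try_edge 2!run_seq.
have [K1 K2] := run_mark_K nb_uniq nb_mem nb_bound er ea eb hl (fun c => z kK c isT).
have ag1 := run_agree env mark_K st.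
set st1 := run env mark_K st in K1 K2 ag1 *.
have er1 : hr st1 ve = r by rewrite ag1.1.
have ea1 : hr st1 vu = a by rewrite ag1.1.
have eb1 : hr st1 vv = b by rewrite ag1.1.
have hl1 : has_graph st1 by apply: has_lists_agree ag1 hl.
have z1 k c : k \in [:: kV; kQ; kpr] -> ht st1 k r c = 0.
  by rewrite !inE => /or3P [] /eqP ->; rewrite ag1.2 // z.
have [q I] := run_search nb_mem nb_bound envn er1 ea1 eb1 hl1 K1 z1.
have ag2 := run_agree env search st1.
set st2 := run env search st1 in I ag2 *.
have f2 : hr st2 vfd = 0 by rewrite ag2.1 // ag1.1.
have er2 : hr st2 ve = r by rewrite ag2.1.
have ea2 : hr st2 vu = a by rewrite ag2.1.
have hl2 : has_graph st2 by apply: has_lists_agree ag2 hl1.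
have [f1 f0'] := sv_first I.
have sqn : size q <= n.
  by rewrite -(card_uniqP (sv_uniq I)) (leq_trans (max_card _)) ?card_ord.
rewrite run_when -[beval _ _]/(0 < hr st2 via) (sv_a I).
case: (boolP (a \in q)) => aq; last first.
  right; split=> // /good_connect; rewrite -/K => cn; case/negP: aq.
  have step x y : x \in q -> gsearch G K a x y -> y \in q.
    move=> xq g; have lt : index x q < size q by rewrite index_mem.
    have := sv_done I (or_introl (leq_trans lt sqn)) lt; rewrite nth_index //.
    by case/(_ y g) => t [t1 <- _]; apply: mem_nth.
  have bq : b \in q by rewrite -f0' mem_nth.
  have reach s : forall x, x \in q -> path (gsearch G K a) x s -> last x s \in q.
    by elim: s => [//|y s IH] x xq /= /andP [g]; apply: IH (step _ _ xq g).
  by case/connectP: cn => s ps ->; apply: reach.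
have i0 : 0 < index a q.
  rewrite lt0n; apply: contraNneq ab => e.
  by rewrite -f0' -e nth_index.
rewrite i0 run_seq.
have zhi c : ht st2 khi r c = 0 by rewrite ag2.2 // ag1.2 // z.
have [p [k [e1 e2 ip h1 h2]]] := run_trace nb_mem nb_bound envn I aq ab er2 ea2 hl2 zhi.
have ag3 := run_agree env trace st2.
set st3 := run env trace st2 in e1 e2 h1 h2 ag3 *.
have f3 : hr st3 vfd = 0 by rewrite ag3.1.
rewrite run_when -[beval _ _]/(2 < hr st3 vlen) e1.
have k2P : ~~ (2 < k) -> ~ good G a b.
  rewrite -leqNgt => hk gd; have [V [i1 hV]] := good_target gd ip.
  by have [r1 r2] := tg_range hV; nat_lia.
case: ifP => hk; last by right; split=> //; apply: k2P; rewrite hk.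
have kn : k < n.
  have u : uniq (map p (iota 0 k.+1)).
    rewrite map_inj_in_uniq ?iota_uniq // => i j; rewrite !mem_iota !add0n !ltnS => hi hj.
    exact: (ip_inj ip).
  have := max_card (mem (map p (iota 0 k.+1))).
  by rewrite (card_uniqP u) size_map size_iota card_ord.
have ap : a != p 1.
  rewrite -(ip_first ip); apply/negP => /eqP e.
  by have : 0 = 1 by apply: (ip_inj ip) e => //; apply: ltnW; apply: ltnW.
have sta : static G nb r K p k (fun x => ht st3 khi r x) st3.
  split=> //.
  - by apply: has_lists_agree ag3 hl2.
  - by rewrite ag3.1.
  - by rewrite ag3.1 // ag2.1.
  - by move=> x; rewrite ag3.2 // ag2.2 // K1.
  - by move=> x y; rewrite ag3.2 // ag2.2 // ag1.2 // hF.
  - by rewrite ag3.2 // ag2.2 // ag1.2.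
have ea3 : hr st3 vu = a by rewrite ag3.1.
have zS c : ht st3 kS r c = 0 by rewrite ag3.2 // ag2.2 // ag1.2 // z.
have hadj x : 0 < ht st3 khi r x -> ht st3 khi r x < k /\ cadj G (p (ht st3 khi r x)) x by apply: h2.
have hge j x : 0 < j -> j < k -> cadj G (p j) x -> j <= ht st3 khi r x by apply: h1.
have [fd|[f4 nt]] := run_sweep nb_uniq nb_mem nb_bound envn cK hge hadj sta ea3 f3 zS ap hk kn.
  by left.
right; split=> // gd; have [V [i1 hV]] := good_target gd ip.
exact: nt hV.
Qed.

Variables (es : seq ('I_n * 'I_n)).
Hypothesis esG : edge_list G es.
Hypothesis envm : env Bm = size es.

Lemma found_agree st st' :
  agree [:: ve; vu; vv; vq] [::] st st' -> found G st -> found G st'.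
Proof.
move=> ag [r [K [S [u [w [[h1 h2 h3 h4] tK tS h]]]]]].
exists r, K, S, u, w; split=> //.
- by rewrite !ag.1.
- by move=> x; rewrite ag.2.
- by move=> x; rewrite ag.2.
Qed.

Lemma run_try_edges st :
  has_input es st -> has_graph st -> has_flags st ->
  (forall k u c, 4 < k -> ht st k u c = 0) ->
  let st' := run env try_edges st in
  found G st' \/ (hr st' vfd = 0 /\ forall a b, (a, b) \in es -> ~ good G a b).
Proof.
move=> hI hl hF z st'; rewrite {}/st' /try_edges 2!run_seq.
set st0 := run env (vfd ::= _) _; set bd := _ ;; _.
(* The rows from [i] on are still zero when edge [i] is reached, so no table is ever cleared. *)
pose P i st' := [/\ hr st' vq = i.*2.+2, [/\ has_input es st', has_graph st' & has_flags st'],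
   forall k u c, 4 < k -> i <= u -> ht st' k u c = 0 &
   found G st' \/ (hr st' vfd = 0 /\
     forall a b, (a, b) \in take i es -> ~ good G a b)].
suff : P (env Bm) (run env (HFor Bm ve bd) st0).
  by case=> _ _ _ []; [left|rewrite envm take_size; right].
apply: (run_for (P := P)).
  split=> //; first by move=> k u c k4 _; apply: z.
  by right; split=> // a b; rewrite take0.
move=> i st' hi _ [hq [hI' hl' hF'] z' hfd]; rewrite envm in hi.
have x0 : 'I_n * 'I_n by case: (es) hi.
have e1 := run_read_edge env (st := hset ve i st') x0 hi hI' hq.
have hI00 : input_cells es 0 = n by [].
rewrite /bd run_seq e1; set a := (nth x0 es i).1; set b := (nth x0 es i).2.
have abes : (a, b) \in es by rewrite /a /b -surjective_pairing mem_nth.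
have gab : G a b by have [_ h _] := esG; apply: h.
set st1 := hset vq _ _.
have ag1 : agree [:: ve; vu; vv; vq] [::] st' st1.
  by do 3![apply: agree_trans; last exact: agree_hset]; apply: agree_hset.
set c := When _ Do _.
have agc := run_agree env c st1.
have q' : hr (run env c st1) vq = i.+1.*2.+2 by rewrite agc.1.
have hP : [/\ has_input es (run env c st1), has_graph (run env c st1) & has_flags (run env c st1)].
  split.
  - by move=> d; rewrite agc.2 //; apply: hI'.
  - by apply: has_lists_agree agc _.
  - by move=> x y; rewrite agc.2 //; apply: hF'.
have zc k u d : 4 < k -> i.+1 <= u -> ht (run env c st1) k u d = 0.
  move=> k4 iu; rewrite (run_row env (v := ve)) //; first by apply: z' => //; apply: ltnW.
  by rewrite (_ : hr st1 ve = i) // neq_ltn iu orbT.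
split=> //; clear q' hP zc agc.
rewrite /c run_when -[beval _ _]/((hr st1 vfd == 0) && (0 < ht st1 kF a b)).
rewrite (hF' a b : ht st1 kF a b = _) gab andTb gt0b ag1.1 //.
have tk : take i.+1 es = rcons (take i es) (a, b).
  by rewrite (take_nth x0) // /a /b -surjective_pairing.
case: hfd => [fd|[f0 ng]].
  have f1 : hr st' vfd = 1 by case: fd => ? [? [? [? [? [[]]]]]].
  by rewrite f1 andFb; left; apply: found_agree ag1 fd.
rewrite f0 eqxx andTb.
have ng' : ~ good G a b -> forall x y, (x, y) \in take i.+1 es -> ~ good G x y.
  move=> nab x y; rewrite tk mem_rcons in_cons => /orP [/eqP [-> ->] //|]; exact: ng.
case: ifP => cb; last first.
  right; split; first by rewrite ag1.1.
  by apply: ng' => /good_edge [_ /cliqueP]; rewrite cb.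
have z1 k d : 4 < k -> ht st1 k i d = 0 by move=> k4; apply: z'.
have hl1 : has_graph st1 by case: hl'.
have [fd|[f1 nab]] := run_try_edge hl1 hF' (etrans (hI' 0) hI00 : ht st1 kI 0 0 = n)
  (erefl : hr st1 ve = i) (erefl : hr st1 vu = a) (erefl : hr st1 vv = b)
  (f0 : hr st1 vfd = 0) gab cb z1.
  by left.
by right; split=> //; apply: ng'.
Qed.

(** Here and in [correct_cells], the output specification is restated for row 0 of table 0 instead
    of a machine state. *)
Definition part_of (f : nat -> nat) l : {set 'I_n} := [set v : 'I_n | f v.+1 == l].

Definition correct_cells (f : nat -> nat) : Prop :=
  (f 0 = 1 /\ generalized_two_join G (part_of f 0)
    (part_of f 1 :|: part_of f 2 :|: part_of f 3) (part_of f 4 :|: part_of f 5 :|: part_of f 6)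
    (part_of f 1) (part_of f 2) (part_of f 4) (part_of f 5)) \/
  (f 0 = 0 /\ ~ admits_generalized_two_join G).

Lemma run_output st :
  connected G -> ~ admits_one_join G -> has_graph st ->
  found G st \/ (hr st vfd = 0 /\ ~ admits_generalized_two_join G) ->
  correct_cells (ht (run env output st) kI 0).
Proof.
move=> cG n1 hl; rewrite /output run_seq.
set st1 := run env (kI~[_; _] ::= _) st.
case=> [fd|[f0 nj]]; last first.
  have f1 : hr st1 vfd = 0 by [].
  by rewrite run_when -[beval _ _]/(0 < hr st1 vfd) f1; right; split; rewrite // /st1 /= f0.
have [r [K [S [u [w [[h1 h2 h3 h4] tK tS [cK cL hb sS [[c cS cKL] [d dS dKL]]]]]]]]] := fd.
have f1 : hr st1 vfd = 1 by [].
rewrite run_when -[beval _ _]/(0 < hr st1 vfd) f1.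
set L := common G u w in cL hb sS cKL dKL.
pose lab x := if x \in K then (if x \in L then 0 else if x \in S then 1 else 4)
  else if x \in L then (if x \in S then 2 else 5) else if x \in S then 3 else 6.
pose P i st' := ht st' kI 0 0 = 1 /\ forall x, x < i -> ht st' kI 0 x.+1 = lab x.
set bd := label ;; _.
have [P0 P1] : P (env Bn) (run env (HFor Bn vx bd) st1).
  apply: (run_for (P := P)); first by split; rewrite // /st1 /= h1.
  move=> i st' hi ag [P0 P1]; rewrite envn in hi.
  set st2 := hset vx i st'.
  have ag2 := run_agree env label st2.
  have e : hr (run env label st2) vz = lab (Ordinal hi).
    have [hM _ _] := hl.
    have M1 (x y : 'I_n) : ht st' kM x y = cadj G x y by rewrite ag.2 //= hM.
    have e1 : hr st' vfr = r by rewrite ag.1.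
    have e2 : hr st' vp = u by rewrite ag.1.
    have e3 : hr st' vc = w by rewrite ag.1.
    have K1 (x : 'I_n) : ht st' kK r x = (x \in K) by rewrite ag.2 //= tK.
    have S1 (x : 'I_n) : ht st' kS r x = (x \in S) by rewrite ag.2 //= tS.
    have L1 : beval st2 (in_clique vx) = (Ordinal hi \in L).
      by rewrite /= e2 e3 -[i]/(val (Ordinal hi)) !M1 !gt0b inE.
    have K2 : beval st2 (BNz kK@[$vfr; $vx]) = (Ordinal hi \in K).
      by rewrite /= e1 -[i]/(val (Ordinal hi)) K1 gt0b.
    have S2 : beval st2 (BNz kS@[$vfr; $vx]) = (Ordinal hi \in S).
      by rewrite /= e1 -[i]/(val (Ordinal hi)) S1 gt0b.
    rewrite /label /lab !run_if L1 K2 S2.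
    by case: (_ \in K); case: (_ \in L); case: (_ \in S).
  rewrite /bd run_seq; set st3 := run env label st2 in ag2 e *.
  have ex : hr st3 vx = i by rewrite ag2.1.
  split; first by rewrite /= ag2.2.
  move=> x; rewrite /= ex e eqSS ltnS leq_eqVlt => /orP [/eqP ei|lt].
    by rewrite ei eqxx /=; congr lab; apply: val_inj; rewrite /= ei.
  by rewrite ltn_eqF //= ag2.2 // P1.
rewrite envn in P1.
set f := ht _ kI 0; left; split=> //.
have fl x : f x.+1 = lab x by rewrite /f P1.
have ptE l : part_of f l = [set x | lab x == l] by apply/setP => x; rewrite !inE fl.
have J := sealed_join cG n1 cK cL hb sS cS cKL dS dKL.
have -> : part_of f 0 = K :&: L.
  by apply/setP => x; rewrite ptE [LHS]in_set /lab !(in_setI, in_setD, in_setU, in_setC); case: (x \in K); case: (x \in L); case: (x \in S).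
have -> : part_of f 1 = (K :\: L) :&: S.
  by apply/setP => x; rewrite ptE [LHS]in_set /lab !(in_setI, in_setD, in_setU, in_setC); case: (x \in K); case: (x \in L); case: (x \in S).
have -> : part_of f 2 = (L :\: K) :&: S.
  by apply/setP => x; rewrite ptE [LHS]in_set /lab !(in_setI, in_setD, in_setU, in_setC); case: (x \in K); case: (x \in L); case: (x \in S).
have -> : part_of f 3 = S :\: (K :|: L).
  by apply/setP => x; rewrite ptE [LHS]in_set /lab !(in_setI, in_setD, in_setU, in_setC); case: (x \in K); case: (x \in L); case: (x \in S).
have -> : part_of f 4 = (K :\: L) :\: S.
  by apply/setP => x; rewrite ptE [LHS]in_set /lab !(in_setI, in_setD, in_setU, in_setC); case: (x \in K); case: (x \in L); case: (x \in S).
have -> : part_of f 5 = (L :\: K) :\: S.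
  by apply/setP => x; rewrite ptE [LHS]in_set /lab !(in_setI, in_setD, in_setU, in_setC); case: (x \in K); case: (x \in L); case: (x \in S).
have -> : part_of f 6 = ~: S :\: (K :|: L).
  by apply/setP => x; rewrite ptE [LHS]in_set /lab !(in_setI, in_setD, in_setU, in_setC); case: (x \in K); case: (x \in L); case: (x \in S).
exact: J.
Qed.

Lemma run_phase2 st :
  connected G -> ~ admits_one_join G -> has_input es st -> has_graph st ->
  (forall k u c, 3 < k -> ht st k u c = 0) ->
  correct_cells (ht (run env phase2 st) kI 0).
Proof.
move=> cG n1 hI hl z; rewrite /phase2 2!run_seq.
have hF := run_flags nb_mem nb_bound esG envm hI hl (fun u c => z kF u c isT).
have ag1 := run_agree env flags st.
set st1 := run env flags st in hF ag1 *.
have hI1 : has_input es st1 by move=> c; rewrite ag1.2.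
have hl1 : has_graph st1 by apply: has_lists_agree ag1 hl.
have s1 : {subset modt flags <= [:: kF]} by apply/allP.
have z1 k u c : 4 < k -> ht st1 k u c = 0.
  move=> k4; rewrite ag1.2; first by apply: z; apply: ltnW.
  by apply/negP => /s1; rewrite inE => /eqP e; rewrite e in k4.
have h := run_try_edges hI1 hl1 hF z1.
have ag2 := run_agree env try_edges st1.
apply: run_output => //; first by apply: has_lists_agree ag2 hl1.
case: h => [|[f0 ng]]; [by left|right; split=> // /good_exists [//|//|a [b gd]]].
have [gab _] := good_edge gd; have [_ _ h2] := esG.
have := h2 _ _ gab; case ab : ((a, b) \in es); first by case: (ng _ _ ab gd).
(* [es] has each edge in one orientation only; [good_sym] covers the other. *)
by case ba : ((b, a) \in es) => // _; apply: (ng _ _ ba (good_sym gd)).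
Qed.

End Main.

(** * The machine program *)

Fixpoint power_code (q : nat) : cmd :=
  if q is q'.+1 then Seq (power_code q') (Op Mul (treg 3) (treg 3) (treg 5))
  else Const (treg 3) 1.

Definition prelude (q : nat) : cmd :=
  Seq (Fetch (treg 0) (treg 4))
  (Seq (Const (treg 4) 1)
  (Seq (Fetch (treg 1) (treg 4))
  (Seq (Op Add (treg 5) (treg 0) (treg 1))
  (Seq (Const (treg 4) 2)
  (Seq (Op Add (treg 5) (treg 5) (treg 4))
       (power_code q)))))).

Definition program (q : nat) : cmd :=
  Seq (prelude q)
  (Seq (compile phase1 4)
  (Seq (Const (treg 4) 0)
  (Seq (Op Add (treg 2) (vreg vD) (treg 4))
       (compile phase2 4)))).

Definition env_of (n m d : nat) (bd : bound) : nat :=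
  match bd with Bn => n | Bm => m | BD => d end.

(** The hypotheses cover all monomials of the two costs, so any constant no less than the sum of the
    coefficients works. [BD] counts as zero in the first phase, which has no loop over it. *)
Lemma cost_bound : exists A, forall n m d M,
  0 < M -> n <= M -> m <= M -> n * d <= M -> m * d <= M -> m * n <= M ->
  m * n * d <= M -> m * d * d <= M ->
  hcost (env_of n m 0) phase1 + hcost (env_of n m d) phase2 <= A * M.
Proof.
exists 4000 => n m d M.
rewrite /phase1 /phase2 /= => *.
lia.
Qed.

Lemma edge_list_nil n (G : sgraph 'I_n) : connected G -> edge_list G [::] -> n <= 1.
Proof.
move=> cG [_ _ h]; rewrite leqNgt; apply/negP => n1.
have /connectP [[|y s]] := cG (Ordinal (ltnW n1)) (Ordinal n1).
  by move=> _ /(congr1 val).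
by move=> /= /andP [/h].
Qed.

Lemma max_degree_lt n (G : sgraph 'I_n) : 0 < n -> max_degree G < n.
Proof.
case: n G => // n G _; rewrite ltnS; apply/bigmax_leqP => x _.
rewrite -ltnS -[X in _ < X]card_ord -[#|'I_n.+1|]cardsT; apply: proper_card.
rewrite properT; apply/negP => /eqP e.
by have := in_setT x; rewrite -e inE (adj_irr G).
Qed.

Lemma max_degree_gt0 n (G : sgraph 'I_n) x y : G x y -> 0 < max_degree G.
Proof.
move=> g; apply: leq_trans (leq_bigmax x).
by rewrite card_gt0; apply/set0Pn; exists y; rewrite inE.
Qed.

(** [d] is the greatest length of a list. If there is an edge, then [d <= D.+1 <= 2 * D] and
    [d <= n], whence the factor two; a connected graph without edges has [n <= 1], and the summand
    one suffices. *)
Lemma monomials_le n m D d :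
  (0 < m -> 0 < D /\ D < n) -> (m = 0 -> n <= 1 /\ D = 0) -> d <= (0 < n) * D.+1 ->
  let M := 2 * (1 + n * m * D) in
  [/\ n <= M, m <= M, n * d <= M & m * d <= M] /\
  [/\ m * n <= M, m * n * d <= M & m * d * d <= M].
Proof.
case: m => [_ /(_ erefl) [n1 ->] hd|m /(_ isT) [D0 Dn] _ hd M].
  by case: n n1 hd => [|[|]] //= _ hd; rewrite !muln0 !mul0n; repeat split; lia.
have d2 : d <= 2 * D by apply: leq_trans hd _; case: (0 < n); lia.
have dn : d <= n by apply: leq_trans hd _; case: (0 < n); lia.
have nm1 : n <= n * m.+1 by rewrite leq_pmulr.
have nm2 : m.+1 <= n * m.+1 by rewrite leq_pmull //; lia.
have e : n * m.+1 <= n * m.+1 * D by rewrite leq_pmulr.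
have h1 : n * m.+1 * d <= n * m.+1 * (2 * D) by rewrite leq_mul2l d2 orbT.
have h2 : m.+1 * d * d <= m.+1 * n * (2 * D) by rewrite !leq_mul.
have h3 : n * d <= n * m.+1 * d by rewrite leq_mul2r nm1 orbT.
have h4 : m.+1 * d <= n * m.+1 * d by rewrite leq_mul2r nm2 orbT.
by rewrite /M; split; split; nat_lia.
Qed.

(** * Memory layout and assembly of the machine program *)

Section Assembly.
Variables (n : nat) (G : sgraph 'I_n) (es : seq ('I_n * 'I_n)).
Hypothesis esG : edge_list G es.

Let Z := n + size es + 2.

Lemma input_size : size [:: n, size es & flatten [seq [:: val p.1; val p.2] | p <- es]] = (size es).*2.+2.
Proof. by rewrite /=; elim: es => //= p s ->. Qed.

Lemma input_le c : input_cells es c <= n + size es.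
Proof.
pose l := [:: n, size es & flatten [seq [:: val p.1; val p.2] | p <- es]].
rewrite -[input_cells es c]/(nth 0 l c).
have [lt|ge] := ltnP c (size l); last by rewrite nth_default.
have := mem_nth 0 lt; rewrite [in X in X -> _]inE in_cons.
case/or3P => [/eqP->|/eqP->|]; rewrite ?leq_addr ?leq_addl //.
case/flattenP => s /mapP [p _ ->]; rewrite !inE => /orP [] /eqP->;
  by apply: leq_trans (ltnW (ltn_ord _)) (leq_addr _ _).
Qed.

Lemma bounded_hinit : bounded (n + size es) (hinit es).
Proof. by split=> // k u c /=; case: ifP => // _; apply: input_le. Qed.

Variables (q : nat).
Hypothesis q_gt1 : 1 < q.
Let N := Z ^ q.
Let W := Z ^ (3 * q).

Lemma W_cube : N * N * N <= W.
Proof. by rewrite /W [3 * q]mulnC expnM -/N !expnS expn0 muln1 mulnA. Qed.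

Lemma Z_ge2 : 1 < Z. Proof. by rewrite /Z addn2. Qed.

Lemma Z2_le : Z * Z <= N.
Proof. by rewrite /N mulnn leq_exp2l // Z_ge2. Qed.

Lemma power_code_ok s j : reg s (treg 5) = Z -> j <= q ->
  code W (power_code j) s (j + 1)
    (fun s' => reg s' (treg 3) = Z ^ j /\ Defs.mem s' = Defs.mem s /\
      forall x, x != treg 3 -> reg s' x = reg s x).
Proof.
have WZ i : i <= q -> Z ^ i < W.
  by move=> h; rewrite /W ltn_exp2l ?Z_ge2 //; lia.
move=> e5; elim: j => [|j IH] hj /=.
  apply: code_const; first exact: (WZ 0).
  split; rewrite /= ?upd_same //; split=> // x hx; by rewrite /upd (negbTE hx).
apply: (code_seq (IH (ltnW hj)) (t2 := 1)); last by rewrite !addn1.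
move=> s1 [h3 [hm hr]].
have h5 : reg s1 (treg 5) = Z by rewrite hr.
apply: code_op => /=; rewrite h3 h5 -expnSr; first exact: WZ.
split; rewrite /= ?upd_same //; split=> // x hx; by rewrite /upd (negbTE hx) hr.
Qed.

Lemma prelude_ok :
  code W (prelude q) (input es) (q + 7)
    (sim (env_of n (size es) 0) N (hinit es)).
Proof.
have Z2 := Z_ge2; have ZN := Z2_le.
have NW : N <= W by have := W_cube; nia.
have WZ : Z < W by nia.
have reg0 x : reg (input es) x = 0 by [].
pose st v0 v1 v4 v5 s := [/\ reg s (treg 0) = v0, reg s (treg 1) = v1,
  reg s (treg 4) = v4 & reg s (treg 5) = v5] /\
  (forall x, x \notin [:: treg 0; treg 1; treg 4; treg 5] -> reg s x = 0) /\ Defs.mem s = Defs.mem (input es).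
have set_st v0 v1 v4 v5 s j v : st v0 v1 v4 v5 s -> j \in [:: 0; 1; 4; 5] ->
   st (if 0 == j then v else v0) (if 1 == j then v else v1) (if 4 == j then v else v4)
     (if 5 == j then v else v5) (set_reg s (treg j) v).
  move=> [[e0 e1 e4 e5] [eo em]] hj; split; first by rewrite /= !upd_treg e0 e1 e4 e5.
  split=> // x hx /=; rewrite /upd ifF ?eo //; apply/negP => /eqP e; move: hx; rewrite e.
  by move: hj; rewrite !inE !treg_eq => ->.
rewrite /prelude.
have c0 := set_st 0 0 0 0.
apply: (code_seq (t1 := 1) (t2 := q + 6) (P := st n 0 0 0)); last lia.
  eexists; exists 1; split=> //; first exact: exec_fetch.
  exact: (@set_st 0 0 0 0 (input es) 0 n).
move=> s1 h1.
apply: (code_seq (t1 := 1) (t2 := q + 5) (P := st n 0 1 0)); last lia.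
  apply: code_const; first by lia.
  exact: (@set_st _ _ _ _ _ 4 1 h1).
move=> s2 h2.
apply: (code_seq (t1 := 1) (t2 := q + 4) (P := st n (size es) 1 0)); last lia.
  eexists; exists 1; split=> //; first exact: exec_fetch.
  have [[_ _ -> _] [_ ->]] := h2.
  exact: (@set_st _ _ _ _ _ 1 (size es) h2).
move=> s3 h3.
apply: (code_seq (t1 := 1) (t2 := q + 3) (P := st n (size es) 1 (n + size es))); last lia.
  have [[e0 e1 _ _] _] := h3.
  apply: code_op; rewrite e0 e1 /=; first by move: WZ; rewrite /Z; lia.
  exact: (@set_st _ _ _ _ _ 5 (n + size es) h3).
move=> s4 h4.
apply: (code_seq (t1 := 1) (t2 := q + 2) (P := st n (size es) 2 (n + size es))); last lia.
  apply: code_const; first by lia.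
  exact: (@set_st _ _ _ _ _ 4 2 h4).
move=> s5 h5.
apply: (code_seq (t1 := 1) (t2 := q + 1) (P := st n (size es) 2 Z)); last lia.
  have [[_ _ e4 e5] _] := h5.
  apply: code_op; rewrite e4 e5 /=; first exact: WZ.
  exact: (@set_st _ _ _ _ _ 5 Z h5).
move=> s6 [[e0 e1 e4 e5] [eo em]].
apply: (code_imp (power_code_ok e5 (leqnn q))) => // s7 [h3' [hm hx]].
split.
- move=> x; rewrite hx ?vreg_treg // eo //.
  by rewrite !inE !vreg_treg.
- by case=> /=; rewrite hx /breg ?treg_eq //= ?eo // !inE !treg_eq.
- exact: h3'.
move=> k u c hk hu hc; rewrite hm em [RHS]/=; case: ifP => [/andP [/eqP-> /eqP->]|h].
  by rewrite /taddr mul0n.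
(* All other rows start at an address of at least [N >= Z * Z], which is past the [2m + 2] input
   cells, in zero memory. *)
apply: nth_default; rewrite input_size /taddr.
have : 0 < u * N + k by case: k h {hk} => [|k] /=; [case: u hu => // u _ _; nia|lia].
by move: ZN; rewrite /Z; nia.
Qed.

Lemma program_ok A d M :
  connected G -> ~ admits_one_join G ->
  d = hr (run (env_of n (size es) 0) phase1 (hinit es)) vD ->
  hcost (env_of n (size es) 0) phase1 + hcost (env_of n (size es) d) phase2 <= A * M ->
  n + size es + A * M < N ->
  code W (program q) (input es) (A * M + q + 9) (correct_output G).
Proof.
move=> cG n1 ed hA hN.
have WC := W_cube; have Z2 := Z_ge2; have ZN := Z2_le.
set c1 := hcost _ phase1 in hA; set c2 := hcost _ phase2 in hA.
rewrite /program.
apply: (code_seq prelude_ok (t2 := A * M + 2)); last lia.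
move=> s1 sim1.
have b0 := bounded_hinit.
have b1 := run_bounded (env_of n (size es) 0) phase1 b0; rewrite -/c1 in b1.
have lt1 : n + size es + c1 < N by lia.
apply: (code_seq (compile_code (d := 4) WC isT sim1 b0 lt1) (t2 := c2 + 2)); last lia.
move=> s2 [sim2 t2].
set st1 := run _ phase1 _ in ed b1 sim2.
apply: (code_seq (t1 := 1) (t2 := c2 + 1)
  (P := fun s => sim (env_of n (size es) 0) N st1 s /\ reg s (treg 4) = 0)); last lia.
  apply: code_const; first by nia.
  split; last by rewrite /= upd_same.
  exact: (sim_frame (d := 4) isT sim2 (frame_set 0 (leqnn 4) (frame_refl 4 s2))).
move=> s3 [sim3 r4].
apply: (code_seq (t1 := 1) (t2 := c2)
  (P := sim (env_of n (size es) d) N st1)); last lia.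
  have hd : d <= n + size es + c1 by rewrite ed; have [h _] := b1; apply: h.
  apply: code_op; rewrite (sim_reg sim3) r4 /= addn0 -ed; first nia.
  have [h1 h2 h3 h4] := sim3.
  have hu j : reg (set_reg s3 (treg 2) d) (treg j) = if j == 2 then d else reg s3 (treg j).
    exact: upd_treg.
  split=> //.
  - by move=> x; rewrite -h1; apply: upd_vt.
  - by case; rewrite hu //; [apply: (h2 Bn)|apply: (h2 Bm)].
move=> s4 sim4.
have lt2 : n + size es + c1 + c2 < N by lia.
apply: (code_imp (compile_code (d := 4) WC isT sim4 b1 lt2)) => // s5 [sim5 _].
have hcell c : c < N -> Defs.mem s5 c = ht (run (env_of n (size es) d) phase2 st1) kI 0 c.
  by move=> hc; rewrite -(sim_mem sim5) // ?/taddr //; nia.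
have envn : env_of n (size es) 0 Bn = n by [].
have envm : env_of n (size es) 0 Bm = size es by [].
have := run_build esG envn envm; rewrite -/phase1 -/st1 => -[[hI hl] z hd _].
have hd' x : size (nbl es x) <= env_of n (size es) d BD by rewrite /= ed.
have nbm x y : (y \in nbl es x) = cadj G x y by rewrite mem_nbl (rel_of_edges esG).
have := run_phase2 (uniq_nbl esG) nbm hd' (erefl n) esG (erefl (size es)) cG n1 hI hl z.
set f := ht _ kI 0 => hf.
have N0 : 0 < N by nia.
have pt l : part n s5 l = part_of n f l.
  by apply/setP => x; rewrite !inE hcell //; apply: leq_ltn_trans (ltn_ord x) _; nia.
case: hf => [[f0 J]|[f0 nj]]; [left|right]; rewrite /answer hcell //; split=> //.
by rewrite /output_two_join !pt.
Qed.

End Assembly.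

Theorem theorem20 :
  exists (p : cmd) (C k : nat),
  forall (n : nat) (G : sgraph 'I_n) (es : seq ('I_n * 'I_n)),
    connected G ->
    ~ admits_one_join G ->
    edge_list G es ->
    let m := num_edges G in
    let D := max_degree G in
    exists (s : state) (t : nat),
      [/\ exec ((n + m + 2) ^ k) p (input es) s t,
          t <= C * (1 + n * m * (D + inv_ackermann m D))
        & correct_output G s].
Proof.
have [A hA] := cost_bound.
(* The row width [Z ^ q] with [Z = n + m + 2] must exceed [n + m + A * M], a bound on all values.
   Here [M <= 4 * Z ^ 3], and [A < Z ^ A] absorbs the constant, so this exponent is ample. *)
pose q := 2 * A + 10.
(* [2 * A] pays for the loop program, as [M] is at most twice the final bound, and [q + 9] for the
   prelude and the code between the phases. The exponent [3 * q] makes room for the three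
   base-[Z ^ q] digits of an address. *)
exists (program q), (2 * A + q + 9), (3 * q) => n G es cG n1 esG m D.
have em : num_edges G = size es by rewrite (size_edges esG).
rewrite /m em {m}; set m := size es.
set d := hr (run (env_of n m 0) phase1 (hinit es)) vD.
pose M := 2 * (1 + n * m * D).
have := run_build esG (erefl : env_of n m 0 Bn = n) (erefl : env_of n m 0 Bm = size es).
move=> [_ _ _ hd]; rewrite -/phase1 -/d -/D in hd.
have mP : 0 < m -> 0 < D /\ D < n.
  rewrite /m => m0; have [[x y] xy] : exists e, e \in es.
    by case: (es) m0 => // e es' _; exists e; rewrite mem_head.
  have g : G x y by have [_ h _] := esG; apply: h.
  split; first exact: max_degree_gt0 g.
  by apply: max_degree_lt; apply: leq_ltn_trans (leq0n x) (ltn_ord x).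
have m0P : m = 0 -> n <= 1 /\ D = 0.
  move=> m0; have e0 : es = [::] by apply: size0nil.
  move: esG; rewrite e0 => esG0; split; first exact: edge_list_nil esG0.
  apply/eqP; rewrite -leqn0; apply/bigmax_leqP => x _; rewrite leqn0 cards_eq0.
  by apply/eqP/setP => y; rewrite !inE; apply/negP => g; have [_ _ /(_ _ _ g)] := esG0.
have [[l1 l2 l3 l4] [l5 l6 l7]] := monomials_le mP m0P hd.
have hc := hA n m d M isT l1 l2 l3 l4 l5 l6 l7.
have q1 : 1 < q by rewrite /q; lia.
have hN : n + m + A * M < (n + m + 2) ^ q.
  set Z := n + m + 2.
  have Dn : D <= n.
    have [m0|mpos] := posnP m; first by have [_ ->] := m0P m0.
    by have [_ h] := mP mpos; apply: ltnW.
  have Z2 : 1 < Z by rewrite /Z; lia.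
  have MZ : M <= 4 * Z ^ 3.
    rewrite /M !expnS expn0 muln1.
    have h1 : n * m * D <= Z * (Z * Z).
      by rewrite -mulnA !leq_mul // /Z; lia.
    have : 0 < Z * (Z * Z) by rewrite !muln_gt0 (ltnW Z2).
    by lia.
  have AZ : A < Z ^ A by apply: ltn_expl.
  have : 8 * (A.+1 * Z ^ 4) <= Z ^ 3 * (Z ^ A * Z ^ 4).
    by rewrite leq_mul // ?leq_mul // (leq_exp2r 2 Z (isT : 0 < 3)).
  have Z34 : 2 * Z ^ 3 <= Z ^ 4 by rewrite [Z ^ 4]expnS leq_mul2r Z2 orbT.
  have ZZ : Z <= Z ^ 3 by rewrite -{1}[Z]expn1 leq_exp2l.
  rewrite -!expnD => h.
  have : Z ^ (3 + (A + 4)) <= Z ^ q by rewrite leq_exp2l // /q; lia.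
  have : A * M <= A * (4 * Z ^ 3) by rewrite leq_mul2l MZ orbT.
  have : A * (2 * Z ^ 3) <= A * Z ^ 4 by rewrite leq_mul2l Z34 orbT.
  have : n + m < Z ^ 3 by apply: leq_trans ZZ; rewrite /Z; lia.
  move: h Z34; rewrite [A.+1 * _]mulSn; move: (Z ^ 3) (Z ^ 4) (A * Z ^ 4) (Z ^ q) (Z ^ (3 + _)).
  nat_lia.
have [s [t [ex tl co]]] := program_ok esG q1 cG n1 (erefl d) hc hN.
exists s, t; split=> //.
apply: leq_trans tl _.
set X := 1 + n * m * (D + inv_ackermann m D).
have MX : M <= 2 * X by rewrite /M /X leq_mul2l /= leq_add2l leq_mul2l leq_addr orbT.
have X1 : 0 < X by [].
have : A * M <= A * (2 * X) by rewrite leq_mul2l MX orbT.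
have : q + 9 <= (q + 9) * X by rewrite leq_pmulr.
rewrite !mulnDl; nat_lia.
Qed.
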